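(* Let $n\ge1$ be an integer and $q>0$. Let $\alpha$ be the law of the two-sided stationary Markov chain $(x^r)_{r\in\mathbb{Z}}$ on $C_n$ with one-time marginal $\mu$ and transition kernel $m_q$. Then $\alpha$ defines a determinantal point process on $[0,2\pi)^{\mathbb{Z}}$ with space-time correlation kernel $$K(r,a;s,b)=\begin{cases}\dfrac1{2\pi}\displaystyle\sum_{k=0}^{n-1}g_k^{\,r-s}e^{i(b-a)k}& r\ge s,\\[2mm] -\dfrac1{2\pi}\displaystyle\sum_{k\in\mathbb{Z}\setminus\{0,\ldots,n-1\}}g_k^{\,r-s}e^{i(b-a)k}& r<s,\end{cases}$$ for $r,s\in\mathbb{Z}$ and $a,b\in[0,2\pi)$, where $$g_k=i\left(k-\frac{n-1}2\right)-\log q,$$ which, for $q\ne1$, equals $\left(\int_0^{2\pi}f(u)e^{-iuk}\,du\right)^{-1}$ with $f(u)=\dfrac{(qe^{i(n-1)/2})^{u\bmod 2\pi}}{1-(-1)^{n-1}q^{2\pi}}$.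
   Context: Here $i=\sqrt{-1}$. $C_n$ is the set of conjugacy classes of $U(n)$, identified with unlabelled configurations of $n$ points (with multiplicity) on the unit circle, equivalently with $D_n=\{\theta\in\mathbb{R}^n:0\le\theta_1\le\cdots\le\theta_n<2\pi\}$ via $\theta\mapsto\{e^{i\theta_1},\ldots,e^{i\theta_n}\}$. $dx$ denotes the measure on $C_n$ corresponding to Lebesgue measure on $D_n$. For $x=\{e^{i\theta_1},\ldots,e^{i\theta_n}\}$, $\Delta(x)=\prod_{1\le l<p\le n}|e^{i\theta_l}-e^{i\theta_p}|$, and $\mu(dx)=(2\pi)^{-n}\Delta(x)^2dx$. For $a,b\in D_n$ write $a\prec b$ if $a_1\le b_1<a_2\le b_2<\cdots<a_n\le b_n$, and $a\succ b$ if $b_1<a_1\le b_2<a_2\le\cdots\le b_n<a_n$. For $y=\{e^{ia_1},\ldots,e^{ia_n}\}$, $z=\{e^{ib_1},\ldots,e^{ib_n}\}$ with $a,b\in D_n$, write $y\prec z$ if $a\prec b$ or $a\succ b$, and let $l(y,z)=\sum_j(b_j-a_j)$ if this sum is $\ge0$, and $l(y,z)=\sum_j(b_j-a_j)+2\pi$ otherwise. Let $\mathcal{I}_q(y,z)=q^{l(y,z)}$ if $y\prec z$ and $0$ otherwise. Let $\tilde c_q=\frac1{(n-1)!}\int_0^{2\pi}|1-e^{ir}|^{n-1}q^r\,dr$. The Markov kernel $m_q$ on $C_n$ is, for $\Delta(y)\ne0$, $$m_q(y,dz)=\tilde c_q^{-1}\frac{\Delta(z)}{\Delta(y)}\,\mathcal{I}_q(y,z)\,dz;$$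 it is a Markov kernel with invariant measure $\mu$. Writing $x^r=\{e^{ia_1^r},\ldots,e^{ia_n^r}\}$ with $a^r\in D_n$, the associated point process is the random set of points $\{(r,a^r_j):r\in\mathbb{Z},1\le j\le n\}$ in $\mathbb{Z}\times[0,2\pi)$. That it is determinantal with space-time correlation kernel $K$ means that, with respect to the product of counting measure on $\mathbb{Z}$ and Lebesgue measure on $[0,2\pi)$, its $p$-point correlation functions are $\det\left(K(r_u,a_u;r_v,a_v)\right)_{1\le u,v\le p}$ for every $p\ge1$. Conventions: $g_k^0=1$ (also if $g_k=0$); for $s=r+1$ the infinite series, which is only conditionally convergent, is understood as a limit of symmetric partial sums, and $K$ matters only up to Lebesgue-null sets. $u\bmod 2\pi\in[0,2\pi)$ and $(qe^{i(n-1)/2})^{t}=q^te^{it(n-1)/2}$. *)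

(* Defs.v *)
From HB Require Import structures.
From mathcomp Require Import all_boot all_order all_algebra.
From mathcomp Require Import all_classical all_reals all_analysis.
From mathcomp Require Import measurable_realfun complex.

Set Implicit Arguments.
Unset Strict Implicit.
Unset Printing Implicit Defensive.

Import Order.TTheory GRing.Theory Num.Theory.
Import numFieldNormedType.Exports.
Local Open Scope classical_set_scope.
Local Open Scope ring_scope.
Local Open Scope complex_scope.

Section tuple_measure.
Context (d : measure_display) (T : measurableType d) (R : realType).
Variable mu : {sigma_finite_measure set T -> \bar R}.

Definition cons_pair (n : nat) (xt : T * n.-tuple T) : n.+1.-tuple T :=
  [tuple of xt.1 :: xt.2].

Lemma measurable_cons_pair (n : nat) : measurable_fun setT (@cons_pair n).
Proof. exact: measurable_cons. Qed.

Definition tuple_measureS (n : nat)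
    (m : {sigma_finite_measure set (n.-tuple T) -> \bar R}) :=
  pushforward (mu \x m)%E (@cons_pair n).

Section tuple_measureS_instances.
Variables (n : nat) (m : {sigma_finite_measure set (n.-tuple T) -> \bar R}).


Let tuple_measureS0 : tuple_measureS m set0 = 0%E.
Proof. by rewrite /tuple_measureS /pushforward preimage_set0 measure0. Qed.

Let tuple_measureS_ge0 A : (0 <= tuple_measureS m A)%E.
Proof. by rewrite /tuple_measureS /pushforward. Qed.

Let tuple_measureS_additive : semi_sigma_additive (tuple_measureS m).
Proof.
have mc A : measurable A -> measurable (@cons_pair n @^-1` A).
  by move=> mA; rewrite -[X in measurable X]setTI; exact: measurable_cons_pair.
move=> F mF tF mUF; rewrite /tuple_measureS /pushforward preimage_bigcup.
apply: measure_semi_sigma_additive => //.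
- by move=> k; exact: mc.
- apply/trivIsetP => /= i j _ _ ij; rewrite -preimage_setI.
  by move/trivIsetP : tF => /(_ _ _ _ _ ij) ->//; rewrite preimage_set0.
- by rewrite -preimage_bigcup; exact: mc.
Qed.

HB.instance Definition _ := isMeasure.Build _ _ _ (tuple_measureS m)
  tuple_measureS0 tuple_measureS_ge0 tuple_measureS_additive.

Let tuple_measureS_sigma_finite : sigma_finite setT (tuple_measureS m).
Proof.
pose uncons (t : n.+1.-tuple T) := (thead t, [tuple of behead t]).
have unconsK : cancel uncons (@cons_pair n).
  by move=> t; rewrite /cons_pair /uncons/= [RHS]tuple_eta.
have consK : cancel (@cons_pair n) uncons.
  by move=> [x t]; rewrite /uncons theadE; congr pair; exact/val_inj.
have muncons : measurable_fun setT uncons.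
  apply/measurable_fun_pairP; split; first exact: measurable_tnth.
  exact: measurable_behead.
have /sigma_finiteP[F [TF ndF Foo]] := sigma_finiteT mu.
have /sigma_finiteP[G [TG ndG Goo]] := sigma_finiteT m.
exists (fun k => uncons @^-1` (F k `*` G k)).
  apply/esym/seteqP; split => // t _.
  have [k1 _ Fk1] : (\bigcup_k F k) (uncons t).1 by rewrite -TF.
  have [k2 _ Gk2] : (\bigcup_k G k) (uncons t).2 by rewrite -TG.
  exists (maxn k1 k2) => //; split.
    by move: Fk1; exact/subsetPset/ndF/leq_maxl.
  by move: Gk2; exact/subsetPset/ndG/leq_maxr.
move=> k; have [mFk Fk] := Foo k; have [mGk Gk] := Goo k; split.
  by rewrite -[X in measurable X]setTI; apply: muncons => //; exact: measurableX.
rewrite /tuple_measureS /pushforward.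
rewrite (_ : _ @^-1` _ = F k `*` G k); last first.
  by rewrite -comp_preimage (_ : _ \o _ = id) ?preimage_id//; exact/funext/consK.
by rewrite product_measure1E// lte_mul_pinfty// ge0_fin_numE.
Qed.

HB.instance Definition _ := Measure_isSigmaFinite.Build _ _ _
  (tuple_measureS m) tuple_measureS_sigma_finite.

End tuple_measureS_instances.

Fixpoint tuple_measure (n : nat) :
    {sigma_finite_measure set (n.-tuple T) -> \bar R} :=
  if n is n'.+1 then tuple_measureS (tuple_measure n')
  else (\d_[tuple])%R.

End tuple_measure.

Definition lebesgue_tuple (R : realType) (n : nat) :
    {sigma_finite_measure set (n.-tuple (measurableTypeR R)) -> \bar R} :=
  @tuple_measure _ (measurableTypeR R) R (@lebesgue_measure R) n.

Section complex_valued.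
Context (R : realType).

Definition expi (t : R) : R[i] := cos t +i* sin t.

Definition limC (u : nat -> R[i]) : R[i] :=
  lim ((fun N => complex.Re (u N)) @ \oo) +i* lim ((fun N => complex.Im (u N)) @ \oo).

Definition integralC (D : set R) (f : R -> R[i]) : R[i] :=
  (\int[lebesgue_measure]_(t in D) complex.Re (f t)) +i*
  (\int[lebesgue_measure]_(t in D) complex.Im (f t)).

Definition mod2pi (u : R) : R := u - (Num.floor (u / (2 * pi)))%:~R * (2 * pi).

End complex_valued.

Section chain.
Context (R : realType) (n : nat).
Implicit Types (a b y z theta : n.-tuple R) (B : set (n.-tuple R)) (q : R).

(* The set C_n of configurations is represented by D_n, so that the integrals
   over C_n with respect to dx are Lebesgue integrals over D_n. *)
Definition Dn : set (n.-tuple R) :=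
  [set theta : n.-tuple R | sorted <=%R theta /\ 
    forall j, 0 <= tnth theta j < 2 * pi].

Definition Delta theta : R :=
  \prod_(l < n) \prod_(p < n | (l < p)%N)
    Normc.normc (expi (tnth theta l) - expi (tnth theta p)).

Definition mu B : \bar R :=
  (\int[lebesgue_tuple R n]_(x in B `&` Dn)
     ((2 * pi) ^- n * Delta x ^+ 2)%:E)%E.

(* a_1 <= b_1 < a_2 <= b_2 < ... < a_n <= b_n *)
Definition interlace_le a b : bool :=
  [forall j, tnth a j <= tnth b j] &&
  [forall j : 'I_n, forall k : 'I_n,
     (k == j.+1 :> nat) ==> (tnth b j < tnth a k)].

(* b_1 < a_1 <= b_2 < a_2 <= ... <= b_n < a_n *)
Definition interlace_gt a b : bool :=
  [forall j, tnth b j < tnth a j] &&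
  [forall j : 'I_n, forall k : 'I_n,
     (k == j.+1 :> nat) ==> (tnth a j <= tnth b k)].

Definition interlace y z : bool := interlace_le y z || interlace_gt y z.

Definition gap y z : R :=
  let s := \sum_(j < n) (tnth z j - tnth y j) in
  if 0 <= s then s else s + 2 * pi.

Definition interlace_weight q y z : R :=
  if interlace y z then q `^ gap y z else 0.

Definition normalization q : R :=
  (n.-1)`!%:R^-1 *
  \int[lebesgue_measure]_(r in `[0, 2 * pi])
     (Normc.normc (1 - expi r) ^+ n.-1 * q `^ r).

(* The division by Delta y makes this the zero measure when Delta y = 0; such
   configurations y form a mu-negligible set. *)
Definition chain_kernel q y B : \bar R :=
  (\int[lebesgue_tuple R n]_(z in B `&` Dn)
     ((normalization q)^-1 * (Delta z / Delta y) * interlace_weight q y z)%:E)%E.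

Definition past d (Omega : measurableType d) (x : int -> Omega -> n.-tuple R)
    (r : int) : set (set Omega) :=
  <<s [set A | exists s B, [/\ s <= r, measurable B & A = x s @^-1` B]] >>.

Definition stationary_markov_chain q d (Omega : measurableType d)
    (P : probability Omega R) (x : int -> Omega -> n.-tuple R) : Prop :=
  [/\ forall r, measurable_fun setT (x r),
      forall r omega, Dn (x r omega),
      forall r B, measurable B -> P (x r @^-1` B) = mu B &
      forall r A B, past x r A -> measurable B ->
        P (A `&` x (r + 1) @^-1` B) =
        (\int[P]_(omega in A) chain_kernel q (x r omega) B)%E].

Definition point_process (Omega : Type) (x : int -> Omega -> n.-tuple R)
    (omega : Omega) : set (int * R) :=
  [set z | exists j : 'I_n, z.2 = tnth (x z.1 omega) j].

End chain.

Section determinantal.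
Context (R : realType).
Context (d : measure_display) (Omega : measurableType d).
Variables (P : probability Omega R) (Xi : Omega -> set (int * R)).

Definition box (p : nat) : set (p.-tuple R) :=
  [set a | forall u, 0 <= tnth a u < 2 * pi].
Arguments box p : clear implicits.

(* A point ((r_1, a_1), ..., (r_p, a_p)) of (Z x [0, 2 pi))^p is given as the
   pair of tuples (r, a). The reference measure on Z x [0, 2 pi) is the product
   of the counting and Lebesgue measures, whose p-th power has the integral
   \esum_r \int_(a in box p). *)
Definition correlation_function (p : nat)
    (rho : p.-tuple int -> p.-tuple R -> R) : Prop :=
  [/\ forall r, measurable_fun setT (rho r),
      forall r a, 0 <= rho r a &
      forall h : p.-tuple int -> p.-tuple R -> \bar R,
        (forall r, measurable_fun setT (h r)) ->
        (forall r a, 0 <= h r a)%E ->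
        ((\int[P]_omega
            \esum_(z in [set z : p.-tuple (int * R) |
                          uniq z /\ forall u, Xi omega (tnth z u)])
              h (map_tuple fst z) (map_tuple snd z)) =
         \esum_(r in [set: p.-tuple int])
           \int[lebesgue_tuple R p]_(a in box p) (h r a * (rho r a)%:E))%E].

(* The density rho is only determined up to negligible sets, and the
   determinant is required to be real and nonnegative almost everywhere. *)
Definition determinantal (K : int -> R -> int -> R -> R[i]) : Prop :=
  forall p : nat, (0 < p)%N ->
  exists rho : p.-tuple int -> p.-tuple R -> R,
    correlation_function rho /\
    forall r : p.-tuple int,
      {ae lebesgue_tuple R p, forall a : p.-tuple R, box p a ->
        \det (\matrix_(u < p, v < p)
                 K (tnth r u) (tnth a u) (tnth r v) (tnth a v)) =
        (rho r a)%:C}.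

End determinantal.

Section space_time_kernel.
Context (R : realType) (n : nat) (q : R).

Definition g (k : int) : R[i] :=
  'i * (k%:~R - (n.-1)%:R / 2)%:C - (ln q)%:C.

Definition symbol (u : R) : R[i] :=
  (q `^ mod2pi u)%:C * expi (mod2pi u * ((n.-1)%:R / 2)) /
  (1 - (-1) ^+ n.-1 * q `^ (2 * pi))%:C.

(* The sum over the integers -N <= k <= N outside {0, ..., n - 1}. *)
Definition tail_sum (m : int) (t : R) (N : nat) : R[i] :=
  \sum_(0 <= j < N.*2.+1 | ~~ (0 <= j%:Z - N%:Z < n%:Z))
    g (j%:Z - N%:Z) ^ m * expi (t * (j%:Z - N%:Z)%:~R).

Definition space_time_kernel (r : int) (a : R) (s : int) (b : R) : R[i] :=
  if s <= r then
    ((2 * pi)^-1)%:C *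
    \sum_(0 <= k < n) g k%:Z ^ (r - s) * expi ((b - a) * k%:R)
  else - (((2 * pi)^-1)%:C * limC (tail_sum (r - s) (b - a))).

End space_time_kernel.

(* Main.v *)
(* With W = e^{2 pi lam}, lam = log q + i (n - 1) / 2, the tail of the Fourier series in K sums to
   e^{lam u} (C - sum_k J_k(u)), whose jump at u = 0 modulo 2 pi encodes the interlacing relation.
   The kernel reproduces itself, int K(r,a;t,c) K(t,c;s,b) dc = ([t <= r] + [s <= t] - 1) K(r,a;s,b),
   so integrating one point of time t out of a correlation determinant D multiplies it by n minus
   the number of remaining points of time t. With n points at each of m consecutive times, a Schur
   complement computation gives D = const * Delta(x^1)^2 * prod m_q(x^i, x^{i+1}), which is, up to
   a constant, the joint density of the chain; hence D >= 0. Integrating out points yields the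
   nonnegativity of all D and, after symmetrising over the labels inside each configuration, the
   correlation functions up to a constant; testing against h = 1 shows that this constant is 1. *)

Require Import Defs.
From HB Require Import structures.
From mathcomp Require Import all_boot all_order all_algebra.
From mathcomp Require Import fingroup perm.
From mathcomp Require Import all_classical all_reals all_analysis.
From mathcomp Require Import measurable_realfun complex.
From mathcomp Require Import ring lra zify.

Set Implicit Arguments.
Unset Strict Implicit.
Unset Printing Implicit Defensive.

Import Order.TTheory GRing.Theory Num.Theory.
Import numFieldNormedType.Exports.
Import Normc.
Local Open Scope classical_set_scope.
Local Open Scope ring_scope.
Local Open Scope complex_scope.

(** * The sawtooth series *)

Section sawtooth.
Context (R : realType).
Implicit Types (u t : R) (N : nat).

(** Two degeneracies shape the argument. For [q = 1] and odd [n], one [g_k] with [k] in {0, ...,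
    n-1} is zero and [W = 1], so neither the inverse of the diagonal matrix of these [g_k] nor a
    formula for [C] divided by [1 - W] is available; hence the integrals [J_k], the implicit
    relation [tailC_jump], and block determinants polynomial in the [g_k]. For time difference one
    the series is only conditionally convergent, so it is compared with the sawtooth series, whose
    partial sums are uniformly bounded and tend to [pi] inside the period. The shift (n-1)/2 in
    [g_k] is dictated by signs: passing from one interlacing pattern to the other moves a row
    through n - 1 others, and the factor e^{i pi (n-1)} in [W] compensates this, leaving the
    positive weight q^{2 pi} that [gap] records as an added 2 pi. No normalising constant is
    computed. The sign of the one-step constant [\det (cmb q l0)] follows by integrating a two-time
    determinant down to the empty one, which is 1; the total mass of the law fixes the rest. *)

Definition sawtooth N u : R := u + \sum_(0 <= k < N) 2 / k.+1%:R * sin (k.+1%:R * u).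

Definition dirichlet N u : R := 1 + \sum_(0 <= k < N) 2 * cos (k.+1%:R * u).

Lemma is_derive_sawtooth N u : is_derive u 1 (sawtooth N) (dirichlet N u).
Proof.
elim: N => [|N IH].
  rewrite /dirichlet big_geq// addr0.
  have -> : sawtooth 0 = id by apply/funext => x; rewrite /sawtooth big_geq// addr0.
  exact: is_derive_id.
have -> : sawtooth N.+1 =
    sawtooth N + (fun u => 2 / N.+1%:R * sin (N.+1%:R * u)).
  by apply/funext => x; rewrite /sawtooth big_nat_recr//= addrA.
rewrite /dirichlet big_nat_recr//= addrA; apply: is_deriveD.
apply: is_derive_eq.
rewrite /GRing.scale/= mulr1 [cos _ * _]mulrC mulrA divfK ?pnatr_eq0//.
Qed.

Lemma dirichletE N u : dirichlet N u * sin (u / 2) = sin ((N%:R + 2^-1) * u).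
Proof.
elim: N => [|N IH]; first by rewrite /dirichlet big_geq// addr0 mul1r add0r mulrC.
rewrite /dirichlet big_nat_recr//= addrA mulrDl IH.
have -> : (N.+1%:R + 2^-1) * u = N.+1%:R * u + u / 2 by rewrite mulrDl [_ * u in X in _ + X]mulrC.
have -> : (N%:R + 2^-1) * u = N.+1%:R * u - u / 2 by rewrite -natr1; field.
rewrite sinB sinD; ring.
Qed.

Lemma sin_natpi k : sin (k%:R * pi) = 0 :> R.
Proof.
elim: k => [|k IH]; first by rewrite mul0r sin0.
by rewrite -natr1 mulrDl mul1r sinDpi IH oppr0.
Qed.

Lemma cos_natpi_pihalf k : cos ((k%:R + 2^-1) * pi) = 0 :> R.
Proof.
rewrite mulrDl [_^-1 * _]mulrC cosDpihalf sin_natpi oppr0 //.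
Qed.

Lemma sawtooth_pi N : sawtooth N pi = pi :> R.
Proof. by rewrite /sawtooth big1_seq ?addr0// => k _; rewrite sin_natpi mulr0. Qed.

Lemma derive_le_aux (f : R -> R) (df : R -> R) u v : u <= v ->
  (forall t, u <= t <= v -> is_derive t 1 f (df t)) ->
  (forall t, u <= t <= v -> 0 <= df t) -> f u <= f v.
Proof.
move=> uv dfE df0.
have := @ger0_derive1_le_cc R f u v.
move=> H; apply: H => //; last 2 first.
- by rewrite in_itv/= lexx.
- by rewrite in_itv/= uv lexx.
- by move=> x /[!in_itv]/= /andP[a b]; have := dfE x; rewrite (ltW a) (ltW b) => /(_ isT) [].
- move=> x /[!in_itv]/= /andP[a b]; have := dfE x; rewrite (ltW a) (ltW b) => /(_ isT) h.
  by rewrite derive1E derive_val df0// (ltW a) (ltW b).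
- apply: derivable_within_continuous => x /[!in_itv]/= xuv.
  by have [] := dfE x xuv.
Qed.

Lemma sin_half_gt0 u : 0 < u < 2 * pi -> 0 < sin (u / 2).
Proof.
move=> /andP[u0 u2]; apply: sin_gt0_pi; apply/andP; split; first by rewrite divr_gt0.
by rewrite ltr_pdivrMr// mulrC.
Qed.

(** With a = N + 1/2, [dirichlet] is sin(a u) / sin(u/2). Integrating it by parts suggests the
    cosine of a u as correction; the extra [s * cos (u / 2)] makes the derivative keep one sign for
    [s = 1] and for [s = -1]. *)
Let psi N (s u : R) := sawtooth N u +
  (cos ((N%:R + 2^-1) * u) + s * cos (u / 2)) / ((N%:R + 2^-1) * sin (u / 2)).

Let is_derive_psi N s u : sin (u / 2) != 0 -> is_derive u 1 (psi N s)
  (- (s + cos ((N%:R + 2^-1) * u) * cos (u / 2)) / (2 * (N%:R + 2^-1) * sin (u / 2) ^+ 2)).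
Proof.
move=> s0.
have a0 : N%:R + 2^-1 != 0 :> R by rewrite gt_eqF// ltr_wpDl// invr_gt0.
have [d1 d2] : is_derive u 1 (sawtooth N) (dirichlet N u) by exact: is_derive_sawtooth.
have dS := is_derive_sawtooth N u.
have dV : is_derive u 1 (fun t => ((N%:R + 2^-1) * sin (t / 2))^-1 : R)
   (- (((N%:R + 2^-1) * sin (u / 2)) ^- 2) * ((N%:R + 2^-1) * (cos (u / 2) / 2))).
  have b0 : (N%:R + 2^-1) * sin (u / 2) != 0 by rewrite mulf_neq0.
  apply: is_derive_eq; rewrite /GRing.scale/=; field.
  by rewrite s0 gt_eqF// ltr_wpDl// mulr_ge0.
have dC : is_derive u 1 (fun t => cos ((N%:R + 2^-1) * t) + s * cos (t / 2) : R)
   (- ((N%:R + 2^-1) * sin ((N%:R + 2^-1) * u)) - s * sin (u / 2) / 2).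
  apply: is_derive_eq; rewrite /GRing.scale/=; ring.
have -> : psi N s = sawtooth N + (fun t => cos ((N%:R + 2^-1) * t) + s * cos (t / 2)) *
     (fun t => ((N%:R + 2^-1) * sin (t / 2))^-1) by [].
apply: is_derive_eq.
rewrite /GRing.scale/=.
have -> : dirichlet N u = sin ((N%:R + 2^-1) * u) / sin (u / 2).
  by rewrite -dirichletE mulfK.
set a := N%:R + _ in a0 *.
set A := sin (a * u); set B := cos (a * u).
have := cos2Dsin2 (u / 2).
set x := sin (u / 2) in s0 *; set y := cos (u / 2) => hxy.
rewrite [X in _ = - (X + _) / _](_ : s = s * (y ^+ 2 + x ^+ 2)); last by rewrite hxy mulr1.
field.
by rewrite s0.
Qed.

(** [psi N (-1)] increases and [psi N 1] decreases up to [u = pi], where both cosines vanish and the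
    common value is [pi]. So [sawtooth N u] is squeezed around [pi] within the correction term,
    whose numerator is at most 2 in modulus. *)
Lemma sawtooth_bound_half N u : 0 < u <= pi ->
  `|sawtooth N u - pi| <= 2 / ((N%:R + 2^-1) * sin (u / 2)).
Proof.
move=> /andP[u0 upi].
have a0 : 0 < N%:R + 2^-1 :> R by rewrite ltr_wpDl// invr_gt0.
have sg t : u <= t <= pi -> 0 < sin (t / 2).
  move=> /andP[ut tp]; apply: sin_half_gt0; rewrite (lt_le_trans u0 ut)/=.
  by rewrite (le_lt_trans tp)// mulr_natl mulr2n ltrDl pi_gt0.
have cc (x y : R) : `|cos x * cos y| <= 1.
  by rewrite normrM mulr_ile1// ler_norml cos_geN1 cos_le1.
have psipi s : psi N s pi = pi.
  by rewrite /psi sawtooth_pi cos_natpi_pihalf cos_pihalf mulr0 addr0 mul0r addr0.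
have h1 : psi N (-1) u <= pi.
  rewrite -[leRHS](psipi (-1)).
  apply: (@derive_le_aux _ (fun t => - (-1 + cos ((N%:R + 2^-1) * t) * cos (t / 2)) / (2 * (N%:R + 2^-1) * sin (t / 2) ^+ 2))) => // t /sg st.
    by apply: is_derive_psi; rewrite gt_eqF.
  apply: divr_ge0; last by rewrite !mulr_ge0// ?sqr_ge0// ltW.
  by have := cc ((N%:R + 2^-1) * t) (t / 2); rewrite ler_norml => /andP[_]; lra.
have h2 : pi <= psi N 1 u.
  rewrite -[leLHS](psipi 1) -lerN2.
  apply: (@derive_le_aux (fun t => - psi N 1 t) (fun t => - (- (1 + cos ((N%:R + 2^-1) * t) * cos (t / 2)) / (2 * (N%:R + 2^-1) * sin (t / 2) ^+ 2)))) => // t /sg st.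
    by apply: is_deriveN; apply: is_derive_psi; rewrite gt_eqF.
  rewrite -mulNr opprK; apply: divr_ge0; last by rewrite !mulr_ge0// ?sqr_ge0// ltW.
  by have := cc ((N%:R + 2^-1) * t) (t / 2); rewrite ler_norml => /andP[+ _]; lra.
have su : 0 < sin (u / 2) by apply: sg; rewrite lexx upi.
move: h1 h2; rewrite /psi.
set b := (N%:R + 2^-1) in a0 *.
have bs : 0 < (b * sin (u / 2))^-1 by rewrite invr_gt0 mulr_gt0.
have := cos_le1 (b * u); have := cos_geN1 (b * u).
have := cos_le1 (u / 2); have := cos_geN1 (u / 2).
set i := (_)^-1 in bs *; set c1 := cos (u / 2); set c2 := cos (b * u) => *.
rewrite ler_norml; apply/andP; split; nra.
Qed.

Lemma sawtoothN N u : sawtooth N (2 * pi - u) = 2 * pi - sawtooth N u.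
Proof.
rewrite /sawtooth opprD addrA; congr (_ + _); rewrite -sumrN; apply: eq_bigr => k _.
rewrite -mulrN; congr (_ * _).
rewrite mulrBr sinB.
have -> : k.+1%:R * (2 * pi) = (k.+1 * 2)%:R * pi :> R by rewrite natrM mulrA.
rewrite sin_natpi mul0r sub0r.
suff -> : cos ((k.+1 * 2)%:R * pi) = 1 :> R by rewrite mul1r.
elim: k.+1 => [|m IH]; first by rewrite mul0n mul0r cos0.
by rewrite mulSn natrD mulrDl addrC [2 * pi]mulr_natl cosD2pi.
Qed.

Lemma sawtooth_bound N u : 0 < u < 2 * pi ->
  `|sawtooth N u - pi| <= 2 / ((N%:R + 2^-1) * sin (u / 2)).
Proof.
move=> /andP[u0 u2].
have [upi|piu] := leP u pi; first by apply: sawtooth_bound_half; rewrite u0.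
have := @sawtooth_bound_half N (2 * pi - u); rewrite sawtoothN.
have -> : sin ((2 * pi - u) / 2) = sin (u / 2).
  rewrite mulrBl mulrAC divff// mul1r sinB sinpi mul0r sub0r cospi mulN1r opprK//.
rewrite -normrN; have -> : - (2 * pi - sawtooth N u - pi) = sawtooth N u - pi by ring.
by apply; apply/andP; split; lra.
Qed.

Lemma normr_sin_muln k u : `|sin (k%:R * u)| <= k%:R * `|sin u|.
Proof.
elim: k => [|k IH]; first by rewrite !mul0r sin0 normr0.
rewrite -natr1 !mulrDl !mul1r sinD (le_trans (ler_normD _ _))// lerD//.
  rewrite normrM (le_trans _ IH)// ler_piMr// ler_norml cos_geN1 cos_le1//.
by rewrite normrM ler_piMl// ler_norml cos_geN1 cos_le1.
Qed.

(** Uniform in [N], as dominated convergence requires. If [N sin(u/2) <= 1], each of the [N] terms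
    is at most 4 sin(u/2), because |sin(k u)| <= k |sin u|; otherwise the error in [sawtooth_bound]
    is at most 2. *)
Lemma sawtooth_bounded N u : 0 <= u <= 2 * pi -> `|sawtooth N u| <= 2 * pi + 4.
Proof.
move=> /andP[u0 u2].
have p0 : 0 < pi :> R by exact: pi_gt0.
have [->|un0] := eqVneq u 0.
  rewrite /sawtooth add0r big1 ?normr0; first lra.
  by move=> k _; rewrite mulr0 sin0 mulr0.
have [->|un2] := eqVneq u (2 * pi).
  rewrite (_ : 2 * pi = 2 * pi - 0) ?subr0// -{1}[2 * pi]subr0 sawtoothN /sawtooth add0r big1; last first.
    by move=> k _; rewrite mulr0 sin0 mulr0.
  by rewrite subr0 ger0_norm; lra.
have h : 0 < u < 2 * pi by rewrite !lt_neqAle eq_sym un0 un2 u0 u2.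
have s0 := sin_half_gt0 h.
have [Ns|Ns] := leP (N%:R * sin (u / 2)) 1.
  rewrite /sawtooth (le_trans (ler_normD _ _))// lerD//; first by rewrite ger0_norm.
  rewrite (le_trans (ler_norm_sum _ _ _))//.
  apply: (@le_trans _ _ (\sum_(0 <= k < N) 4 * sin (u / 2))).
    apply: ler_sum => k _; rewrite normrM ger0_norm ?divr_ge0//.
    rewrite (le_trans (ler_wpM2l _ (normr_sin_muln _ _))) ?divr_ge0// mulrA divfK ?pnatr_eq0//.
    rewrite {1}(_ : u = u / 2 + u / 2) ?sinD; last by field.
    have := cos_le1 (u / 2); have := cos_geN1 (u / 2) => c1 c2.
    rewrite [X in X + _]mulrC -mulr2n normrMn normrM [`|sin _|]gtr0_norm//.
    rewrite mulr2n.
    have : `|cos (u / 2)| <= 1 by rewrite ler_norml c1 c2.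
    by have := normr_ge0 (cos (u / 2)); nra.
  rewrite sumr_const_nat subn0 -mulr_natl; nra.
have := @sawtooth_bound N u h.
have : 2 / ((N%:R + 2^-1) * sin (u / 2)) <= 2.
  rewrite ler_pdivrMr ?mulr_gt0// ?ltr_wpDl ?invr_gt0//; nra.
by rewrite !ler_norml => hh /andP[]; lra.
Qed.

Lemma sawtooth_cvg u : 0 < u < 2 * pi -> (fun N => sawtooth N u) @ \oo --> (pi : R).
Proof.
move=> h; have s0 := sin_half_gt0 h.
apply/cvgrPdist_le => e e0.
near=> N.
rewrite distrC (le_trans (sawtooth_bound N h))//.
rewrite ler_pdivrMr ?mulr_gt0// ?ltr_wpDl ?invr_gt0//.
have : 2 / (e * sin (u / 2)) <= N%:R.
  by near: N; exact: nbhs_infty_ger.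
rewrite ler_pdivrMr ?mulr_gt0//; nra.
Unshelve. all: by end_near.
Qed.

End sawtooth.

(** * Complex-valued calculus *)

Section complex_calculus.
Context (R : realType).
Implicit Types (z w : R[i]) (t u : R) (f h : R -> R[i]).
Local Notation mu := (@lebesgue_measure R).

Lemma complexD z w : z + w = (complex.Re z + complex.Re w) +i* (complex.Im z + complex.Im w).
Proof. by case: z w => [a b] [c d]. Qed.
Lemma complexM z w : z * w = (complex.Re z * complex.Re w - complex.Im z * complex.Im w)
   +i* (complex.Re z * complex.Im w + complex.Im z * complex.Re w).
Proof. by case: z w => [a b] [c d]. Qed.
Lemma ReD z w : complex.Re (z + w) = complex.Re z + complex.Re w.
Proof. by rewrite complexD. Qed.
Lemma ImD z w : complex.Im (z + w) = complex.Im z + complex.Im w.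
Proof. by rewrite complexD. Qed.
Lemma ReM z w : complex.Re (z * w) = complex.Re z * complex.Re w - complex.Im z * complex.Im w.
Proof. by rewrite complexM. Qed.
Lemma ImM z w : complex.Im (z * w) = complex.Re z * complex.Im w + complex.Im z * complex.Re w.
Proof. by rewrite complexM. Qed.
Lemma ReN z : complex.Re (- z) = - complex.Re z. Proof. by case: z. Qed.
Lemma ImN z : complex.Im (- z) = - complex.Im z. Proof. by case: z. Qed.

Lemma complex_ext z w : complex.Re z = complex.Re w -> complex.Im z = complex.Im w -> z = w.
Proof. by case: z w => [a b] [c d] /= -> ->. Qed.

Lemma normc_ge0 z : 0 <= normc z.
Proof. by case: z => a b; exact: sqrtr_ge0. Qed.
Lemma normcD z w : normc (z + w) <= normc z + normc w.
Proof. exact: (@le_normcD R). Qed.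
Lemma normc_sum I (r : seq I) (P : pred I) (F : I -> R[i]) :
  normc (\sum_(i <- r | P i) F i) <= \sum_(i <- r | P i) normc (F i).
Proof.
elim/big_ind2 : _ => //; first by rewrite normc0.
by move=> x1 x2 y1 y2 h1 h2; rewrite (le_trans (normcD _ _))// lerD.
Qed.
Lemma normr_Re z : `|complex.Re z| <= normc z.
Proof.
case: z => a b /=; rewrite -sqrtr_sqr ler_wsqrtr// lerDl sqr_ge0//.
Qed.
Lemma normr_Im z : `|complex.Im z| <= normc z.
Proof.
case: z => a b /=; rewrite -sqrtr_sqr ler_wsqrtr// lerDr sqr_ge0//.
Qed.
Lemma normc_le z : normc z <= `|complex.Re z| + `|complex.Im z|.
Proof.
case: z => a b /=; rewrite -[leRHS]ger0_norm ?addr_ge0// -sqrtr_sqr ler_wsqrtr//.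
rewrite sqrrD !real_normK ?num_real// lerD2r lerDl mulrn_wge0// mulr_ge0//.
Qed.
Lemma normc_real t : normc t%:C = `|t|.
Proof. by rewrite /= expr0n/= addr0 sqrtr_sqr. Qed.
Lemma normc_expi t : normc (expi t) = 1.
Proof. by rewrite /= cos2Dsin2 sqrtr1. Qed.

Definition cexp z : R[i] := (expR (complex.Re z))%:C * expi (complex.Im z).

Lemma expiD t u : expi (t + u) = expi t * expi u.
Proof.
rewrite /expi complexM/= cosD sinD; congr (_ +i* _).
by rewrite addrC.
Qed.
Lemma expi0 : expi 0 = 1 :> R[i].
Proof. by rewrite /expi cos0 sin0. Qed.
Lemma cexpD z w : cexp (z + w) = cexp z * cexp w.
Proof. by rewrite /cexp ReD ImD expRD expiD rmorphM/=; ring. Qed.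
Lemma cexp0 : cexp 0 = 1.
Proof. by rewrite /cexp/= expR0 expi0 mulr1. Qed.
Lemma cexp_neq0 z : cexp z != 0.
Proof.
apply/eqP => h; have := cexpD z (- z); rewrite subrr cexp0 h mul0r => /eqP.
by rewrite oner_eq0.
Qed.
Lemma cexpN z : cexp (- z) = (cexp z)^-1.
Proof.
by apply: (mulfI (cexp_neq0 z)); rewrite -cexpD subrr cexp0 divff ?cexp_neq0.
Qed.
Lemma expiE t : expi t = cexp ('i * t%:C).
Proof. by rewrite /cexp ReM ImM/= !mul0r !mul1r subrr add0r expR0 mul1r. Qed.
Lemma expi_neq0 t : expi t != 0.
Proof. by rewrite expiE cexp_neq0. Qed.
Lemma expiN t : expi (- t) = (expi t)^-1.
Proof. by rewrite !expiE -cexpN rmorphN/= mulrN. Qed.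
Lemma normc_cexp z : normc (cexp z) = expR (complex.Re z).
Proof. by rewrite normcM normc_expi normc_real mulr1 ger0_norm// expR_ge0. Qed.

Definition cderiv f t l := is_derive t 1 (fun x => complex.Re (f x)) (complex.Re l) /\
  is_derive t 1 (fun x => complex.Im (f x)) (complex.Im l).

Lemma cderiv_cst z t : cderiv (fun=> z) t 0.
Proof. by split; exact: is_derive_cst. Qed.
Lemma cderivD f h t l m : cderiv f t l -> cderiv h t m ->
  cderiv (fun x => f x + h x) t (l + m).
Proof.
move=> [f1 f2] [h1 h2]; split; rewrite ?ReD ?ImD.
  by under eq_fun do rewrite ReD; exact: is_deriveD.
by under eq_fun do rewrite ImD; exact: is_deriveD.
Qed.
Lemma cderivM f h t l m : cderiv f t l -> cderiv h t m ->
  cderiv (fun x => f x * h x) t (l * h t + f t * m).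
Proof.
move=> [f1 f2] [h1 h2]; split.
  under eq_fun do rewrite ReM.
  apply: is_derive_eq.
  by rewrite /GRing.scale/= ReD !ReM; ring.
under eq_fun do rewrite ImM.
apply: is_derive_eq.
by rewrite /GRing.scale/= ImD !ImM; ring.
Qed.
Lemma cderivZ z f t l : cderiv f t l -> cderiv (fun x => z * f x) t (z * l).
Proof. by move=> h; have := cderivM (cderiv_cst z t) h; rewrite mul0r add0r. Qed.
Lemma cderiv_sum I (r : seq I) (P : pred I) (F : I -> R -> R[i]) (L : I -> R[i]) t :
  (forall i, cderiv (F i) t (L i)) ->
  cderiv (fun x => \sum_(i <- r | P i) F i x) t (\sum_(i <- r | P i) L i).
Proof.
move=> H; elim: r => [|a r IH].
  rewrite big_nil (_ : (fun _ => _) = fun=> 0); first exact: cderiv_cst.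
  by apply/funext => x; rewrite big_nil.
rewrite big_cons (_ : (fun _ => _) = fun x => if P a then F a x + \sum_(i <- r | P i) F i x else \sum_(i <- r | P i) F i x).
  by case: ifP => // _; exact: cderivD.
by apply/funext => x; rewrite big_cons.
Qed.
Lemma cderiv_real (k : R -> R) t (l : R) : is_derive t 1 k l -> cderiv (fun x => (k x)%:C) t l%:C.
Proof. by move=> h; split => //=; exact: is_derive_cst. Qed.
Lemma cderiv_cexp z t : cderiv (fun x => cexp (z * x%:C)) t (z * cexp (z * t%:C)).
Proof.
case: z => a b.
have E (x : R) : cexp ((a +i* b) * x%:C) =
   (expR (a * x) * cos (b * x)) +i* (expR (a * x) * sin (b * x)).
  by rewrite /cexp ReM ImM/= !mulr0 subr0 add0r; apply: complex_ext; rewrite ?ReM ?ImM/= !mul0r ?subr0 ?addr0.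
split.
  under eq_fun do rewrite E.
  by apply: is_derive_eq; rewrite /GRing.scale E/=; ring.
under eq_fun do rewrite E.
by apply: is_derive_eq; rewrite /GRing.scale E/=; ring.
Qed.

Definition cintegrable (D : set R) f :=
  mu.-integrable D (EFin \o (fun x => complex.Re (f x))) /\
  mu.-integrable D (EFin \o (fun x => complex.Im (f x))).
Definition cmeasurable (D : set R) f := measurable_fun D (fun x => complex.Re (f x)) /\
  measurable_fun D (fun x => complex.Im (f x)).

Section on_domain.
Variable D : set R.
Hypothesis mD : measurable D.

Lemma cintegrableD f h : cintegrable D f -> cintegrable D h ->
  cintegrable D (fun x => f x + h x).
Proof.
move=> [f1 f2] [h1 h2]; split.
  by rewrite [X in _.-integrable _ X](_ : _ = fun x => ((complex.Re (f x))%:E + (complex.Re (h x))%:E)%E);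
   [exact: integrableD | apply/funext => x /=; rewrite ReD].
by rewrite [X in _.-integrable _ X](_ : _ = fun x => ((complex.Im (f x))%:E + (complex.Im (h x))%:E)%E);
   [exact: integrableD | apply/funext => x /=; rewrite ImD].
Qed.
Lemma integralCD f h : cintegrable D f -> cintegrable D h ->
  integralC D (fun x => f x + h x) = integralC D f + integralC D h.
Proof.
move=> [f1 f2] [h1 h2]; rewrite /integralC complexD/=; congr (_ +i* _).
  by rewrite -RintegralD//; apply: eq_Rintegral => x _; rewrite ReD.
by rewrite -RintegralD//; apply: eq_Rintegral => x _; rewrite ImD.
Qed.
Let intZ (r : R) (k : R -> R) : mu.-integrable D (EFin \o k) -> mu.-integrable D (EFin \o (fun x => r * k x)).
Proof.
move=> h; rewrite [X in _.-integrable _ X](_ : _ = fun x => (r%:E * (k x)%:E)%E); last by apply/funext => x.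
exact: integrableZl.
Qed.
Let intB (k l : R -> R) : mu.-integrable D (EFin \o k) -> mu.-integrable D (EFin \o l) -> mu.-integrable D (EFin \o (fun x => k x - l x)).
Proof.
move=> h1 h2; rewrite [X in _.-integrable _ X](_ : _ = fun x => ((k x)%:E - (l x)%:E)%E); last by apply/funext => x.
exact: integrableB.
Qed.
Let intD (k l : R -> R) : mu.-integrable D (EFin \o k) -> mu.-integrable D (EFin \o l) -> mu.-integrable D (EFin \o (fun x => k x + l x)).
Proof.
move=> h1 h2; rewrite [X in _.-integrable _ X](_ : _ = fun x => ((k x)%:E + (l x)%:E)%E); last by apply/funext => x.
exact: integrableD.
Qed.
Lemma cintegrableZ z f : cintegrable D f -> cintegrable D (fun x => z * f x).
Proof.
move=> [f1 f2]; split.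
  rewrite [X in _.-integrable _ X](_ : _ = EFin \o (fun x => (complex.Re z * complex.Re (f x) - complex.Im z * complex.Im (f x)))).
    by apply: intB; exact: intZ.
  by apply/funext => x /=; rewrite ReM.
rewrite [X in _.-integrable _ X](_ : _ = EFin \o (fun x => (complex.Re z * complex.Im (f x) + complex.Im z * complex.Re (f x)))).
  by apply: intD; exact: intZ.
by apply/funext => x /=; rewrite ImM.
Qed.
Lemma integralCZ z f : cintegrable D f ->
  integralC D (fun x => z * f x) = z * integralC D f.
Proof.
move=> [f1 f2]; rewrite /integralC complexM/=; congr (_ +i* _).
  rewrite -!RintegralZl// -RintegralB//; try exact: intZ.
  by apply: eq_Rintegral => x _; rewrite ReM.
rewrite -!RintegralZl// -RintegralD//; try exact: intZ.
by apply: eq_Rintegral => x _; rewrite ImM.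
Qed.
Lemma cintegrable0 : cintegrable D (fun=> 0).
Proof. by split => /=; exact: integrable0. Qed.
Lemma integralC0 : integralC D (fun=> 0) = 0.
Proof. by rewrite /integralC/= /Rintegral integral0. Qed.
Lemma cintegrable_sum I (r : seq I) (P : pred I) (F : I -> R -> R[i]) :
  (forall i, cintegrable D (F i)) ->
  cintegrable D (fun x => \sum_(i <- r | P i) F i x).
Proof.
move=> H; elim: r => [|a r IH].
  rewrite (_ : (fun _ => _) = fun=> 0); first exact: cintegrable0.
  by apply/funext => x; rewrite big_nil.
rewrite (_ : (fun _ => _) = fun x => if P a then F a x + \sum_(i <- r | P i) F i x else \sum_(i <- r | P i) F i x).
  by case: (P a) => //; apply: cintegrableD => //; exact: H.
by apply/funext => x; rewrite big_cons.
Qed.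
Lemma integralC_sum I (r : seq I) (P : pred I) (F : I -> R -> R[i]) :
  (forall i, cintegrable D (F i)) ->
  integralC D (fun x => \sum_(i <- r | P i) F i x) = \sum_(i <- r | P i) integralC D (F i).
Proof.
move=> H; elim: r => [|a r IH].
  rewrite (_ : (fun _ => _) = fun=> 0); first by rewrite big_nil integralC0.
  by apply/funext => x; rewrite big_nil.
rewrite (_ : (fun _ => _) = fun x => if P a then F a x + \sum_(i <- r | P i) F i x else \sum_(i <- r | P i) F i x).
  by rewrite big_cons; case: ifP => // _; rewrite integralCD ?IH//; exact: cintegrable_sum.
by apply/funext => x; rewrite big_cons.
Qed.
Lemma eq_integralC f h : (forall x, D x -> f x = h x) -> integralC D f = integralC D h.
Proof.
by move=> fh; rewrite /integralC; congr (_ +i* _); apply: eq_Rintegral => x /[!inE] /fh ->.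
Qed.

Hypothesis fD : (mu D < +oo)%E.

Lemma bounded_Rintegrable (k : R -> R) (M : R) : measurable_fun D k ->
  (forall x, D x -> `|k x| <= M) -> mu.-integrable D (EFin \o k).
Proof.
move=> mk kM; apply: measurable_bounded_integrable => //.
exists M; split; first exact: num_real.
by move=> y My x Dx /=; rewrite (le_trans (kM _ Dx))// ltW.
Qed.

Lemma bounded_cintegrable f M : cmeasurable D f ->
  (forall x, D x -> normc (f x) <= M) -> cintegrable D f.
Proof.
move=> [m1 m2] fM; split.
  by apply: (bounded_Rintegrable m1) => x /fM; apply: le_trans; exact: normr_Re.
by apply: (bounded_Rintegrable m2) => x /fM; apply: le_trans; exact: normr_Im.
Qed.

Lemma bounded_cvg_Rintegral (F : nat -> R -> R) (k : R -> R) (M : R) :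
  (forall N, measurable_fun D (F N)) -> measurable_fun D k ->
  (forall N x, D x -> `|F N x| <= M) ->
  {ae mu, forall x, D x -> F ^~ x @ \oo --> k x} ->
  (fun N => \int[mu]_(x in D) F N x) @ \oo --> \int[mu]_(x in D) k x.
Proof.
move=> mF mk FM Fk.
have [||||| ik _ H] := @dominated_convergence _ _ _ mu D mD (fun N => EFin \o F N) (EFin \o k) (cst M%:E).
- by move=> N; apply/measurable_EFinP; exact: mF.
- by apply/measurable_EFinP; exact: mk.
- apply: (@filterS _ (almost_everywhere mu) _ _ _ _ Fk) => x h Dx; apply: cvg_EFin; last exact: h.
  by near=> N.
- by apply: (@bounded_Rintegrable (fun=> M) `|M|).
- by apply: aeW => x N Dx; rewrite /= lee_fin; exact: FM.
apply: (@fine_cvg _ _ _ _ (fun N => \int[mu]_(x in D) (F N x)%:E)%E).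
rewrite /Rintegral fineK//; exact: integrable_fin_num.
Unshelve. all: by end_near.
Qed.

(** Componentwise, because [limC] takes the limits of the real and imaginary parts separately. *)
Definition ccvg (v : nat -> R[i]) z :=
  (fun N => complex.Re (v N)) @ \oo --> complex.Re z /\
  (fun N => complex.Im (v N)) @ \oo --> complex.Im z.

Lemma limCE (v : nat -> R[i]) z : ccvg v z -> limC v = z.
Proof.
move=> [h1 h2]; rewrite /limC (cvg_lim _ h1)// (cvg_lim _ h2)//; by case: z h1 h2.
Qed.

(** Dominated convergence by a constant. Convergence is only asked almost everywhere, since the
    partial sums of the kernel have a different limit at the jump. *)
Lemma bounded_cvg_integralC (F : nat -> R -> R[i]) f (M : R) :
  (forall N, cmeasurable D (F N)) -> cmeasurable D f ->
  (forall N x, D x -> normc (F N x) <= M) ->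
  {ae mu, forall x, D x -> ccvg (F ^~ x) (f x)} ->
  ccvg (fun N => integralC D (F N)) (integralC D f).
Proof.
move=> mF [mf1 mf2] FM Ff; split => /=.
  apply: (@bounded_cvg_Rintegral (fun N x => complex.Re (F N x)) _ M) => //.
  - by move=> N; have [] := mF N.
  - by move=> N x /FM h; rewrite (le_trans _ (h N))// normr_Re.
  - by apply: (@filterS _ (almost_everywhere mu) _ _ _ _ Ff) => x h /h [].
apply: (@bounded_cvg_Rintegral (fun N x => complex.Im (F N x)) _ M) => //.
- by move=> N; have [] := mF N.
- by move=> N x /FM h; rewrite (le_trans _ (h N))// normr_Im.
- by apply: (@filterS _ (almost_everywhere mu) _ _ _ _ Ff) => x h /h [].
Qed.
End on_domain.

Lemma Rintegral_FTC (F k : R -> R) (a b : R) : a <= b ->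
  (forall t, is_derive t 1 F (k t)) -> continuous k ->
  \int[mu]_(x in `[a, b]) k x = F b - F a.
Proof.
rewrite le_eqVlt => /predU1P[<-|ab] dF ck.
  by rewrite subrr set_itv1 /Rintegral integral_set1.
rewrite /Rintegral (@continuous_FTC2 _ k F)//.
- exact: continuous_subspaceT.
- split.
  + by move=> x _; have [] := dF x.
  + by apply: cvg_at_right_filter; apply: differentiable_continuous; apply/derivable1_diffP; have [] := dF a.
  + by apply: cvg_at_left_filter; apply: differentiable_continuous; apply/derivable1_diffP; have [] := dF b.
- by move=> x _; rewrite derive1E; have [_ ->] := dF x.
Qed.

Lemma integralC_FTC (F f : R -> R[i]) (a b : R) : a <= b ->
  (forall t, cderiv F t (f t)) -> (forall t, exists l, cderiv f t l) ->
  integralC `[a, b] f = F b - F a.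
Proof.
move=> ab dF df.
have diffc (k : R -> R) : (forall t, exists l : R, is_derive t 1 k l) -> continuous k.
  move=> h t; apply: differentiable_continuous; apply/derivable1_diffP.
  by have [l []] := h t.
have e1 : \int[mu]_(x in `[a, b]) complex.Re (f x) = complex.Re (F b) - complex.Re (F a).
  apply: (@Rintegral_FTC (fun x => complex.Re (F x)) (fun x => complex.Re (f x)) a b ab).
    by move=> t; have [] := dF t.
  by apply: diffc => t; have [l [h _]] := df t; exists (complex.Re l).
have e2 : \int[mu]_(x in `[a, b]) complex.Im (f x) = complex.Im (F b) - complex.Im (F a).
  apply: (@Rintegral_FTC (fun x => complex.Im (F x)) (fun x => complex.Im (f x)) a b ab).
    by move=> t; have [] := dF t.
  by apply: diffc => t; have [l [_ h]] := df t; exists (complex.Im l).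
rewrite /integralC e1 e2.
by rewrite complexD ReN ImN.
Qed.

Lemma cderiv_cmeasurable (D : set R) f : measurable D -> (forall t, exists l, cderiv f t l) -> cmeasurable D f.
Proof.
move=> mD df.
have diffc (k : R -> R) : (forall t, exists l : R, is_derive t 1 k l) -> measurable_fun D k.
  move=> h; apply: measurable_funS (@measurableT _ _) _ _ => //.
  apply: continuous_measurable_fun => t; apply: differentiable_continuous; apply/derivable1_diffP.
  by have [l []] := h t.
split; apply: diffc => t; have [l [h1 h2]] := df t; [by exists (complex.Re l)|by exists (complex.Im l)].
Qed.

Lemma ccvgD (u v : nat -> R[i]) z w : ccvg u z -> ccvg v w -> ccvg (fun N => u N + v N) (z + w).
Proof.
by move=> [a b] [c d]; split; rewrite ?ReD ?ImD; under eq_fun do rewrite ?ReD ?ImD; exact: cvgD.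
Qed.
Lemma ccvgM (u v : nat -> R[i]) z w : ccvg u z -> ccvg v w -> ccvg (fun N => u N * v N) (z * w).
Proof.
move=> [a b] [c d]; split; rewrite ?ReM ?ImM; under eq_fun do rewrite ?ReM ?ImM.
  by apply: cvgB; exact: cvgM.
by apply: cvgD; exact: cvgM.
Qed.
Lemma ccvg_cst z : ccvg (fun=> z) z.
Proof. by split; exact: cvg_cst. Qed.
Lemma ccvg_unique (v : nat -> R[i]) z w : ccvg v z -> ccvg v w -> z = w.
Proof. by move=> /limCE <- /limCE. Qed.

End complex_calculus.

(** * The conditionally convergent tail of the kernel *)

Section symmetric_sums.
Context (R : realType).
Implicit Types (F G : int -> R[i]) (N : nat).

Definition symsum F N := \sum_(0 <= j < N.*2.+1) F (j%:Z - N%:Z).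

Lemma symsumS F N : symsum F N.+1 = symsum F N + (F N.+1%:Z + F (- N.+1%:Z)).
Proof.
rewrite /symsum doubleS [LHS]big_nat_recl// [X in _ + X = _]big_nat_recr//=.
have -> : \sum_(0 <= i < N.*2.+1) F (i.+1%:Z - N.+1%:Z) = \sum_(0 <= j < N.*2.+1) F (j%:Z - N%:Z).
  by apply: eq_bigr => j _; congr F; lia.
have -> : N.*2.+2%:Z - N.+1%:Z = N.+1%:Z by lia.
by rewrite sub0r; ring.
Qed.

Lemma symsumE F N : symsum F N =
  \sum_(0 <= k < N.+1) F k%:Z + \sum_(0 <= k < N) F (- k.+1%:Z).
Proof.
elim: N => [|N IH].
  rewrite /symsum double0 [X in _ = _ + X]big_nil addr0 [LHS]big_nat1 [RHS]big_nat1.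
  by congr F.
by rewrite symsumS IH [X in _ = X + _]big_nat_recr//= [X in _ = _ + X]big_nat_recr//=; ring.
Qed.

Lemma eq_symsum F G N : (forall k, F k = G k) -> symsum F N = symsum G N.
Proof. by move=> FG; apply: eq_bigr => j _. Qed.

Lemma symsumZ z F N : symsum (fun k => z * F k) N = z * symsum F N.
Proof. by rewrite /symsum mulr_sumr. Qed.

Lemma dirichlet_symsum N t : (dirichlet N t)%:C = symsum (fun k => expi (t * k%:~R)) N.
Proof.
elim: N => [|N IH].
  by rewrite /symsum big_nat1 mulr0 expi0 /dirichlet big_geq// addr0.
rewrite symsumS -IH /dirichlet big_nat_recr//= addrA rmorphD/=; congr (_ + _).
rewrite rmorphN/= mulrN mulrC; apply: complex_ext; rewrite ?ReD ?ImD/=.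
  by rewrite cosN -pmulrn mulrC [N.+1%:R * t]mulrC; ring.
by rewrite sinN subrr.
Qed.

Lemma symsum_in (n N : nat) F : (n <= N)%N ->
  symsum (fun k => if (0 <= k < n%:Z) then F k else 0) N = \sum_(0 <= k < n) F k%:Z.
Proof.
move=> nN; rewrite symsumE [X in _ + X = _](_ : _ = 0) ?addr0; last first.
  by rewrite big1// => k _; rewrite (_ : (0 <= - k.+1%:Z < n%:Z) = false)//; lia.
rewrite (big_cat_nat (n := n))//=; last by rewrite ltnW.
rewrite [X in _ + X]big_nat_cond [X in _ + X]big1 ?addr0; last first.
  by move=> k kn; rewrite ifF//; lia.
by rewrite !big_nat; apply: eq_bigr => k kn; rewrite ifT//; lia.
Qed.

End symmetric_sums.

(** * Sequences with increments of order 1/N^2 *)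

Section cvg_criterion.
Context (R : realType).

Lemma telescope_bound (w : nat -> R) (c : R) (n0 : nat) : (0 < n0)%N -> 0 <= c ->
  (forall N, (n0 <= N)%N -> `|w N.+1 - w N| <= c * (N%:R^-1 - N.+1%:R^-1)) ->
  forall m, `|w (m + n0)%N - w n0| <= c * (n0%:R^-1 - (m + n0)%:R^-1).
Proof.
move=> n00 c0 H; elim=> [|m IH]; first by rewrite add0n !subrr normr0 mulr0.
have := H (m + n0)%N (leq_addl _ _); rewrite -addSn => h.
rewrite (_ : w (m.+1 + n0)%N - w n0 = (w (m.+1 + n0)%N - w (m + n0)%N) + (w (m + n0)%N - w n0)); last ring.
rewrite (le_trans (ler_normD _ _))// (le_trans (lerD h IH))//.
by rewrite -mulrDr ler_wpM2l//; lra.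
Qed.

(** From [n0] on, [w N + c / N] is nonincreasing, since the majorant telescopes, and it is bounded
    below by [telescope_bound]. *)
Lemma telescope_cvg (w : nat -> R) (c : R) (n0 : nat) : (0 < n0)%N -> 0 <= c ->
  (forall N, (n0 <= N)%N -> `|w N.+1 - w N| <= c * (N%:R^-1 - N.+1%:R^-1)) ->
  cvgn w.
Proof.
move=> n00 c0 H.
have B := telescope_bound n00 c0 H.
suff /cvg_ex[l hl] : cvgn (fun m => w (m + n0)%N) by apply/cvg_ex; exists l; rewrite -(cvg_shiftn n0).
pose a m := w (m + n0)%N + c * (m + n0)%:R^-1.
have ca : cvgn a.
  apply: nonincreasing_is_cvgn.
    apply/nonincreasing_seqP => m; rewrite /a addSn.
    have := H (m + n0)%N (leq_addl _ _).
    move: (w (m + n0).+1) (w (m + n0)%N) ((m + n0).+1%:R^-1) ((m + n0)%:R^-1) => A B' C D.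
    by rewrite ler_norml => /andP[_]; nra.
  exists (w n0 - c * n0%:R^-1) => _ [m _ <-]; rewrite /a.
  have : 0 <= c / (m + n0)%:R by rewrite divr_ge0.
  have := B m; rewrite ler_norml mulrBr => /andP[].
  move: (w (m + n0)%N) (w n0) (c / n0%:R) (c / (m + n0)%:R) => A B' C D; lra.
rewrite (_ : (fun m => _) = a - (fun m => c * (m + n0)%:R^-1)); last first.
  by apply/funext => m; rewrite /a !fctE addrK.
apply: is_cvgB => //; apply: is_cvgMr.
apply/cvg_ex; exists (0 : R).
rewrite (cvg_shiftn n0 (fun m => m%:R^-1 : R)).
rewrite -(cvg_shiftn 1); under eq_fun do rewrite addn1.
exact: cvg_harmonic.
Qed.

(** The factor 2 accounts for the real and imaginary parts, which are treated separately. *)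
Lemma ctelescope (v : nat -> R[i]) (c : R) (n0 : nat) : (0 < n0)%N -> 0 <= c ->
  (forall N, (n0 <= N)%N -> normc (v N.+1 - v N) <= c * (N%:R^-1 - N.+1%:R^-1)) ->
  (exists z, ccvg v z) /\ (forall N, (n0 <= N)%N -> normc (v N) <= normc (v n0) + 2 * c).
Proof.
move=> n00 c0 H.
have HR N : (n0 <= N)%N -> `|complex.Re (v N.+1) - complex.Re (v N)| <= c * (N%:R^-1 - N.+1%:R^-1).
  by move=> /H; apply: le_trans; rewrite -ReN -ReD normr_Re.
have HI N : (n0 <= N)%N -> `|complex.Im (v N.+1) - complex.Im (v N)| <= c * (N%:R^-1 - N.+1%:R^-1).
  by move=> /H; apply: le_trans; rewrite -ImN -ImD normr_Im.
split.
  have := telescope_cvg n00 c0 HR => /cvg_ex[x hx].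
  have := telescope_cvg n00 c0 HI => /cvg_ex[y hy].
  by exists (x +i* y).
move=> N n0N; have := telescope_bound n00 c0 HR (N - n0); have := telescope_bound n00 c0 HI (N - n0).
rewrite subnK// => h1 h2.
have : c * (n0%:R^-1 - N%:R^-1) <= c.
  rewrite ler_piMr//.
  have : (n0%:R : R)^-1 <= 1 by rewrite invf_le1 ?ltr0n// ler1n.
  have : 0 <= (N%:R : R)^-1 by rewrite invr_ge0.
  lra.
move=> hc; rewrite (_ : v N = v n0 + (v N - v n0)); last ring.
rewrite (le_trans (normcD _ _))// lerD2l (le_trans (normc_le _))//.
rewrite ReD ReN ImD ImN; lra.
Qed.
End cvg_criterion.

(** * Convergence, closed form and bounds of the tail series *)

Section kernel_analysis.
Context (R : realType) (n : nat) (q : R).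
Hypothesis n_ge1 : (1 <= n)%N.
Hypothesis q_gt0 : 0 < q.
Local Notation mu := (@lebesgue_measure R).
Implicit Types (u t : R) (k : int) (N d : nat).

(** Since [g k = i k - lam], each term e^{iuk} / g_k solves T' = lam T + e^{iuk}; this is why
    e^{-lam u} is the integrating factor for the tail. *)
Definition lam : R[i] := ln q +i* (n.-1%:R / 2).

Lemma gE k : g n q k = 'i * (k%:~R)%:C - lam.
Proof.
rewrite /g /lam; apply: complex_ext; rewrite ?ReD ?ImD ?ReM ?ImM ?ReN ?ImN/=; ring.
Qed.

Definition isin k := 0 <= k < n%:Z.

Lemma g_norm k : (n <= `|k|)%N -> (`|k|%:R / 2 : R) <= normc (g n q k) /\ 1 / 2 <= normc (g n q k) /\ ((n < `|k|)%N -> 1 <= normc (g n q k)).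
Proof.
move=> nk.
have h : (`|k|%:R - n.-1%:R / 2 : R) <= normc (g n q k).
  apply: le_trans (normr_Im _).
  rewrite gE ImD ImN ImM/= !mul0r !mul1r add0r.
  case: k nk => k /= nk; first by rewrite -pmulrn ler_norm.
  rewrite NegzE rmorphN/= -pmulrn -normrN ler_normr; apply/orP; left.
  have : 0 <= (n.-1%:R : R) by []. lra.
have hn : (n%:R : R) = n.-1%:R + 1 by rewrite natr1 prednK.
have hk : (n%:R : R) <= `|k|%:R by rewrite ler_nat.
have n1 : (1 : R) <= n%:R by rewrite ler1n.
split; first lra; split; first lra.
move=> nk1; have : (n.+1%:R : R) <= `|k|%:R by rewrite ler_nat.
rewrite -natr1; lra.
Qed.

Definition tailterm d u k : R[i] :=
  if isin k then 0 else (g n q k ^+ d)^-1 * expi (u * k%:~R).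

Lemma tail_sumE d u N : tail_sum n q (- d%:Z) u N = symsum (tailterm d u) N.
Proof.
rewrite /tail_sum /symsum big_mkcond/=; apply: eq_bigr => j _.
rewrite /tailterm /isin; case: ifP; first by move/negbTE ->; rewrite exprnN.
by move/negbFE ->.
Qed.

Lemma isinN (N : nat) : (n <= N)%N -> isin N%:Z = false /\ isin (- N%:Z) = false.
Proof. rewrite /isin; split; lia. Qed.

Lemma tailterm_bound d u k : (2 <= d)%N -> (n < `|k|)%N ->
  normc (tailterm d u k) <= 4 / `|k|%:R ^+ 2.
Proof.
move=> d2 nk; rewrite /tailterm; have [h1 [_ h2]] := g_norm (ltnW nk).
have k0 : 0 < (`|k|%:R : R) by rewrite ltr0n (leq_ltn_trans _ nk).
case: ifP => _; first by rewrite normc0 divr_ge0// exprn_ge0.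
rewrite normcM normc_expi mulr1 normcV.
have -> : normc (g n q k ^+ d) = normc (g n q k) ^+ d.
  by elim: d {d2} => [|d IH]; rewrite ?expr0 ?normc1// !exprS normcM IH.
have -> : 4 / `|k|%:R ^+ 2 = ((`|k|%:R / 2) ^+ 2)^-1 :> R by field; rewrite gt_eqF.
have gk : 0 < normc (g n q k) by rewrite (lt_le_trans ltr01)// h2.
rewrite lef_pV2 ?posrE ?exprn_gt0 ?divr_gt0//.
apply: (@le_trans _ _ (normc (g n q k) ^+ 2)).
  by rewrite lerXn2r// nnegrE ?divr_ge0// normc_ge0.
by rewrite ler_weXn2l// h2.
Qed.

Let inv_sq_le N : (0 < N)%N -> (N.+1%:R ^+ 2 : R)^-1 <= N%:R^-1 - N.+1%:R^-1.
Proof.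
move=> N0; have Np : 0 < (N%:R : R) by rewrite ltr0n.
rewrite -natr1; have -> : N%:R^-1 - (N%:R + 1)^-1 = (N%:R * (N%:R + 1))^-1 :> R.
  by field; rewrite !gt_eqF// ltr_wpDl.
rewrite lef_pV2 ?posrE ?mulr_gt0 ?exprn_gt0 ?ltr_wpDl//.
by rewrite expr2; nra.
Qed.

(** Absolute convergence: as |g_k| is at least |k| / 2, the two terms added in the step to [N + 1]
    are each at most 4 / (N+1)^2. They give the constant 8 of [ctelescope], and 16 is its double. *)
Lemma tail_ge2 d u : (2 <= d)%N ->
  (exists z, ccvg (tail_sum n q (- d%:Z) u) z) /\
  (forall N, (n <= N)%N -> normc (tail_sum n q (- d%:Z) u N) <= normc (tail_sum n q (- d%:Z) u n) + 16).
Proof.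
move=> d2.
have := @ctelescope R (tail_sum n q (- d%:Z) u) 8 n n_ge1 _ _.
rewrite (_ : 2 * 8 = 16); last by rewrite -natrM.
apply => // N nN.
rewrite !tail_sumE symsumS addrC addKr (le_trans (normcD _ _))//.
have nN' : (n < `|N.+1%:Z|)%N by [].
have nN'' : (n < `|- N.+1%:Z|)%N by lia.
rewrite (le_trans (lerD (tailterm_bound u d2 nN') (tailterm_bound u d2 nN'')))//.
rewrite abszN /= -mulrDl (_ : 4 + 4 = 8) -?natrD// ler_wpM2l// inv_sq_le//.
exact: leq_trans n_ge1 nN.
Qed.

(** Convergence comes from pairing k with -k: [g k + g (-k) = -2 lam], so the two inverses add up to
    -2 lam / (g_k g_{-k}), of order 1/k^2, while each one alone is of order 1/k. *)
Lemma tail1_at0 :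
  (exists z, ccvg (tail_sum n q (- 1%:Z) 0) z) /\
  (exists M, forall N, (n <= N)%N -> normc (tail_sum n q (- 1%:Z) 0 N) <= M).
Proof.
have := @ctelescope R (tail_sum n q (- 1%:Z) 0) (8 * normc lam) n n_ge1 _ _.
case.
- by rewrite mulr_ge0// normc_ge0.
- move=> N nN.
  rewrite !tail_sumE symsumS addrC addKr.
  have nN' : (n < `|N.+1%:Z|)%N by [].
  have nN'' : (n < `|- N.+1%:Z|)%N by lia.
  have [h1 [_ h2]] := g_norm (ltnW nN').
  have [h3 [_ h4]] := g_norm (ltnW nN'').
  have [i1 i2] := isinN (leqW nN).
  rewrite /tailterm i1 i2 !mul0r expi0 !mulr1 !expr1.
  have p1 : 0 < normc (g n q N.+1) by rewrite (lt_le_trans ltr01)// h2.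
  have p2 : 0 < normc (g n q (- N.+1%:Z)) by rewrite (lt_le_trans ltr01)// h4.
  have n1 : g n q N.+1 != 0 by apply: contraTneq p1 => ->; rewrite normc0 ltxx.
  have n2 : g n q (- N.+1%:Z) != 0 by apply: contraTneq p2 => ->; rewrite normc0 ltxx.
  have -> : (g n q N.+1)^-1 + (g n q (- N.+1%:Z))^-1 = (- 2 * lam) * ((g n q N.+1) * (g n q (- N.+1%:Z)))^-1.
    rewrite [in RHS](_ : - 2 * lam = g n q N.+1 + g n q (- N.+1%:Z)).
      by field; rewrite n1 n2.
    by rewrite !gE mulrNz rmorphN/=; ring.
  rewrite !normcM normcV normcM.
  have -> : normc (- 2 : R[i]) = 2.
    rewrite (_ : - 2 = (- 2 : R)%:C); first by rewrite normc_real normrN normr_nat.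
    by rewrite rmorphN/= rmorph_nat.
  rewrite [8 * _]mulrC [2 * _]mulrC -!mulrA.
  rewrite ler_wpM2l ?normc_ge0//.
  apply: (@le_trans _ _ (8 * (N.+1%:R ^+ 2)^-1)); last first.
    by rewrite ler_wpM2l// inv_sq_le//; exact: leq_trans n_ge1 nN.
  have -> : 8 * (N.+1%:R ^+ 2)^-1 = 2 * ((N.+1%:R / 2) * (N.+1%:R / 2))^-1 :> R.
    by field; rewrite addrC natr1 pnatr_eq0.
  rewrite ler_wpM2l// lef_pV2 ?posrE ?mulr_gt0 ?divr_gt0 ?ltr0n//.
  by apply: ler_pM => //; rewrite ?divr_ge0//; move: h1 h3; rewrite abszN /= => ? ?.
- by move=> h1 h2; split => //; eexists; exact: h2.
Qed.

Lemma Re_mulr (z : R[i]) (x : R) : complex.Re (z * x%:C) = complex.Re z * x.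
Proof. by rewrite ReM/= mulr0 subr0. Qed.

(* The integral of e^{g_k t} over [0, u]; it stays meaningful when g_k = 0. *)
Definition J k u : R[i] :=
  if g n q k == 0 then u%:C else (cexp (g n q k * u%:C) - 1) / g n q k.

Lemma gJ k u : g n q k * J k u = cexp (g n q k * u%:C) - 1.
Proof.
rewrite /J; case: eqP => [->|/eqP h]; first by rewrite !mul0r cexp0 subrr.
by rewrite mulrC divfK.
Qed.

Lemma J0 k : J k 0 = 0.
Proof. by rewrite /J; case: eqP => // _; rewrite mulr0 cexp0 subrr mul0r. Qed.

Lemma JD k u t : J k (u + t) = J k u + cexp (g n q k * u%:C) * J k t.
Proof.
rewrite /J; case: eqP => [->|/eqP h]; first by rewrite mul0r cexp0 mul1r rmorphD.
rewrite rmorphD/= mulrDr cexpD; field.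
exact: h.
Qed.

Lemma cderiv_J k u : cderiv (J k) u (cexp (g n q k * u%:C)).
Proof.
rewrite /J; case: eqP => [->|/eqP h].
  by rewrite mul0r cexp0; apply: cderiv_real; exact: is_derive_id.
have -> : (fun u => (cexp (g n q k * u%:C) - 1) / g n q k) =
    (fun u => (g n q k)^-1 * (cexp (g n q k * u%:C) + (- 1))).
  by apply/funext => x; rewrite mulrC.
have := cderivZ (g n q k)^-1 (cderivD (cderiv_cexp (g n q k) u) (cderiv_cst (-1) u)).
by rewrite addr0 mulKf.
Qed.

Lemma expi_cexp u k : expi (u * k%:~R) = cexp ('i * (k%:~R)%:C * u%:C).
Proof. by rewrite expiE rmorphM/=; congr cexp; ring. Qed.

Lemma cexp_lamg k u : cexp (- lam * u%:C) * expi (u * k%:~R) = cexp (g n q k * u%:C).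
Proof. by rewrite expi_cexp -cexpD gE; congr cexp; ring. Qed.

Let cderiv_expi u k : cderiv (fun x => expi (x * k%:~R)) u ('i * (k%:~R)%:C * expi (u * k%:~R)).
Proof.
rewrite expi_cexp (_ : (fun x => _) = fun x => cexp ('i * (k%:~R)%:C * x%:C)); first exact: cderiv_cexp.
by apply/funext => x; rewrite expi_cexp.
Qed.

(** The imaginary part of [g k] vanishes only at k = (n-1)/2, which lies between 0 and n - 1. Hence
    the negative powers in the tail never meet the convention that the inverse of 0 is 0. *)
Lemma g_neq0 k : ~~ isin k -> g n q k != 0.
Proof.
move=> h; have nk : (k < 0) || (n <= `|k|)%N by move: h; rewrite /isin; lia.
apply/eqP => /(congr1 (@complex.Im R)); rewrite gE ImD ImN ImM/= !mul0r !mul1r add0r => /eqP.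
rewrite subr_eq0 => /eqP e.
have hn : (n%:R : R) = n.-1%:R + 1 by rewrite natr1 prednK.
have n1 : (1 : R) <= n%:R by rewrite ler1n.
case/orP: nk => nk.
  have : (k%:~R : R) < 0 by rewrite ltrz0.
  rewrite e; lra.
case: k e nk h => k /=; rewrite /isin.
  rewrite -pmulrn => e nk _; have : (n%:R : R) <= k%:R by rewrite ler_nat.
  lra.
move=> e nk _; have : (Negz k)%:~R < 0 :> R by rewrite ltrz0.
rewrite e; lra.
Qed.

(** As [i k = g k + lam], differentiating e^{iuk} / g_k returns lam times it plus e^{iuk}. Summed
    over the tail, the latter give the Dirichlet kernel without its terms 0, ..., n - 1. *)
Lemma cderiv_tail1 N u : (n <= N)%N ->
  cderiv (fun x => tail_sum n q (- 1%:Z) x N) u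
   (lam * tail_sum n q (- 1%:Z) u N + (dirichlet N u)%:C - \sum_(0 <= k < n) expi (u * k%:R)).
Proof.
move=> nN.
have -> : (fun x => tail_sum n q (- 1%:Z) x N) = fun x => symsum (fun k => tailterm 1 x k) N.
  by apply/funext => x; rewrite tail_sumE.
have E k : cderiv (fun x => tailterm 1 x k) u
   (lam * tailterm 1 u k + expi (u * k%:~R) - (if isin k then expi (u * k%:~R) else 0)).
  rewrite /tailterm; case: ifPn => h.
    by rewrite mulr0 add0r subrr; exact: cderiv_cst.
  have := cderivZ (g n q k ^+ 1)^-1 (cderiv_expi u k).
  have -> // : (g n q k ^+ 1)^-1 * ('i * (k%:~R)%:C * expi (u * k%:~R)) =
    lam * ((g n q k ^+ 1)^-1 * expi (u * k%:~R)) + expi (u * k%:~R) - 0.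
  have g0 := g_neq0 h.
  rewrite expr1 (_ : 'i * (k%:~R)%:C = g n q k + lam); last by rewrite gE subrK.
  by field.
have := @cderiv_sum R nat (index_iota 0 N.*2.+1) xpredT (fun j x => tailterm 1 x (j%:Z - N%:Z)) _ u (fun j => E _).
rewrite -/(symsum _ _).
rewrite (_ : \sum_(i <- _) _ = lam * tail_sum n q (- 1%:Z) u N + (dirichlet N u)%:C - \sum_(0 <= k < n) expi (u * k%:R)) //.
rewrite big_split/= big_split/= sumrN -mulr_sumr -!/(symsum _ _).
rewrite dirichlet_symsum tail_sumE; congr (_ - _).
rewrite [LHS](_ : _ = symsum (fun k => if 0 <= k < n%:Z then expi (u * k%:~R) else 0) N)//.
by rewrite symsum_in.
Qed.

(* Integrates G' = lam e^{-lam u} S_N, where S_N is the sawtooth, T_N the tail sum and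
   G = e^{-lam u} (T_N - S_N) + sum_k J_k. *)
Lemma tail1_formula N u : (n <= N)%N -> 0 <= u ->
  tail_sum n q (- 1%:Z) u N = (sawtooth N u)%:C + cexp (lam * u%:C) *
   (tail_sum n q (- 1%:Z) 0 N - \sum_(0 <= k < n) J k%:Z u +
    integralC `[0, u] (fun t => lam * (cexp (- lam * t%:C) * (sawtooth N t)%:C))).
Proof.
move=> nN u0.
pose G x := cexp (- lam * x%:C) * (tail_sum n q (- 1%:Z) x N + (- 1) * (sawtooth N x)%:C) + \sum_(0 <= k < n) J k%:Z x.
have dS (x : R) : cderiv (fun y => (sawtooth N y)%:C) x (dirichlet N x)%:C.
  by apply: cderiv_real; exact: is_derive_sawtooth.
have dG (x : R) : cderiv G x (lam * (cexp (- lam * x%:C) * (sawtooth N x)%:C)).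
  have := cderivD (cderivM (cderiv_cexp (- lam) x) (cderivD (cderiv_tail1 x nN) (cderivZ (- 1) (dS x))))
     (@cderiv_sum R nat (index_iota 0 n) xpredT (fun (k : nat) x => J k%:Z x) _ x (fun k : nat => cderiv_J k%:Z x)).
  congr (cderiv _ _ _).
  have -> : \sum_(0 <= k < n) cexp (g n q k%:Z * x%:C) = cexp (- lam * x%:C) * \sum_(0 <= k < n) expi (x * k%:R).
    by rewrite mulr_sumr; apply: eq_bigr => k _; rewrite -cexp_lamg.
  by ring.
have ex (x : R) : exists l, cderiv (fun t => lam * (cexp (- lam * t%:C) * (sawtooth N t)%:C)) x l.
  by eexists; apply: cderivZ; apply: cderivM; [exact: cderiv_cexp|exact: dS].
rewrite (integralC_FTC u0 dG ex) /G.
rewrite mulr0 cexp0 mul1r.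
have -> : sawtooth N 0 = 0 :> R.
  by rewrite /sawtooth add0r big1// => k _; rewrite mulr0 sin0 mulr0.
rewrite mulr0 addr0 [\sum_(0 <= k < n) J k%:Z 0]big1; last by move=> k _; rewrite J0.
rewrite addr0.
have -> : - lam * u%:C = - (lam * u%:C) by rewrite mulNr.
rewrite cexpN.
have := cexp_neq0 (lam * u%:C); move: (cexp _) (tail_sum _ _ _ 0 _) (tail_sum _ _ _ _ _) (\sum_(_ <= _ < _) _) => e A B C e0.
by field.
Qed.

Lemma normc_integralC_le (f : R -> R[i]) (M u : R) : 0 <= u ->
  cmeasurable `[0, u] f -> (forall x, 0 <= x <= u -> normc (f x) <= M) ->
  normc (integralC `[0, u] f) <= 2 * (M * u).
Proof.
move=> u0 [m1 m2] fM.
have mD : measurable (`[0, u] : set R) by exact: measurable_itv.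
have fD : (mu (`[0%R, u] : set R) < +oo)%E.
  by rewrite lebesgue_measure_itv/=; case: ifP => _ //=; rewrite -EFinD ltry.
have fM' (x : R) : (`[0, u]%classic : set R) x -> normc (f x) <= M by rewrite /= in_itv/=; exact: fM.
have M0 : 0 <= M by apply: le_trans (fM 0 _); [exact: normc_ge0|rewrite lexx].
have key (k : R -> R) : measurable_fun `[0, u] k -> (forall x : R, (`[0, u]%classic : set R) x -> `|k x| <= M) ->
   `|\int[mu]_(x in `[0, u]) k x| <= M * u.
  move=> mk kM; have ik := bounded_Rintegrable mD fD mk kM.
  apply: (le_trans (@le_normr_Rintegral _ _ _ mu _ _ mD ik)).
  have iM : mu.-integrable `[0, u] (EFin \o (fun=> M)).
    by apply: (@bounded_Rintegrable _ _ mD fD (fun=> M) M) => // x _; rewrite ger0_norm.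
  have ik' : mu.-integrable `[0, u] (EFin \o (fun x => `|k x|)) by exact: (@integrable_norm _ _ _ mu `[0, u] k ik).
  apply: (le_trans (@le_Rintegral _ _ _ mu _ _ _ mD ik' iM kM)).
  have hm : mu (`[0%R, u]%classic : set R) = u%:E.
    rewrite lebesgue_measure_itv/= lte_fin; case: ltP => h; first by rewrite oppr0 adde0.
    by congr EFin; apply/le_anti; rewrite u0.
  by rewrite Rintegral_cst// [X in fine X]hm.
rewrite (le_trans (normc_le _))// mulr2n mulrDl mul1r lerD// key//.
  by move=> x /fM'; apply: le_trans; exact: normr_Re.
by move=> x /fM'; apply: le_trans; exact: normr_Im.
Qed.

(** Symmetric summation at 0 returns the midpoint of the jump; adding [pi], half the jump, gives the
    limit from the right. *)
Definition tailC : R[i] := limC (tail_sum n q (- 1%:Z) 0) + pi%:C.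

Definition tail1 u : R[i] := cexp (lam * u%:C) * (tailC - \sum_(0 <= k < n) J k%:Z u).

Let ssw u N := integralC `[0, u] (fun t => lam * (cexp (- lam * t%:C) * (sawtooth N t)%:C)).

Let dsw (x : R) N : exists l, cderiv (fun t => lam * (cexp (- lam * t%:C) * (sawtooth N t)%:C)) x l.
Proof.
eexists; apply: cderivZ; apply: cderivM; first exact: cderiv_cexp.
by apply: cderiv_real; exact: is_derive_sawtooth.
Qed.

Let bnd := normc lam * (expR (`|ln q| * (2 * pi)) * (2 * pi + 4)).

Let cexp_bound (s u : R) : 0 <= u <= 2 * pi -> (s = ln q \/ s = - ln q) -> expR (s * u) <= expR (`|ln q| * (2 * pi)).
Proof.
move=> /andP[u0 u2] hs; rewrite ler_expR (le_trans (ler_norm _))// normrM (ger0_norm u0).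
by apply: ler_pM => //; case: hs => ->; rewrite ?normrN.
Qed.

Let sw_bound (x : R) N : 0 <= x <= 2 * pi ->
  normc (lam * (cexp (- lam * x%:C) * (sawtooth N x)%:C)) <= bnd.
Proof.
move=> hx; rewrite normcM ler_wpM2l ?normc_ge0// normcM ler_pM ?normc_ge0//.
  rewrite normc_cexp ReM ReN ImN/= mulr0 subr0.
  by apply: cexp_bound => //; right.
by rewrite normc_real sawtooth_bounded.
Qed.

Let ssw_cvg u : 0 <= u <= 2 * pi -> ccvg (ssw u) (pi%:C * (1 - cexp (- lam * u%:C))).
Proof.
move=> /andP[u0 u2].
have e : integralC `[0, u] (fun t => lam * (cexp (- lam * t%:C) * pi%:C)) = pi%:C * (1 - cexp (- lam * u%:C)).
  rewrite (@integralC_FTC R (fun t => - pi%:C * cexp (- lam * t%:C)))//.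
  - by rewrite mulr0 cexp0; ring.
  - move=> t; have := cderivZ (- pi%:C) (cderiv_cexp (- lam) t).
    by congr (cderiv _ _ _); ring.
  - by move=> t; eexists; apply: cderivZ; apply: cderivM; [exact: cderiv_cexp|exact: cderiv_cst].
rewrite -e.
have mD : measurable (`[0, u] : set R) by exact: measurable_itv.
apply: (@bounded_cvg_integralC R _ mD _ _ _ bnd).
- by rewrite lebesgue_measure_itv/=; case: ifP => _ //=; rewrite -EFinD ltry.
- by move=> N; apply: cderiv_cmeasurable => // t; exact: dsw.
- apply: cderiv_cmeasurable => // t.
  by eexists; apply: cderivZ; apply: cderivM; [exact: cderiv_cexp|exact: cderiv_cst].
- by move=> N x; rewrite /= in_itv/= => /andP[x0 xu]; apply: sw_bound; rewrite x0 (le_trans xu).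
(* At these two points the partial sums of the sawtooth are constantly 0 and 2 pi and do not tend to
   [pi]. *)
- exists ([set 0] `|` [set 2 * pi]); split.
  + by apply: measurableU; exact: measurable_set1.
  + apply/eqP; rewrite eq_le measure_ge0 andbT (le_trans (measureU2 _ _ _))//.
    by have h := @lebesgue_measure_set1 R; rewrite [X in (X + _)%E]h [X in (_ + X)%E]h adde0.
  + move=> x /= nx; apply: contrapT => /not_orP[/eqP x0 /eqP x2]; apply: nx => /[!in_itv]/= /andP[h1 h2].
    apply: ccvgM; first exact: ccvg_cst.
    apply: ccvgM; first exact: ccvg_cst.
    split => /=; last exact: cvg_cst.
    apply: sawtooth_cvg; rewrite lt_neqAle eq_sym x0 h1 lt_neqAle x2/=.
    exact: le_trans u2.
Qed.

Let ccvg_shift (v : nat -> R[i]) z : ccvg (fun N => v (N + n)%N) z -> ccvg v z.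
Proof.
by move=> [h1 h2]; split; rewrite -(cvg_shiftn n).
Qed.
Let ccvg_shift' (v : nat -> R[i]) z : ccvg v z -> ccvg (fun N => v (N + n)%N) z.
Proof.
by move=> [h1 h2]; split;
  [rewrite (cvg_shiftn n (fun N => complex.Re (v N)))|rewrite (cvg_shiftn n (fun N => complex.Im (v N)))].
Qed.

Let tail1_at0_lim : ccvg (tail_sum n q (- 1%:Z) 0) (limC (tail_sum n q (- 1%:Z) 0)).
Proof. by have [[z hz] _] := tail1_at0; rewrite (limCE hz). Qed.

(** The limit [s] of the sawtooth is left open: it is [pi] inside the period but [2 * pi] at the
    right end, and that second value produces [tailC_jump]. *)
Let tail1_cvg_gen u s : 0 <= u <= 2 * pi -> ccvg (fun N => (sawtooth N u)%:C) s ->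
  ccvg (tail_sum n q (- 1%:Z) u) (s + cexp (lam * u%:C) * (limC (tail_sum n q (- 1%:Z) 0) - \sum_(0 <= k < n) J k%:Z u + pi%:C * (1 - cexp (- lam * u%:C)))).
Proof.
move=> hu hs; apply: ccvg_shift.
have -> : (fun N => tail_sum n q (- 1%:Z) u (N + n)%N) = fun N => (sawtooth (N + n)%N u)%:C + cexp (lam * u%:C) *
   (tail_sum n q (- 1%:Z) 0 (N + n)%N - \sum_(0 <= k < n) J k%:Z u + ssw u (N + n)%N).
  apply/funext => N; apply: tail1_formula; first exact: leq_addl.
  by case/andP: hu.
apply: ccvgD; first exact: (ccvg_shift' hs).
apply: ccvgM; first exact: ccvg_cst.
apply: ccvgD; last exact: (ccvg_shift' (ssw_cvg hu)).
apply: ccvgD; last exact: ccvg_cst.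
exact: (ccvg_shift' tail1_at0_lim).
Qed.

Lemma tail1_cvg u : 0 < u < 2 * pi -> ccvg (tail_sum n q (- 1%:Z) u) (tail1 u).
Proof.
move=> hu; have hs : ccvg (fun N => (sawtooth N u)%:C) pi%:C.
  by split => /=; [exact: sawtooth_cvg|exact: cvg_cst].
have hu' : 0 <= u <= 2 * pi by case/andP: hu => a b; rewrite !ltW.
have := tail1_cvg_gen hu' hs; congr ccvg.
rewrite /tail1 /tailC; have -> : - lam * u%:C = - (lam * u%:C) by ring.
rewrite cexpN; have := cexp_neq0 (lam * u%:C).
move: (limC _) (cexp _) (\sum_(_ <= _ < _) _) => A B C h; field.
exact: h.
Qed.

Lemma expi2pi k : expi (2 * pi * k%:~R) = 1 :> R[i].
Proof.
have e m : expi (2 * pi * m%:R) = 1 :> R[i].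
  elim: m => [|m IH]; first by rewrite mulr0 expi0.
  by rewrite -(natr1 m) mulrDr mulr1 expiD IH mul1r /expi mulr_natl cos2pi sin2pi.
case: k => k; first by rewrite -pmulrn e.
by rewrite NegzE rmorphN/= mulrN expiN -pmulrn e invr1.
Qed.

(** The tail sums at 0 and 2 pi coincide by periodicity, while the closed form at 2 pi is taken with
    the sawtooth fixed at 2 pi; equating the two limits gives the relation. It holds also when e^{2
    pi lam} = 1, where it cannot be solved for [tailC]. *)
Lemma tailC_jump : tailC - cexp (lam * (2 * pi)%:C) * (tailC - \sum_(0 <= k < n) J k%:Z (2 * pi)) = (2 * pi)%:C.
Proof.
have p0 : 0 <= pi :> R by exact: pi_ge0.
have hs : ccvg (fun N => (sawtooth N (2 * pi : R))%:C) (2 * pi)%:C.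
  have -> : (fun N => (sawtooth N (2 * pi : R))%:C) = fun=> (2 * pi)%:C.
    apply/funext => N; congr (_%:C); rewrite -{1}[2 * pi]subr0 sawtoothN /sawtooth add0r big1 ?subr0//.
    by move=> k _; rewrite mulr0 sin0 mulr0.
  exact: ccvg_cst.
have hu' : ((0 : R) <= 2 * pi) && (2 * pi <= 2 * (pi : R)) by rewrite lexx andbT; exact: mulr_ge0.
have := tail1_cvg_gen hu' hs.
have -> : tail_sum n q (- 1%:Z) (2 * pi) = tail_sum n q (- 1%:Z) 0.
  apply/funext => N; rewrite !tail_sumE; apply: eq_symsum => k; rewrite /tailterm.
  by rewrite expi2pi mul0r expi0.
move=> /(ccvg_unique tail1_at0_lim).
rewrite /tailC; have -> : - lam * (2 * pi)%:C = - (lam * (2 * pi)%:C) by ring.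
rewrite cexpN; have := cexp_neq0 (lam * (2 * pi)%:C).
move: (cexp _) (\sum_(_ <= _ < _) _) => B C h.
move: (limC _) => A hA; rewrite {1}hA rmorphM/= (_ : 2%:C = 2); last by rewrite rmorph_nat.
by field.
Qed.

Let norm_J_bound k u : 0 <= u <= 2 * pi -> normc (J k u) <= 2 * (expR (`|ln q| * (2 * pi)) * u).
Proof.
move=> /andP[u0 u2].
have ex (t : R) : exists l, cderiv (fun t => cexp (g n q k * t%:C)) t l by eexists; exact: cderiv_cexp.
have <- : integralC `[0, u] (fun t => cexp (g n q k * t%:C)) = J k u.
  by rewrite (integralC_FTC u0 (cderiv_J k) ex) J0 subr0.
apply: normc_integralC_le => //; first by apply: cderiv_cmeasurable => //; exact: measurable_itv.
move=> x /andP[x0 xu]; rewrite normc_cexp Re_mulr.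
have -> : complex.Re (g n q k) = - ln q by rewrite gE ReD ReN ReM/= !mul0r mulr0 subrr add0r.
by apply: cexp_bound; [rewrite x0 (le_trans xu)|right].
Qed.

Lemma tail1_bounded : exists M, forall N u, (n <= N)%N -> 0 <= u <= 2 * pi ->
  normc (tail_sum n q (- 1%:Z) u N) <= M.
Proof.
have [_ [M0 hM0]] := tail1_at0.
set E := expR (`|ln q| * (2 * pi)).
exists (2 * pi + 4 + E * (M0 + n%:R * (2 * (E * (2 * pi))) + 2 * (bnd * (2 * pi)))) => N u nN /andP[u0 u2].
have hu : 0 <= u <= 2 * pi by rewrite u0.
have b0 : 0 <= bnd by rewrite /bnd !mulr_ge0 ?normc_ge0 ?expR_ge0 ?addr_ge0 ?mulr_ge0 ?pi_ge0.
rewrite tail1_formula// (le_trans (normcD _ _))// lerD//.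
  by rewrite normc_real sawtooth_bounded.
rewrite normcM ler_pM ?normc_ge0//.
  rewrite normc_cexp ReM/= mulr0 subr0.
  by apply: cexp_bound => //; left.
rewrite (le_trans (normcD _ _))// lerD//.
  rewrite (le_trans (normcD _ _))// lerD//; first exact: hM0.
  rewrite -mulN1r normcM (_ : normc (-1 : R[i]) = 1); last first.
    rewrite (_ : -1 = (-1 : R)%:C); first by rewrite normc_real normrN1.
    by rewrite rmorphN/= rmorph1.
  rewrite mul1r (le_trans (normc_sum _ _ _))//.
  apply: (@le_trans _ _ (\sum_(0 <= k < n) 2 * (E * (2 * pi)))).
    apply: ler_sum => k _; rewrite (le_trans (norm_J_bound _ hu))//.
    by rewrite ler_wpM2l// ler_wpM2l// expR_ge0.
  by rewrite sumr_const_nat subn0 -[leLHS]mulr_natl.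
apply: (@le_trans _ _ (2 * (bnd * u))).
  apply: normc_integralC_le => //.
    by apply: cderiv_cmeasurable => [|t]; [exact: measurable_itv|exact: dsw].
  by move=> x /andP[x0 xu]; apply: sw_bound; rewrite x0 (le_trans xu).
by rewrite ler_wpM2l// ler_wpM2l.
Qed.

End kernel_analysis.

(** * The kernel and its reproducing property *)

Section complex_measurable.
Context d (T : measurableType d) (R : realType).
Implicit Types (f h : T -> R[i]).

Definition cmfun f := measurable_fun setT (fun x => complex.Re (f x)) /\
  measurable_fun setT (fun x => complex.Im (f x)).

Lemma cmfun_cst z : cmfun (fun=> z).
Proof. by split; exact: measurable_cst. Qed.
Lemma cmfunD f h : cmfun f -> cmfun h -> cmfun (fun x => f x + h x).
Proof.
move=> [f1 f2] [h1 h2]; split.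
  by under eq_fun do rewrite ReD; exact: measurable_funD.
by under eq_fun do rewrite ImD; exact: measurable_funD.
Qed.
Lemma cmfunM f h : cmfun f -> cmfun h -> cmfun (fun x => f x * h x).
Proof.
move=> [f1 f2] [h1 h2]; split.
  by under eq_fun do rewrite ReM; apply: measurable_funB; exact: measurable_funM.
by under eq_fun do rewrite ImM; apply: measurable_funD; exact: measurable_funM.
Qed.
Lemma cmfunN f : cmfun f -> cmfun (fun x => - f x).
Proof. by move=> h; under eq_fun do rewrite -mulN1r; apply: cmfunM => //; exact: cmfun_cst. Qed.
Lemma cmfun_sum I (r : seq I) (P : pred I) (F : I -> T -> R[i]) :
  (forall i, cmfun (F i)) -> cmfun (fun x => \sum_(i <- r | P i) F i x).
Proof.
move=> H; elim: r => [|a r IH].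
  by under eq_fun do rewrite big_nil; exact: cmfun_cst.
under eq_fun do rewrite big_cons.
by case: (P a) => //; apply: cmfunD => //; exact: H.
Qed.
Lemma cmfun_prod I (r : seq I) (P : pred I) (F : I -> T -> R[i]) :
  (forall i, cmfun (F i)) -> cmfun (fun x => \prod_(i <- r | P i) F i x).
Proof.
move=> H; elim: r => [|a r IH].
  by under eq_fun do rewrite big_nil; exact: cmfun_cst.
under eq_fun do rewrite big_cons.
by case: (P a) => //; apply: cmfunM => //; exact: H.
Qed.
Lemma cmfun_if (b : T -> bool) f h : measurable_fun setT b -> cmfun f -> cmfun h ->
  cmfun (fun x => if b x then f x else h x).
Proof.
move=> mb [f1 f2] [h1 h2]; split.
  rewrite (_ : (fun x => _) = fun x => if b x then complex.Re (f x) else complex.Re (h x)).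
    by apply: measurable_fun_ifT.
  by apply/funext => x; case: ifP.
rewrite (_ : (fun x => _) = fun x => if b x then complex.Im (f x) else complex.Im (h x)).
  by apply: measurable_fun_ifT.
by apply/funext => x; case: ifP.
Qed.
Lemma cmfun_cvg (F : nat -> T -> R[i]) f : (forall N, cmfun (F N)) ->
  (forall x, ccvg (F ^~ x) (f x)) -> cmfun f.
Proof.
move=> mF Ff; split.
  apply: (@measurable_fun_cvg _ _ _ _ (fun N x => complex.Re (F N x))).
    by move=> N; have [] := mF N.
  by move=> x _; have [] := Ff x.
apply: (@measurable_fun_cvg _ _ _ _ (fun N x => complex.Im (F N x))).
  by move=> N; have [] := mF N.
by move=> x _; have [] := Ff x.
Qed.
Lemma cmfun_comp (k : R -> R[i]) (u : T -> R) :
  (forall t, exists l, cderiv k t l) -> measurable_fun setT u -> cmfun (fun x => k (u x)).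
Proof.
move=> /(cderiv_cmeasurable (@measurableT _ _)) [k1 k2] mu; split.
  exact: (measurableT_comp k1 mu).
exact: (measurableT_comp k2 mu).
Qed.
Lemma cmfun_expi (u : T -> R) : measurable_fun setT u -> cmfun (fun x => expi (u x)).
Proof.
apply: cmfun_comp => t.
have h : cderiv (fun x => cexp ('i * x%:C)) t ('i * cexp ('i * t%:C)) by exact: cderiv_cexp.
by exists ('i * cexp ('i * t%:C)); move: h; congr cderiv; apply/funext => x; rewrite expiE.
Qed.
End complex_measurable.

Section kernel.
Context (R : realType) (n : nat) (q : R).
Hypothesis n_ge1 : (1 <= n)%N.
Hypothesis q_gt0 : 0 < q.
Local Notation mu := (@lebesgue_measure R).
Implicit Types (a b c u : R) (r s t k : int) (N d : nat).

Definition circ : set R := `[0, 2 * pi[%classic.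
Definition incirc a : bool := 0 <= a < 2 * pi.

Lemma measurable_circ : measurable circ. Proof. exact: measurable_itv. Qed.
Lemma mu_circ : mu circ = (2 * pi)%:E.
Proof.
rewrite /circ lebesgue_measure_itv/= lte_fin mulr_gt0 ?pi_gt0//.
by rewrite oppr0 adde0.
Qed.
Lemma mu_circ_fin : (mu circ < +oo)%E. Proof. by rewrite mu_circ ltry. Qed.

(** For points of [0, 2 pi), the representative of b - a in the one period on which the closed form
    [tail1] is valid. *)
Definition wrap a b := b - a + (if b < a then 2 * pi else 0).

Lemma wrap_itv a b : incirc a -> incirc b -> 0 <= wrap a b < 2 * pi.
Proof.
rewrite /incirc /wrap => /andP[a0 a2] /andP[b0 b2].
by case: ltP => ab; apply/andP; split; lra.
Qed.
Lemma wrap_gt0 a b : incirc a -> incirc b -> a != b -> 0 < wrap a b < 2 * pi.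
Proof.
rewrite /incirc /wrap => /andP[a0 a2] /andP[b0 b2] ab.
move: ab; case: (ltgtP a b) => h //_; apply/andP; split; lra.
Qed.

Lemma tailterm_wrap d a b k : tailterm n q d (wrap a b) k = tailterm n q d (b - a) k.
Proof.
rewrite /tailterm; case: ifP => // _; congr (_ * _).
by rewrite /wrap mulrDl expiD; case: ltP => _; rewrite ?expi2pi ?mul0r ?expi0 mulr1.
Qed.

Lemma tail_sum_wrap d a b N : tail_sum n q (- d%:Z) (wrap a b) N = tail_sum n q (- d%:Z) (b - a) N.
Proof. by rewrite !tail_sumE; apply: eq_symsum => k; exact: tailterm_wrap. Qed.

Definition tailK d a b : R[i] :=
  if d == 1 then tail1 n q (wrap a b) else limC (tail_sum n q (- d%:Z) (b - a)).

Lemma tailK_cvg d a b : (0 < d)%N -> incirc a -> incirc b -> (1 < d)%N || (a != b) ->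
  ccvg (tail_sum n q (- d%:Z) (b - a)) (tailK d a b).
Proof.
rewrite /tailK => d0 ia ib; have [d1 /= ab|d1 _] := eqVneq d 1%N.
  subst d.
  rewrite (_ : tail_sum n q (- 1%:Z) (b - a) = tail_sum n q (- 1%:Z) (wrap a b)).
    by apply: (tail1_cvg n_ge1 q_gt0); exact: wrap_gt0.
  by apply/funext => N; rewrite tail_sum_wrap.
have d2 : (1 < d)%N by case: d d0 d1 => [|[|]].
by have [[z hz] _] := tail_ge2 n_ge1 q_gt0 (b - a) d2; rewrite (limCE hz).
Qed.

(* The space-time kernel with the limit replaced by its closed form, so that it is bounded,
   measurable and defined everywhere; it can only differ where r <> s and a = b, and outside [0, 2 pi). *)
Definition kern r a s b : R[i] :=
  if incirc a && incirc b then
    ((2 * pi)^-1)%:C *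
    (if s <= r then \sum_(0 <= k < n) g n q k%:Z ^ (r - s) * expi ((b - a) * k%:R)
     else - tailK `|r - s|%N a b)
  else 0.

Lemma kern_spec r a s b : incirc a -> incirc b -> (r == s) || (a != b) ->
  kern r a s b = space_time_kernel n q r a s b.
Proof.
move=> ia ib rsab; rewrite /kern /space_time_kernel ia ib/=; case: leP => rs //.
have d0 : (0 < `|r - s|)%N by lia.
rewrite mulrN; congr (- (_ * _)).
have := @tailK_cvg `|r - s|%N a b d0 ia ib; rewrite (_ : a != b); last first.
  by move: rsab; rewrite (lt_eqF rs).
rewrite orbT => /(_ isT) /limCE <-; congr limC.
by congr tail_sum; lia.
Qed.

(** Fourier coefficients of the kernel as a function of b - a. The supports for [s <= r] and for
    [r < s] are complementary, which is what drives [coefM]. *)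
Definition coef r s k : R[i] :=
  if s <= r then (if isin n k then g n q k ^ (r - s) else 0)
  else (if isin n k then 0 else - g n q k ^ (r - s)).

Definition kernN r a s b N : R[i] :=
  ((2 * pi)^-1)%:C * symsum (fun k => coef r s k * expi ((b - a) * k%:~R)) N.

Lemma kernN_le r a s b N : (n <= N)%N -> s <= r ->
  kernN r a s b N = ((2 * pi)^-1)%:C * \sum_(0 <= k < n) g n q k%:Z ^ (r - s) * expi ((b - a) * k%:R).
Proof.
move=> nN sr; congr (_ * _).
rewrite -[RHS](symsum_in (fun k => g n q k ^ (r - s) * expi ((b - a) * k%:~R)) nN).
by apply: eq_symsum => k; rewrite /coef sr /isin; case: ifP; rewrite ?mul0r.
Qed.

Lemma kernN_gt r a s b N : r < s ->
  kernN r a s b N = - (((2 * pi)^-1)%:C * tail_sum n q (- `|r - s|%N%:Z) (b - a) N).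
Proof.
move=> rs; rewrite -mulrN; congr (_ * _); rewrite tail_sumE -mulN1r -symsumZ.
apply: eq_symsum => k; rewrite /coef /tailterm leNgt rs/=; case: ifP => _; rewrite ?mul0r ?mulr0//.
rewrite mulN1r mulNr exprnN; congr (- (_ ^ _ * _)); lia.
Qed.

(** The excluded case is the jump itself: there the partial sums tend to the midpoint, while [kern]
    takes the value from the right. *)
Lemma kernN_cvg r a s b : incirc a -> incirc b -> (s != r + 1) || (a != b) ->
  ccvg (kernN r a s b) (kern r a s b).
Proof.
move=> ia ib h; rewrite /kern ia ib/=; case: leP => rs.
  have sh (v : nat -> R[i]) z : (forall N, (n <= N)%N -> v N = z) -> ccvg v z.
    move=> vz; split; apply: cvg_near_cst; exists n => // N /= nN; rewrite vz//.
  by apply: sh => N nN; rewrite kernN_le.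
rewrite (_ : kernN r a s b = fun N => ((2 * pi)^-1)%:C * - tail_sum n q (- `|r - s|%N%:Z) (b - a) N); last first.
  by apply/funext => N; rewrite kernN_gt// mulrN.
apply: ccvgM; first exact: ccvg_cst.
rewrite -[- tailK _ _ _]mulN1r.
rewrite (_ : (fun x => - _) = fun N => -1 * tail_sum n q (- `|r - s|%N%:Z) (b - a) N); last first.
  by apply/funext => N; rewrite [RHS]mulN1r.
apply: ccvgM; first exact: ccvg_cst.
apply: tailK_cvg => //; first lia.
by move: h; case: (eqVneq s (r + 1)) => [_ /= ->|sn _]; [rewrite orbT|apply/orP; left; lia].
Qed.

Lemma kernN_bounded r s : exists M, forall a b N, (n <= N)%N -> incirc a -> incirc b ->
  normc (kernN r a s b N) <= M.
Proof.
have [sr|rs] := leP s r.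
  exists (normc ((2 * pi)^-1)%:C * \sum_(0 <= k < n) normc (g n q k%:Z ^ (r - s) : R[i])) => a b N nN _ _.
  rewrite kernN_le// normcM ler_wpM2l ?normc_ge0// (le_trans (normc_sum _ _ _))//.
  by apply: ler_sum => k _; rewrite normcM normc_expi mulr1.
suff [M hM] : exists M, forall a b N, (n <= N)%N -> incirc a -> incirc b ->
   normc (tail_sum n q (- `|r - s|%N%:Z) (b - a) N) <= M.
  exists (normc ((2 * pi)^-1)%:C * M) => a b N nN ia ib.
  rewrite kernN_gt// -mulrN normcM ler_wpM2l ?normc_ge0// normcN hM//.
have : (0 < `|r - s|)%N by lia.
move: `|r - s|%N => d d0.
have [->|d1] := eqVneq d 1%N.
  have [M hM] := tail1_bounded n_ge1 q_gt0; exists M => a b N nN ia ib.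
  rewrite -tail_sum_wrap; apply: hM => //.
  by have /andP[-> /ltW] := wrap_itv ia ib.
have d2 : (1 < d)%N by case: d d0 d1 => [|[|]].
exists ((\sum_(0 <= j < n.*2.+1) normc ((g n q (j%:Z - n%:Z) ^+ d)^-1 : R[i])) + 16) => a b N nN _ _.
have [_ h] := tail_ge2 n_ge1 q_gt0 (b - a) d2.
rewrite (le_trans (h N nN))// lerD2r tail_sumE (le_trans (normc_sum _ _ _))//.
apply: ler_sum => j _; rewrite /tailterm; case: ifP => _; first by rewrite normc0 normc_ge0.
by rewrite normcM normc_expi mulr1.
Qed.

Lemma integral_expi k l a b :
  integralC circ (fun c => expi ((c - a) * k%:~R) * expi ((b - c) * l%:~R)) =
  if k == l then (2 * pi)%:C * expi ((b - a) * k%:~R) else 0.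
Proof.
have e c : expi ((c - a) * k%:~R) * expi ((b - c) * l%:~R) =
   (expi (- a * k%:~R) * expi (b * l%:~R)) * cexp ('i * ((k - l)%:~R)%:C * c%:C).
  rewrite -expi_cexp -!expiD; congr expi; rewrite intrD rmorphN/=; ring.
rewrite (eq_integralC (h := fun c => (expi (- a * k%:~R) * expi (b * l%:~R)) * cexp ('i * ((k - l)%:~R)%:C * c%:C))); last by [].
have ci z : cintegrable circ (fun c => cexp ('i * (z%:~R)%:C * c%:C)).
  apply: (@bounded_cintegrable R _ measurable_circ mu_circ_fin _ 1).
    by apply: cderiv_cmeasurable => [|t]; [exact: measurable_circ|eexists; exact: cderiv_cexp].
  by move=> x _; rewrite -expi_cexp normc_expi.
rewrite integralCZ//; last exact: measurable_circ.
have -> : integralC circ (fun c => cexp ('i * ((k - l)%:~R)%:C * c%:C)) =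
  integralC `[0, 2 * pi] (fun c => cexp ('i * ((k - l)%:~R)%:C * c%:C)).
  have m1 (F : R -> R) : measurable_fun circ F -> \int[mu]_(x in circ) F x = \int[mu]_(x in `[0, 2 * pi]) F x.
    by move=> mF; rewrite /circ; congr fine; apply: integral_itv_bndo_bndc; exact/measurable_EFinP.
  have [] : cmeasurable circ (fun c => cexp ('i * ((k - l)%:~R)%:C * c%:C)).
    by apply: cderiv_cmeasurable => [|t]; [exact: measurable_circ|eexists; exact: cderiv_cexp].
  by rewrite /integralC => ? ?; rewrite !m1.
have p0 : 0 <= 2 * pi :> R by rewrite mulr_ge0 ?pi_ge0.
have [->|kl] := eqVneq k l.
  rewrite subrr (integralC_FTC (F := fun x => x%:C) p0).
  - by rewrite subr0 -expiD mulrC; congr (_ * expi _); ring.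
  - by move=> t; rewrite mulr0 mul0r cexp0; apply: cderiv_real; exact: is_derive_id.
  - by move=> t; eexists; exact: cderiv_cexp.
set z := 'i * _.
have z0 : z != 0.
  rewrite /z mulf_neq0//; first by apply/eqP => /(congr1 (@complex.Im R))/= /eqP; rewrite oner_eq0.
  apply/eqP => /(congr1 (@complex.Re R))/= /eqP; rewrite intr_eq0 subr_eq0; exact/negP.
rewrite (integralC_FTC (F := fun x => z^-1 * cexp (z * x%:C)) p0).
- rewrite -!expi_cexp expi2pi mul0r expi0 subrr mulr0//.
- by move=> t; have := cderivZ z^-1 (cderiv_cexp z t); rewrite mulKf.
- by move=> t; eexists; exact: cderiv_cexp.
Qed.

Lemma kernN_cmfun disp (T : measurableType disp) (A B : T -> R) r s N :
  measurable_fun setT A -> measurable_fun setT B ->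
  cmfun (fun x => kernN r (A x) s (B x) N).
Proof.
move=> mA mB; apply: cmfunM; first exact: cmfun_cst.
apply: cmfun_sum => j; apply: cmfunM; first exact: cmfun_cst.
by apply: cmfun_expi; apply: measurable_funM => //; exact: measurable_funB.
Qed.

Lemma measurable_incirc disp (T : measurableType disp) (A : T -> R) :
  measurable_fun setT A -> measurable_fun setT (fun x => incirc (A x)).
Proof.
move=> mA; rewrite /incirc; apply: measurable_and.
  by apply: measurable_fun_ler => //; exact: measurable_cst.
by apply: measurable_fun_ltr => //; exact: measurable_cst.
Qed.

Lemma kern_cmfun disp (T : measurableType disp) (A B : T -> R) r s :
  measurable_fun setT A -> measurable_fun setT B ->
  cmfun (fun x => kern r (A x) s (B x)).
Proof.
move=> mA mB; rewrite /kern.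
apply: cmfun_if; [|apply: cmfunM; first exact: cmfun_cst|exact: cmfun_cst].
  by apply: measurable_and; exact: measurable_incirc.
have [rs|rs] := leP s r.
  apply: cmfun_sum => k; apply: cmfunM; first exact: cmfun_cst.
  by apply: cmfun_expi; apply: measurable_funM => //; exact: measurable_funB.
apply: cmfunN; rewrite /tailK; case: eqP => [_|d1].
  have mw : measurable_fun setT (fun x => wrap (A x) (B x)).
    rewrite /wrap; apply: measurable_funD; first exact: measurable_funB.
    by apply: measurable_fun_ifT => //; exact: measurable_fun_ltr.
  rewrite /tail1; apply: cmfunM.
    by apply: (cmfun_comp (k := fun u => cexp (lam n q * u%:C))) => // t; eexists; exact: cderiv_cexp.
  apply: cmfunD; first exact: cmfun_cst.
  apply: cmfunN; apply: cmfun_sum => k.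
  by apply: (cmfun_comp (k := J n q k)) => // t; eexists; exact: cderiv_J.
have d2 : (1 < `|r - s|)%N by lia.
apply: (cmfun_cvg (F := fun N x => tail_sum n q (- `|r - s|%N%:Z) (B x - A x) N)).
  move=> N; under eq_fun do rewrite tail_sumE.
  apply: cmfun_sum => j; rewrite /tailterm; case: (isin _ _); first exact: cmfun_cst.
  apply: cmfunM; first exact: cmfun_cst.
  by apply: cmfun_expi; apply: measurable_funM => //; exact: measurable_funB.
by move=> x; have [[z hz] _] := tail_ge2 n_ge1 q_gt0 (B x - A x) d2; rewrite (limCE hz).
Qed.

Lemma kern_bounded r s : exists M, forall a b, normc (kern r a s b) <= M.
Proof.
have [sr|rs] := leP s r.
  exists (normc ((2 * pi)^-1)%:C * \sum_(0 <= k < n) normc (g n q k%:Z ^ (r - s) : R[i])) => a b.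
  have h0 : 0 <= normc ((2 * pi)^-1 : R)%:C * \sum_(0 <= k < n) normc (g n q k%:Z ^ (r - s) : R[i]).
    by rewrite mulr_ge0 ?normc_ge0// sumr_ge0// => k _; exact: normc_ge0.
  rewrite /kern; case: ifP => _; last by rewrite normc0.
  rewrite sr normcM ler_wpM2l ?normc_ge0// (le_trans (normc_sum _ _ _))//.
  by apply: ler_sum => k _; rewrite normcM normc_expi mulr1.
have [M hM] := kernN_bounded r s.
exists (Num.max 0 (2 * M + normc (kern r 0 s 0))) => a b.
have [/andP[ia ib]|nab] := boolP (incirc a && incirc b); last first.
  by rewrite /kern (negbTE nab) normc0 le_max lexx.
have M0 : 0 <= M by apply: le_trans (hM a b n (leqnn _) ia ib); exact: normc_ge0.
have n0 := normc_ge0 (kern r 0 s 0).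
have [sab|sab] := boolP ((s != r + 1) || (a != b)).
  rewrite le_max; apply/orP; right.
  have [h1 h2] := kernN_cvg ia ib sab.
  apply: (le_trans (normc_le _)).
  suff : `|complex.Re (kern r a s b)| <= M /\ `|complex.Im (kern r a s b)| <= M by case; lra.
  split.
    have h : (fun N => `|complex.Re (kernN r a s b N)|) @ \oo --> `|complex.Re (kern r a s b)| by exact: cvg_norm.
     rewrite -(cvg_lim _ h)//; apply: limr_le; first by apply/cvg_ex; eexists; exact: h.
    by exists n => // N /= nN; rewrite (le_trans (normr_Re _))// hM.
  have h : (fun N => `|complex.Im (kernN r a s b N)|) @ \oo --> `|complex.Im (kern r a s b)| by exact: cvg_norm.
   rewrite -(cvg_lim _ h)//; apply: limr_le; first by apply/cvg_ex; eexists; exact: h.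
  by exists n => // N /= nN; rewrite (le_trans (normr_Im _))// hM.
(* At the jump [kern] depends only on b - a = 0, so a single value bounds all these points. *)
move: sab; rewrite negb_or !negbK => /andP[/eqP -> /eqP ->].
rewrite le_max; apply/orP; right.
have i0 : incirc 0 by rewrite /incirc lexx mulr_gt0 ?pi_gt0.
suff -> : kern r b (r + 1) b = kern r 0 (r + 1) 0 by lra.
rewrite /kern ib i0/=; have -> : (r + 1 <= r) = false by apply/negbTE; lia.
congr (_ * - _); rewrite /tailK; have -> : absz (r - (r + 1))%R = 1%N by lia.
by rewrite eqxx /wrap !subrr !ltxx.
Qed.

(** For k inside {0, ..., n-1} the product survives only if [s <= t <= r], with factor 1; outside
    only if [r < t < s], with factor -1. In these cases the powers of [g k] add up; in the mixed
    cases the factor is 0. *)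
Lemma coefM r s t k : coef r t k * coef t s k =
  ((t <= r)%R%:R + (s <= t)%R%:R - 1) * coef r s k.
Proof.
rewrite /coef; have [kin|kout] := boolP (isin n k).
  have [tr|rt] := leP t r; have [st|ts] := leP s t; rewrite ?mul0r ?mulr0//=; last 1 first.
  - by rewrite (leNgt s r) (lt_trans rt ts) /= mulr0.
  - rewrite (le_trans st tr) -mulr2n addrK mul1r.
    have -> : r - s = `|r - t|%N%:Z + `|t - s|%N%:Z by lia.
    have -> : r - t = `|r - t|%N%:Z by lia.
    have -> : t - s = `|t - s|%N%:Z by lia.
    by rewrite -exprD.
  - by rewrite addr0 subrr mul0r.
  - by rewrite add0r subrr mul0r.
have g0 := g_neq0 n_ge1 q_gt0 kout.
have [tr|rt] := leP t r; have [st|ts] := leP s t; rewrite ?mul0r ?mulr0//=.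
- by rewrite (le_trans st tr) mulr0.
- by rewrite addr0 subrr mul0r.
- by rewrite add0r subrr mul0r.
- rewrite (leNgt s r) (lt_trans rt ts) /= add0r sub0r mulN1r opprK mulrNN -expfzDr//.
  by congr (_ ^ _); ring.
Qed.

(** Orthogonality of the exponentials makes the reproducing identity exact already for each finite
    [N]; only the passage to the limit needs analysis. *)
Lemma integral_kernN r a s b t N :
  integralC circ (fun c => kernN r a t c N * kernN t c s b N) =
  ((t <= r)%R%:R + (s <= t)%R%:R - 1) * kernN r a s b N.
Proof.
set p := ((2 * pi)^-1)%:C : R[i].
have E c : kernN r a t c N * kernN t c s b N =
  \sum_(0 <= i < N.*2.+1) \sum_(0 <= j < N.*2.+1)
     (p * p * coef r t (i%:Z - N%:Z) * coef t s (j%:Z - N%:Z)) *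
     (expi ((c - a) * (i%:Z - N%:Z)%:~R) * expi ((b - c) * (j%:Z - N%:Z)%:~R)).
  rewrite /kernN -/p /symsum mulrACA big_distrlr/= mulr_sumr; apply: eq_bigr => i _.
  by rewrite mulr_sumr; apply: eq_bigr => j _; ring.
rewrite (@eq_integralC _ circ _ _ (fun c _ => E c)).
have ci k l : cintegrable circ (fun c => expi ((c - a) * k%:~R) * expi ((b - c) * l%:~R)).
  apply: (@bounded_cintegrable R _ measurable_circ mu_circ_fin _ 1).
    have [h1 h2] : cmfun (fun c : R => expi ((c - a) * k%:~R) * expi ((b - c) * l%:~R)).
      by apply: cmfunM; apply: cmfun_expi; apply: measurable_funM => //; apply: measurable_funB.
    by split; exact: measurable_funTS.
  by move=> x _; rewrite normcM !normc_expi mulr1.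
have mc := measurable_circ.
have ciz z k l : cintegrable circ (fun c => z * (expi ((c - a) * k%:~R) * expi ((b - c) * l%:~R))).
  exact: cintegrableZ.
rewrite integralC_sum//; last by move=> i; apply: cintegrable_sum => // j; exact: ciz.
rewrite /kernN -/p mulrCA -symsumZ /symsum mulr_sumr; apply: eq_big_nat => i /andP[_ iN].
rewrite integralC_sum//.
under eq_bigr => j _ do rewrite integralCZ// integral_expi.
rewrite big_mkord (bigD1 (Ordinal iN))//=.
rewrite eqxx big1 ?addr0; last first.
  move=> j ji; rewrite ifN ?mulr0//; apply: contra ji => /eqP e; apply/eqP/val_inj => /=; lia.
rewrite [X in _ = p * X]mulrA -coefM.
have -> : (2 * pi)%:C = p^-1 by rewrite /p fmorphV invrK.
have p0 : p != 0 by rewrite /p fmorph_eq0 invr_neq0// mulf_neq0 ?pnatr_eq0// gt_eqF// pi_gt0.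
move: (coef _ _ _) (coef _ _ _) (expi _) p0 => A B C p0.
clearbody p; field; exact: p0.
Qed.

Lemma integral_kern r a s b t :
  integralC circ (fun c => kern r a t c * kern t c s b) =
  ((t <= r)%R%:R + (s <= t)%R%:R - 1) * kern r a s b.
Proof.
have mc := measurable_circ.
have [ia|nia] := boolP (incirc a); last first.
  rewrite [in RHS]/kern (negbTE nia) mulr0 (@eq_integralC _ circ _ (fun=> 0)) ?integralC0// => c _.
  by rewrite /kern (negbTE nia) mul0r.
have [ib|nib] := boolP (incirc b); last first.
  rewrite [in RHS]/kern (negbTE nib) andbF mulr0 (@eq_integralC _ circ _ (fun=> 0)) ?integralC0// => c _.
  by rewrite /kern (negbTE nib) andbF mulr0.
have [M1 hM1] := kernN_bounded r t; have [M2 hM2] := kernN_bounded t s.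
have i0 : incirc 0 by rewrite /incirc lexx mulr_gt0 ?pi_gt0.
have inC c : circ c -> incirc c by rewrite /circ /= in_itv.
have key : ccvg (fun N => integralC circ (fun c => kernN r a t c (N + n) * kernN t c s b (N + n)))
   (integralC circ (fun c => kern r a t c * kern t c s b)).
  apply: (@bounded_cvg_integralC R _ mc mu_circ_fin _ _ (M1 * M2)).
  - move=> N; have [h1 h2] : cmfun (fun c : R => kernN r a t c (N + n) * kernN t c s b (N + n)).
      by apply: cmfunM; apply: kernN_cmfun.
    by split; exact: measurable_funTS.
  - have [h1 h2] : cmfun (fun c : R => kern r a t c * kern t c s b).
      by apply: cmfunM; apply: kern_cmfun.
    by split; exact: measurable_funTS.
  - move=> N c /inC ic; rewrite normcM ler_pM ?normc_ge0// ?hM1 ?hM2//; exact: leq_addl.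
  - exists ([set a] `|` [set b]); split.
    + by apply: measurableU; exact: measurable_set1.
    + apply/eqP; rewrite eq_le measure_ge0 andbT (le_trans (measureU2 _ _ _))//.
      by have h := @lebesgue_measure_set1 R; rewrite [X in (X + _)%E]h [X in (_ + X)%E]h adde0.
    + move=> c /= nx; apply: contrapT => /not_orP[/eqP ca /eqP cb]; apply: nx => /inC ic.
      apply: ccvgM.
        have [h1 h2] : ccvg (kernN r a t c) (kern r a t c).
          by apply: kernN_cvg => //; rewrite [a == c]eq_sym ca orbT.
        by split; [rewrite (cvg_shiftn n (fun N => complex.Re (kernN r a t c N)))|rewrite (cvg_shiftn n (fun N => complex.Im (kernN r a t c N)))].
      have [h1 h2] : ccvg (kernN t c s b) (kern t c s b).
        by apply: kernN_cvg => //; rewrite cb orbT.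
      by split; [rewrite (cvg_shiftn n (fun N => complex.Re (kernN t c s b N)))|rewrite (cvg_shiftn n (fun N => complex.Im (kernN t c s b N)))].
apply: (ccvg_unique key).
under eq_fun do rewrite integral_kernN.
(* The partial sums on the right may have the wrong limit when [s = r + 1] and [a = b], but then the
   factor is 0 for every [t]. *)
have [e|e] := eqVneq ((t <= r)%R%:R + (s <= t)%R%:R - 1 : R[i]) 0.
  by rewrite e mul0r; under eq_fun do rewrite mul0r; exact: ccvg_cst.
apply: ccvgM; first exact: ccvg_cst.
have [h1 h2] : ccvg (kernN r a s b) (kern r a s b).
  apply: kernN_cvg => //; apply/orP; left; apply: contra e => /eqP ->.
  apply/eqP; have [tr|rt] := leP t r.
    by rewrite (leNgt (r + 1)) (_ : (t < r + 1))/= ?addr0 ?subrr//; lia.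
  by rewrite (_ : (r + 1 <= t))/= ?add0r ?subrr//; lia.
by split; [rewrite (cvg_shiftn n (fun N => complex.Re (kernN r a s b N)))|rewrite (cvg_shiftn n (fun N => complex.Im (kernN r a s b N)))].
Qed.

Lemma integral_kern_diag t : integralC circ (fun c => kern t c t c) = n%:R.
Proof.
rewrite (eq_integralC (h := fun c => (n%:R / (2 * pi))%:C)); last first.
  move=> c; rewrite /circ/= in_itv/= => ic; rewrite /kern /incirc ic lexx/= subrr.
  under eq_bigr => k _ do rewrite subrr mul0r expi0 expr0z mulr1.
  by rewrite sumr_const_nat subn0 rmorphM/= rmorph_nat mulrC.
rewrite /integralC/= Rintegral_cst; last exact: measurable_circ.
rewrite Rintegral_cst; last exact: measurable_circ.
rewrite mul0r (_ : fine _ = 2 * pi); last by rewrite [X in fine X]mu_circ.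
rewrite divfK ?mulf_neq0// ?gt_eqF ?pi_gt0//.
by rewrite -(rmorph_nat (real_complex R)).
Qed.

End kernel.

(** * Correlation determinants *)

Section determinants.

(** Expansion along the first row and then the first column. Apart from the corner, every term
    contains one entry of the new row and one of the new column, so integrating out the new point
    only involves the products treated by [integral_kern]. *)
Lemma det_bordered (F : comNzRingType) p (A : 'M[F]_(p.+1)) (M := row' 0 (col' 0 A)) :
  \det A = A 0 0 * \det M -
    \sum_i \sum_j (\adj M) j i * (A (lift 0 i) 0 * A 0 (lift 0 j)).
Proof.
rewrite (expand_det_row A 0) big_ord_recl; congr (_ + _).
  by rewrite /cofactor addn0 expr0 mul1r.
rewrite exchange_big/= -sumrN; apply: eq_bigr => j _.
rewrite -sumrN /cofactor.
set B := row' 0 _.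
case: p A @M j @B => [|p] A M j B; first by case: j B.
rewrite (expand_det_col B 0) mulr_sumr mulr_sumr; apply: eq_bigr => i _.
have -> : B i 0 = A (lift 0 i) 0.
  by rewrite /B !mxE; congr (A _ _); apply/val_inj.
rewrite /cofactor !mxE /cofactor.
have -> : row' i (col' 0 B) = row' i (col' j M).
  apply/matrixP => a b; rewrite /B /M !mxE; congr (A _ _); apply/val_inj => /=.
  by rewrite /bump/= !add1n ltnS addnS.
rewrite addn0 add0n lift0 exprD exprS.
move: (A (lift 0 i) 0) (A 0 (lift 0 j)) (\det _) => x y z.
rewrite !mulrA; ring.
Qed.

Lemma rank_diag_pred (F : fieldType) p (P : pred 'I_p) :
  (#|P| <= \rank (diag_mx (\row_i (P i)%:R : 'rV[F]_p)))%N.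
Proof.
set D := diag_mx _; pose f : 'I_#|P| -> 'I_p := fun i => enum_val i.
have e : rowsub f 1%:M *m D *m colsub f 1%:M = 1%:M :> 'M[F]_#|P|.
  rewrite mul_rowsub_mx mul1mx mulmx_colsub mulmx1.
  apply/matrixP => i j; rewrite !mxE (inj_eq enum_val_inj).
  case: eqP => [_|_]; rewrite ?mulr0n// mulr1n /f.
  by have := enum_valP i; rewrite unfold_in => ->.
have := mxrankM_maxr (rowsub f 1%:M) D.
apply: leq_trans; rewrite -[X in (X <= _)%N](mxrank1 F) -e.
exact: mxrankM_maxl.
Qed.

(** If [M] is invertible, its block on [P] and [Q] has rank at least |P| + |Q| - p, while a
    factorisation through dimension [m] bounds this rank by [m]. *)
Lemma det_rank_block (F : fieldType) p m (M : 'M[F]_p) (P Q : pred 'I_p)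
    (U : 'M[F]_(p, m)) (V : 'M[F]_(m, p)) :
  (forall i j, P i -> Q j -> M i j = (U *m V) i j) ->
  (p + m < #|P| + #|Q|)%N -> \det M = 0.
Proof.
move=> MUV h; apply/eqP; apply/negPn/negP => dM.
have uM : M \in unitmx by rewrite unitmxE unitfE.
pose DP := diag_mx (\row_i (P i)%:R : 'rV[F]_p); pose DQ := diag_mx (\row_i (Q i)%:R : 'rV[F]_p).
have e : DP *m M *m DQ = (DP *m U) *m (V *m DQ).
  rewrite mulmxA -[DP *m U *m V]mulmxA; apply/matrixP => i j.
  rewrite mul_mx_diag mul_diag_mx [RHS]mxE mul_diag_mx !mxE.
  under [in RHS]eq_bigr => k _ do rewrite 2!mxE.
  rewrite (bigD1 j)//= !mxE eqxx mulr1n [X in _ = _ + X]big1 ?addr0; last first.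
    by move=> k kj; rewrite !mxE (negbTE kj) mulr0n mulr0.
  case: (boolP (P i)) => Pi; last by rewrite !mul0r.
  case: (boolP (Q j)) => Qj; last by rewrite !mulr0.
  by rewrite !mul1r !mulr1 MUV// mxE.
have h1 : (\rank (DP *m M *m DQ) <= m)%N.
  by rewrite e mulmx_max_rank.
have h2 := mxrank_mul_min (DP *m M) DQ.
have h3 : \rank (DP *m M) = \rank DP by rewrite mxrankMfree// row_free_unit.
have := rank_diag_pred F P; have := rank_diag_pred F Q.
rewrite -/DP -/DQ => h4 h5.
have := leq_trans h2 h1; rewrite h3 leq_subLR => h6.
have := leq_trans (leq_add h5 h4) h6; rewrite leqNgt addnC; move: h; rewrite addnC.
by move=> ->.
Qed.

End determinants.

(** Both exponents on the right are nonnegative, so this also covers z = 0, that is, a vanishing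
    [g_k]. *)
Lemma exprz_split (F : unitRingType) (z : F) (a t b : int) : t <= a -> b <= t ->
  z ^ (a - b) = z ^ (a - t) * z ^ (t - b).
Proof.
rewrite -subr_ge0 -[b <= t]subr_ge0 => ha hb; have -> : a - b = (a - t) + (t - b) by ring.
move: (a - t) (t - b) ha hb => [x|x] [y|y] // _ _.
by rewrite -PoszD -!exprnP exprD.
Qed.

Section correlation_determinant.
Context (R : realType) (n : nat) (q : R).
Hypothesis n_ge1 : (1 <= n)%N.
Hypothesis q_gt0 : 0 < q.
Local Notation kern := (kern n q).

Definition corr_mx p (tau : p.-tuple int) (X : p.-tuple R) : 'M[R[i]]_p :=
  \matrix_(u, v) kern (tnth tau u) (tnth X u) (tnth tau v) (tnth X v).

Definition corr p (tau : p.-tuple int) (X : p.-tuple R) : R[i] := \det (corr_mx tau X).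

Definition reindex_tuple T p m (X : p.-tuple T) (f : 'I_m -> 'I_p) : m.-tuple T :=
  [tuple tnth X (f i) | i < m].

Lemma corr_perm p (tau : p.-tuple int) (X : p.-tuple R) (s : {perm 'I_p}) :
  corr (reindex_tuple tau s) (reindex_tuple X s) = corr tau X.
Proof.
rewrite /corr; have -> : corr_mx (reindex_tuple tau s) (reindex_tuple X s) =
    row_perm s (col_perm s (corr_mx tau X)).
  by apply/matrixP => i j; rewrite !mxE !tnth_mktuple.
rewrite row_permE col_permE !det_mulmx !det_perm odd_permV.
by rewrite mulrCA -expr2 sqrr_sign mulr1.
Qed.

Lemma corr_eq_points p (tau : p.-tuple int) (X : p.-tuple R) (i j : 'I_p) :
  i != j -> tnth tau i = tnth tau j -> tnth X i = tnth X j -> corr tau X = 0.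
Proof.
move=> ij etau eX; rewrite /corr; apply: (determinant_alternate ij) => k.
by rewrite !mxE etau eX.
Qed.

Lemma corr_out p (tau : p.-tuple int) (X : p.-tuple R) (i : 'I_p) :
  ~~ incirc (tnth X i) -> corr tau X = 0.
Proof.
move=> h; rewrite /corr (expand_det_row _ i) big1// => j _.
by rewrite !mxE /kern (negbTE h) mul0r.
Qed.

Lemma count_tuple p (T : eqType) (t : T) (tau : p.-tuple T) :
  count_mem t tau = (\sum_(i < p) (tnth tau i == t))%N.
Proof. by rewrite -sum1_count big_mkcond big_tuple; apply: eq_bigr => i _; rewrite /=; case: eqP. Qed.

(** Rows of time at least [t] against columns of time at most [t] factor through the n exponentials
    of index 0, ..., n - 1, and the numbers of such rows and columns add up to [p] plus the
    multiplicity of [t]. *)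
Lemma corr_many p (tau : p.-tuple int) (X : p.-tuple R) (t : int) :
  (n < count_mem t tau)%N -> corr tau X = 0.
Proof.
move=> nt.
pose U : 'M[R[i]]_(p, n) := \matrix_(i, k) (if incirc (tnth X i) then
  ((2 * pi)^-1)%:C * (g n q k%:Z ^ (tnth tau i - t) * expi (- tnth X i * k%:R)) else 0).
pose V : 'M[R[i]]_(n, p) := \matrix_(k, j) (if incirc (tnth X j) then
  g n q k%:Z ^ (t - tnth tau j) * expi (tnth X j * k%:R) else 0).
apply: (@det_rank_block _ _ n _ (fun i => t <= tnth tau i) (fun j => tnth tau j <= t) U V).
  move=> i j ti jt; rewrite !mxE /kern.
  have [ii|ni] := boolP (incirc (tnth X i)); last first.
    by rewrite /= big1// => k _; rewrite !mxE (negbTE ni) mul0r.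
  have [ij|nj] := boolP (incirc (tnth X j)); last first.
    by rewrite andbF big1// => k _; rewrite !mxE (negbTE nj) mulr0.
  rewrite /= (le_trans jt ti) big_mkord mulr_sumr; apply: eq_bigr => k _.
  have -> : expi ((tnth X j - tnth X i) * k%:R) = expi (- tnth X i * k%:R) * expi (tnth X j * k%:R).
    by rewrite -expiD; congr expi; ring.
  rewrite !mxE ii ij.
  by rewrite (exprz_split (g n q k%:Z) ti jt); ring.
rewrite -!sum1_card big_mkcond [X in (_ < _ + X)%N]big_mkcond -big_split/=.
have -> : (p + n < \sum_(i < p) ((if i \in (fun i => (t <= tnth tau i)%R) then 1 else 0) + (if i \in (fun j => (tnth tau j <= t)%R) then 1 else 0)))%N = (p + n < \sum_(i < p) (1 + (tnth tau i == t)))%N.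
  congr (_ < _)%N; apply: eq_bigr => i _; rewrite !unfold_in.
  by case: (ltgtP t (tnth tau i)).
by rewrite big_split/= sum1_card card_ord -count_tuple ltn_add2l.
Qed.

Lemma corr_cmfun p (tau : p.-tuple int) disp (T : measurableType disp) (X : T -> p.-tuple R) :
  measurable_fun setT X -> cmfun (fun x => corr tau (X x)).
Proof.
move=> mX; rewrite /corr /determinant.
apply: cmfun_sum => s; apply: cmfunM; first exact: cmfun_cst.
apply: cmfun_prod => i; rewrite /corr_mx.
under eq_fun do rewrite mxE.
by apply: kern_cmfun => //; apply: (measurableT_comp (measurable_tnth _)).
Qed.

Lemma corr_bounded p (tau : p.-tuple int) : exists M, forall X, normc (corr tau X) <= M.
Proof.
have [B hB] : exists B : p.-tuple int -> 'I_p -> 'I_p -> R, forall i j a b,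
   normc (kern (tnth tau i) a (tnth tau j) b) <= B tau i j.
  have /choice[f hf] : forall ij : 'I_p * 'I_p, exists M, forall a b, normc (kern (tnth tau ij.1) a (tnth tau ij.2) b) <= M.
    by move=> ij; exact: kern_bounded.
  by exists (fun _ i j => f (i, j)) => i j a b; exact: (hf (i, j)).
exists (\sum_(s : {perm 'I_p}) \prod_i B tau i (s i)) => X.
rewrite /corr /determinant (le_trans (normc_sum _ _ _))//; apply: ler_sum => s _.
rewrite normcM.
have -> : normc ((-1) ^+ s : R[i]) = 1.
  by case: (odd_perm s); rewrite ?expr0 ?normc1// expr1 (_ : -1 = (-1 : R)%:C) ?normc_real ?normrN1// rmorphN rmorph1.
rewrite mul1r.
elim/big_ind2 : _ => //; first by rewrite normc1.
  by move=> x1 x2 y1 y2 h1 h2; rewrite normcM ler_pM ?normc_ge0.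
by move=> i _; rewrite mxE.
Qed.

(** After [det_bordered] and [integral_kern], the (i, j) term carries the factor [t <= t_i] +
    [t_j <= t] - 1. Each of the three pieces is a sum of row or column expansions of the same
    determinant, and together they count the i with t_i = t. *)
Lemma integral_corr_cons p (t : int) (tau : p.-tuple int) (Y : p.-tuple R) :
  integralC (@circ R) (fun c => corr [tuple of t :: tau] [tuple of c :: Y]) =
  (n%:R - (count_mem t tau)%:R) * corr tau Y.
Proof.
have mc := @measurable_circ R.
set M := corr_mx tau Y.
have E c : corr [tuple of t :: tau] [tuple of c :: Y] =
   \det M * kern t c t c + \sum_i \sum_j (- (\adj M) j i) *
     (kern (tnth tau i) (tnth Y i) t c * kern t c (tnth tau j) (tnth Y j)).
  have eM : row' 0 (col' 0 (corr_mx [tuple of t :: tau] [tuple of c :: Y])) = M.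
    by apply/matrixP => i j; rewrite !mxE !tnthS.
  rewrite /corr det_bordered eM mulrC !mxE !tnth0; congr (_ + _).
  rewrite -sumrN; apply: eq_bigr => i _; rewrite -sumrN; apply: eq_bigr => j _.
  rewrite mulNr; congr (- (_ * (_ * _))); first by rewrite mxE !tnthS !tnth0.
  by rewrite mxE !tnthS !tnth0.
rewrite (@eq_integralC _ (@circ R) _ _ (fun c _ => E c)).
have i1 : cintegrable (@circ R) (fun c => kern t c t c).
  have [B hB] := kern_bounded n_ge1 q_gt0 t t.
  apply: (@bounded_cintegrable R _ mc (mu_circ_fin R) _ B); last by move=> x _; exact: hB.
  have [h1 h2] : cmfun (fun c : R => kern t c t c) by apply: kern_cmfun.
  by split; exact: measurable_funTS.
have i2 r a s b : cintegrable (@circ R) (fun c => kern r a t c * kern t c s b).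
  have [B hB] := kern_bounded n_ge1 q_gt0 r t; have [B' hB'] := kern_bounded n_ge1 q_gt0 t s.
  apply: (@bounded_cintegrable R _ mc (mu_circ_fin R) _ (B * B')); last first.
    by move=> x _; rewrite normcM ler_pM ?normc_ge0.
  have [h1 h2] : cmfun (fun c : R => kern r a t c * kern t c s b) by apply: cmfunM; apply: kern_cmfun.
  by split; exact: measurable_funTS.
have i3 z r a s b : cintegrable (@circ R) (fun c => z * (kern r a t c * kern t c s b)) by exact: cintegrableZ.
have i4 (F : 'I_p -> 'I_p -> R[i]) : cintegrable (@circ R) (fun c => \sum_i \sum_j F i j *
     (kern (tnth tau i) (tnth Y i) t c * kern t c (tnth tau j) (tnth Y j))).
  by apply: cintegrable_sum => // i; apply: cintegrable_sum => // j.
rewrite integralCD//; last exact: cintegrableZ.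
rewrite integralCZ// integral_kern_diag integralC_sum//; last first.
  by move=> i; apply: cintegrable_sum.
have e2 i : integralC (@circ R) (fun x => \sum_j - (\adj M) j i *
      (kern (tnth tau i) (tnth Y i) t x * kern t x (tnth tau j) (tnth Y j))) =
   - \sum_j (\adj M) j i * (((t <= tnth tau i)%R%:R + (tnth tau j <= t)%R%:R - 1) * M i j).
  rewrite integralC_sum// -sumrN; apply: eq_bigr => j _.
  have -> : M i j = kern (tnth tau i) (tnth Y i) (tnth tau j) (tnth Y j) by rewrite /M mxE.
  rewrite integralCZ// (integral_kern n_ge1 q_gt0) mulNr //.
under eq_bigr => i _ do rewrite e2.
rewrite sumrN mulrBl mulrC; congr (_ - _).
have -> : \sum_i \sum_j (\adj M) j i * (((t <= tnth tau i)%R%:R + (tnth tau j <= t)%R%:R - 1) * M i j) =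
  \sum_i (t <= tnth tau i)%R%:R * (\sum_j M i j * (\adj M) j i) +
  \sum_j (tnth tau j <= t)%R%:R * (\sum_i (\adj M) j i * M i j) - \sum_i (\sum_j M i j * (\adj M) j i).
  under [X in _ + X - _]eq_bigr => j _ do rewrite mulr_sumr.
  rewrite [X in _ + X - _]exchange_big/= -big_split -sumrB/=; apply: eq_bigr => i _.
  rewrite mulr_sumr -big_split -sumrB/=; apply: eq_bigr => j _; ring.
have ed1 i : \sum_j M i j * (\adj M) j i = \det M.
  by have /matrixP/(_ i i) := mul_mx_adj M; rewrite !mxE eqxx mulr1n.
have ed2 j : \sum_i (\adj M) j i * M i j = \det M.
  by have /matrixP/(_ j j) := mul_adj_mx M; rewrite !mxE eqxx mulr1n.
under eq_bigr => i _ do rewrite ed1.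
under [X in _ + X - _]eq_bigr => i _ do rewrite ed2.
under [X in _ + _ - X]eq_bigr => i _ do rewrite ed1.
have -> : \sum_(i < p) \det M = \sum_(i < p) 1 * \det M by apply: eq_bigr => i _; rewrite mul1r.
rewrite -!mulr_suml -mulrDl -mulrBl; congr (_ * _).
rewrite -big_split -sumrB/= count_tuple natr_sum; apply: eq_bigr => i _.
by case: (ltgtP t (tnth tau i)) => _ /=; rewrite ?addr0 ?add0r ?subrr// addrK.
Qed.

End correlation_determinant.

(** * The two-time determinant *)

Section vandermonde.
Context (R : realType) (n : nat).
Implicit Types (y z : n.-tuple R).

(** Half of a factorisation: the kernel from a time r to a time s <= r is [emx], times the diagonal
    matrix of the g_k^{r-s}, times [fmx]. *)
Definition emx z : 'M[R[i]]_n := \matrix_(i, k) (((2 * pi)^-1)%:C * expi (- tnth z i * k%:R)).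
Definition fmx z : 'M[R[i]]_n := \matrix_(k, j) expi (tnth z j * k%:R).

Lemma expi_natmul (u : R) k : expi (u * k%:R) = expi u ^+ k.
Proof.
elim: k => [|k IH]; first by rewrite mulr0 expi0 expr0.
by rewrite -(natr1 k) mulrDr mulr1 expiD IH exprSr.
Qed.

Lemma det_fmx z : \det (fmx z) =
  \prod_(l < n) \prod_(p < n | (l < p)%N) (expi (tnth z p) - expi (tnth z l)).
Proof.
have -> : fmx z = Vandermonde n (\row_j expi (tnth z j)).
  by apply/matrixP => i j; rewrite !mxE expi_natmul.
by rewrite det_Vandermonde; apply: eq_bigr => l _; apply: eq_bigr => p _; rewrite !mxE.
Qed.

Lemma det_emx z : \det (emx z) = ((2 * pi)^-1)%:C ^+ n *
  \prod_(l < n) \prod_(p < n | (l < p)%N) (expi (- tnth z p) - expi (- tnth z l)).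
Proof.
have -> : emx z = ((2 * pi)^-1)%:C *: (Vandermonde n (\row_j expi (- tnth z j)))^T.
  by apply/matrixP => i j; rewrite !mxE expi_natmul.
rewrite detZ det_tr det_Vandermonde; congr (_ * _).
by apply: eq_bigr => l _; apply: eq_bigr => p _; rewrite !mxE.
Qed.

Lemma expiB_sin (u v : R) : expi u - expi v = 2 * 'i%C * (sin ((u - v) / 2))%:C * expi ((u + v) / 2).
Proof.
have h (m d : R) : expi (m + d) - expi (m - d) = 2 * 'i%C * (sin d)%:C * expi m.
  rewrite !expiD; have -> : expi d = expi (- d) + 2 * 'i%C * (sin d)%:C.
    by apply: complex_ext; rewrite ?ReD ?ImD ?ReM ?ImM ?ReN ?ImN/= ?cosN ?sinN; ring.
  by move: (expi m) (expi (- d)) => A B; ring.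
by rewrite -h; congr (expi _ - expi _); field.
Qed.

Lemma Dn_lt z (l p : 'I_n) : Dn z -> (l < p)%N -> 0 <= tnth z p - tnth z l < 2 * pi.
Proof.
move=> [sz bz] lp.
have := bz l; have := bz p => /andP[p0 p2] /andP[l0 l2].
have : tnth z l <= tnth z p.
  rewrite !(tnth_nth 0); apply: (sorted_leq_nth le_trans le_refl) => //; rewrite ?inE ?size_tuple//.
  exact: ltnW.
by move=> h; apply/andP; split; lra.
Qed.

Lemma normc_expiB (u v : R) : 0 <= u - v < 2 * pi -> normc (expi v - expi u) = 2 * sin ((u - v) / 2).
Proof.
move=> huv; rewrite -normcN opprB expiB_sin !normcM normc_expi mulr1 normc_real.
have -> : normc (2 : R[i]) = 2 by rewrite (_ : 2 = (2 : R)%:C) ?normc_real ?normr_nat// rmorph_nat.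
have -> : normc ('i%C : R[i]) = 1 by rewrite /= expr0n/= expr1n add0r sqrtr1.
rewrite mulr1 ger0_norm//; apply: sin_ge0_pi; case/andP: huv => h1 h2; apply/andP; split; lra.
Qed.

Lemma prod_pairs (z : R[i] ^ n) : \prod_(l < n) \prod_(p < n | (l < p)%N) (z l * z p) = \prod_(l < n) z l ^+ n.-1.
Proof.
have -> : \prod_(l < n) \prod_(p < n | (l < p)%N) (z l * z p) =
   (\prod_(l < n) \prod_(p < n | (l < p)%N) z l) * (\prod_(l < n) \prod_(p < n | (l < p)%N) z p).
  by rewrite -big_split/=; apply: eq_bigr => l _; rewrite big_split.
rewrite [X in _ * X](exchange_big_dep xpredT)//= -big_split/=; apply: eq_bigr => l _.
rewrite !prodr_const -exprD; congr (_ ^+ _).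
rewrite -!sum1_card !(big_mkcond (fun _ => _ \in _))/= -big_split/=.
rewrite (eq_bigr (fun p : 'I_n => ((p != l) : nat))); last first.
  move=> p _; have -> : (p != l) = (l != p :> nat) by rewrite -val_eqE eq_sym.
  rewrite !unfold_in -[eqn (l.+1 - p) 0]/(leq l.+1 p) -[eqn (p.+1 - l) 0]/(leq p.+1 l).
  by case: (ltngtP l p).
rewrite -big_mkcond/= sum1_card cardC1 card_ord //.
Qed.

(** A difference of two exponentials has the mean of the two angles as phase, up to a constant, and
    each point lies in n - 1 pairs; this is where (n-1)/2 enters. The phase cancels against the one
    in [trans_det_weight]. *)
Definition vphase (s : R) (z : n.-tuple R) := expi (s * (n.-1%:R / 2 * \sum_(l < n) tnth z l)) : R[i].

Lemma expi_sum (I : Type) (r : seq I) (P : pred I) (F : I -> R) :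
  expi (\sum_(i <- r | P i) F i) = \prod_(i <- r | P i) expi (F i).
Proof. exact: (big_morph (@expi R) (@expiD R) (expi0 R)). Qed.

Lemma vander_phase (c : R[i]) (s : R) z :
  \prod_(l < n) \prod_(p < n | (l < p)%N) (c * (Normc.normc (expi (tnth z l) - expi (tnth z p)))%:C *
     (expi (s * (tnth z l / 2)) * expi (s * (tnth z p / 2)))) =
  (\prod_(l < n) \prod_(p < n | (l < p)%N) c) * (Delta z)%:C * vphase s z.
Proof.
under eq_bigr => l _ do rewrite 2!big_split/=.
rewrite 2!big_split/=; congr (_ * _ * _).
  by rewrite /Delta rmorph_prod; apply: eq_bigr => l _; rewrite rmorph_prod.
under eq_bigr => l _ do rewrite big_split/=.
rewrite big_split/=.
have := prod_pairs [ffun l => expi (s * (tnth z l / 2))].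
rewrite (eq_bigr (fun l : 'I_n => \prod_(p < n | (l < p)%N) (expi (s * (tnth z l / 2)) * expi (s * (tnth z p / 2))))); last first.
  by move=> l _; apply: eq_bigr => p _; rewrite !ffunE.
under eq_bigr => l _ do rewrite big_split/=.
rewrite big_split/= => ->.
under eq_bigr => l _ do rewrite ffunE.
rewrite /vphase mulr_sumr mulr_sumr expi_sum; apply: eq_bigr => l _.
by rewrite -expi_natmul; congr expi; field.
Qed.

Definition vunit (c : R[i]) := \prod_(l < n) \prod_(p < n | (l < p)%N) c.

(** On an increasing configuration the half-angle sines are nonnegative, so each Vandermonde factor
    is its modulus times an explicit phase. *)
Lemma det_fmx_Delta z : Dn z -> \det (fmx z) = vunit 'i%C * (Delta z)%:C * vphase 1 z.
Proof.
move=> Dz; rewrite det_fmx -vander_phase; apply: eq_bigr => l _; apply: eq_bigr => p lp.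
rewrite expiB_sin normc_expiB ?Dn_lt// -expiD rmorphM/= rmorph_nat.
rewrite (_ : 1 * (tnth z l / 2) + 1 * (tnth z p / 2) = (tnth z p + tnth z l) / 2); last by field.
by ring.
Qed.

Lemma det_emx_Delta z : Dn z ->
  \det (emx z) = ((2 * pi)^-1)%:C ^+ n * vunit (- 'i%C) * (Delta z)%:C * vphase (-1) z.
Proof.
move=> Dz; rewrite det_emx -!mulrA; congr (_ * _); rewrite mulrA -vander_phase.
apply: eq_bigr => l _; apply: eq_bigr => p lp.
rewrite expiB_sin normc_expiB ?Dn_lt// -expiD rmorphM/= rmorph_nat.
have -> : (- tnth z p - - tnth z l) / 2 = - ((tnth z p - tnth z l) / 2) by field.
rewrite sinN rmorphN/= (_ : -1 * (tnth z l / 2) + -1 * (tnth z p / 2) = (- tnth z p + - tnth z l) / 2); last by field.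
by ring.
Qed.

Lemma vunitM (c d : R[i]) : vunit c * vunit d = vunit (c * d).
Proof.
rewrite /vunit -big_split/=; apply: eq_bigr => l _.
by rewrite -big_split.
Qed.

Lemma vunit1 : vunit 1 = 1.
Proof. by rewrite /vunit big1// => l _; rewrite big1. Qed.

Lemma vunit_ii : vunit (- 'i%C) * vunit 'i%C = 1.
Proof.
rewrite vunitM -[RHS]vunit1; congr vunit.
by apply: complex_ext; rewrite ?ReM ?ImM ?ReN ?ImN/=; ring.
Qed.

Lemma det_emx_neq0 z : Dn z -> Delta z != 0 -> \det (emx z) != 0.
Proof.
move=> Dz d0; rewrite det_emx_Delta// !mulf_neq0// ?expi_neq0//.
- by rewrite expf_neq0// fmorph_eq0 invr_eq0 mulf_neq0// ?gt_eqF ?pi_gt0.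
- by apply/eqP => h; have := vunit_ii; rewrite h mul0r => /eqP; rewrite eq_sym oner_eq0.
- by rewrite fmorph_eq0.
Qed.

End vandermonde.

(** * The one-step determinant and interlacing *)

Section two_times.
Context (R : realType) (n : nat) (q : R).
Hypothesis n_ge1 : (1 <= n)%N.
Hypothesis q_gt0 : 0 < q.
Implicit Types (y z : n.-tuple R).
Local Notation lam := (lam n q).
Local Notation J := (J n q).
Local Notation tailC := (tailC n q).

Definition gam : 'M[R[i]]_n := diag_mx (\row_k g n q k%:Z).

(** Its negative is the kernel block from one time to the next. *)
Definition tmx y z : 'M[R[i]]_n :=
  \matrix_(i, j) (((2 * pi)^-1)%:C * tailK n q 1 (tnth y i) (tnth z j)).

(* When all g_k are nonzero this is a Schur complement of the two-time kernel; as a polynomial in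
   the g_k it makes sense even when some g_k vanishes. *)
Definition trans_det y z : R[i] := \det (block_mx (emx y) (- tmx y z) gam (fmx z)).

Definition lmx y z : 'M[R[i]]_n := \matrix_(i, j) (tnth z j < tnth y i)%R%:R.

(* trans_det y z is, up to an exponential factor, det (cmb L) for the 0-1 matrix L = lmx y z, so it
   only depends on the relative order of y and z; two equal rows or columns of L make it vanish,
   which is what happens when y and z do not interlace. *)
Definition cmb (L : 'M[R[i]]_n) : 'M[R[i]]_(n + n) :=
  block_mx (const_mx ((2 * pi)^-1)%:C) (L - const_mx (((2 * pi)^-1)%:C * tailC)) gam (const_mx 1).

Lemma det_block_unip m p (A : 'M[R[i]]_m) (B : 'M[R[i]]_(m, p)) (P : 'M[R[i]]_(p, m)) (M : 'M[R[i]]_p) (U : 'M[R[i]]_(m, p)) :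
  \det (block_mx 1%:M U 0 1%:M *m block_mx A B P M) = \det (block_mx A B P M).
Proof. by rewrite det_mulmx det_ublock !det1 !mul1r. Qed.
Lemma det_block_unipr m p (A : 'M[R[i]]_m) (B : 'M[R[i]]_(m, p)) (P : 'M[R[i]]_(p, m)) (M : 'M[R[i]]_p) (U : 'M[R[i]]_(m, p)) :
  \det (block_mx A B P M *m block_mx 1%:M U 0 1%:M) = \det (block_mx A B P M).
Proof. by rewrite det_mulmx det_ublock !det1 !mulr1. Qed.

Lemma cexp_lam_g (k : nat) (u : R) : cexp (lam * u%:C) * cexp (g n q k%:Z * u%:C) = expi (u * k%:R).
Proof. by rewrite -cexpD gE (expi_cexp u k%:Z); congr cexp; ring. Qed.

Lemma cexp_g2pi (k : nat) : cexp (lam * (2 * pi)%:C) * cexp (g n q k%:Z * (2 * pi)%:C) = 1.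
Proof. by rewrite cexp_lam_g; exact: (expi2pi R k%:Z). Qed.

(** By [JD] and the jump relation the closed form can be written in b - a itself; wrapping around
    the circle then costs exactly 2 pi, which the prefactor 1/(2 pi) of the kernel turns into the
    entries 0 and 1 of [lmx]. *)
Lemma tail1_wrap (a b : R) : tail1 n q (wrap a b) =
  cexp (lam * (b - a)%:C) * (tailC - \sum_(k < n) J k%:Z (b - a) - (2 * pi)%:C * (b < a)%R%:R).
Proof.
rewrite /tail1 /wrap; case: ltP => ba; last by rewrite addr0 mulr0 subr0 big_mkord.
rewrite mulr1 -(tailC_jump n_ge1 q_gt0) !big_mkord.
under eq_bigr => k _ do rewrite addrC JD.
rewrite big_split/= [(_ + 2 * pi)%:C]rmorphD/= [lam * (_ + _)]mulrDr cexpD.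
have -> : \sum_(k < n) cexp (g n q k * (2 * pi)%:C) * J k (b - a) =
   (cexp (lam * (2 * pi)%:C))^-1 * \sum_(k < n) J k (b - a).
  rewrite mulr_sumr; apply: eq_bigr => k _; congr (_ * _).
  by apply: (mulfI (cexp_neq0 (lam * (2 * pi)%:C))); rewrite cexp_g2pi divff ?cexp_neq0.
have := cexp_neq0 (lam * (2 * pi)%:C).
move: (cexp (lam * (2 * pi)%:C)) (\sum_(k < n) J k (b - a)) (\sum_(k < n) J k (2 * pi)) (cexp _) => W A B e W0.
by field.
Qed.

(** Unipotent row and column operations. By [gJ], adding multiples of [gam] with coefficients [J]
    replaces every e^{iuk} in the outer blocks by e^{lam u}, free of k, which then factors out of
    rows and columns. In the corner the [J] terms cancel by [JD], leaving only the jump and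
    [tailC]. *)
Lemma trans_detE y z : trans_det y z =
  cexp (lam * (\sum_(j < n) (tnth z j - tnth y j))%:C) * \det (cmb (lmx y z)).
Proof.
pose ey i := cexp (lam * (- tnth y i)%:C); pose ez j := cexp (lam * (tnth z j)%:C).
pose p := ((2 * pi)^-1)%:C : R[i].
pose P : 'M[R[i]]_n := \matrix_(k, j) (- (ez j * J k%:Z (tnth z j))).
pose S : 'M[R[i]]_n := \matrix_(i, k) (- (p * ey i * J k%:Z (- tnth y i))).
rewrite /trans_det -[LHS](det_block_unipr _ _ _ _ P) mulmx_block.
rewrite -[LHS](det_block_unip _ _ _ _ S) mulmx_block.
rewrite !mul1mx !mulmx1 !mul0mx !mulmx0 !addr0 !add0r.
have e1 : emx y + S *m gam = diag_mx (\row_i ey i) *m const_mx p.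
  apply/matrixP => i k; rewrite mul_mx_diag mul_diag_mx !mxE.
  have r1 (a b c d : R[i]) : - (a * b * c) * d = - (a * b * (d * c)) by ring.
  rewrite r1 gJ.
  rewrite -(cexp_lam_g k (- tnth y i)) -/(ey i) -/p.
  by move: (ey i) (cexp _) => u v; ring.
have e2 : gam *m P + fmx z = const_mx 1 *m diag_mx (\row_j ez j).
  apply/matrixP => k j; rewrite mul_mx_diag mul_diag_mx !mxE mul1r.
  have r2 (a b d : R[i]) : d * - (a * b) = - (a * (d * b)) by ring.
  rewrite r2 gJ.
  rewrite -(cexp_lam_g k (tnth z j)) -/(ez j).
  by move: (ez j) (cexp _) => u v; ring.
have e3 : emx y *m P - tmx y z + S *m (gam *m P + fmx z) =
   diag_mx (\row_i ey i) *m (lmx y z - const_mx (p * tailC)) *m diag_mx (\row_j ez j).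
  rewrite e2; apply/matrixP => i j.
  rewrite mulmxA !mul_mx_diag mul_diag_mx !mxE.
  have -> : \sum_k emx y i k * P k j = - (p * ez j) * \sum_(k < n) expi (- tnth y i * k%:R) * J k%:Z (tnth z j).
    rewrite mulr_sumr; apply: eq_bigr => k _; rewrite !mxE -/p.
    by move: (expi _) (J _ _) (ez j) => u v w; ring.
  have -> : \sum_k S i k * const_mx 1 k j = - (p * ey i) * \sum_(k < n) J k%:Z (- tnth y i).
    rewrite mulr_sumr; apply: eq_bigr => k _; rewrite !mxE.
    by move: (J _ _) (ey i) => u v; ring.
  rewrite /tailK eqxx tail1_wrap -/p.
  have -> : tnth z j - tnth y i = - tnth y i + tnth z j by ring.
  under [\sum_(k < n) J k%:Z (- tnth y i + tnth z j)]eq_bigr => k _ do rewrite JD.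
  rewrite big_split/= [(- _ + _)%:C]rmorphD/= [lam * (_ + _)]mulrDr cexpD -/(ey i) -/(ez j).
  have -> : \sum_(k < n) expi (- tnth y i * k%:R) * J k%:Z (tnth z j) =
     ey i * \sum_(k < n) cexp (g n q k%:Z * (- tnth y i)%:C) * J k%:Z (tnth z j).
    by rewrite mulr_sumr; apply: eq_bigr => k _; rewrite mulrA -cexp_lam_g.
  have p0 : p != 0 by rewrite /p fmorph_eq0 invr_eq0 mulf_neq0// gt_eqF// pi_gt0.
  have -> : (2 * pi)%:C = p^-1 by rewrite /p fmorphV invrK.
  move: (\sum_(k < n) _) (\sum_(k < n) _) (ey i) (ez j) ((tnth z j < tnth y i)%R%:R : R[i]) => A B u v L.
  clearbody p; field; exact: p0.
rewrite e1 e3 e2.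
have -> : block_mx (diag_mx (\row_i ey i) *m const_mx p)
     (diag_mx (\row_i ey i) *m (lmx y z - const_mx (p * tailC)) *m diag_mx (\row_j ez j))
     gam (const_mx 1 *m diag_mx (\row_j ez j)) =
   block_mx (diag_mx (\row_i ey i)) 0 0 1%:M *m cmb (lmx y z) *m block_mx 1%:M 0 0 (diag_mx (\row_j ez j)).
  by rewrite /cmb !mulmx_block !(mul1mx, mulmx1, mul0mx, mulmx0, addr0, add0r).
rewrite !det_mulmx !det_ublock !det1 !det_diag mulr1 mul1r mulrAC; congr (_ * _).
under eq_bigr => i _ do rewrite mxE.
under [X in _ * X]eq_bigr => i _ do rewrite mxE.
rewrite -big_split/= rmorph_sum/= mulr_sumr (big_morph (@cexp R) (@cexpD R) (cexp0 R)).
apply: eq_bigr => j _; rewrite /ey /ez -cexpD; congr cexp.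
by rewrite rmorphB rmorphN/=; ring.
Qed.

End two_times.

Section two_times.
Context (R : realType) (n : nat) (q : R).
Hypothesis n_ge1 : (1 <= n)%N.
Hypothesis q_gt0 : 0 < q.
Implicit Types (y z : n.-tuple R).
Local Notation lam := (lam n q).
Local Notation J := (J n q).
Local Notation tailC := (tailC n q).
Local Notation cmb := (cmb q).
Local Notation trans_det := (trans_det q).

Definition l0 : 'M[R[i]]_n := \matrix_(i, j) (j < i)%N%:R.
Definition l1 : 'M[R[i]]_n := \matrix_(i, j) (j <= i)%N%:R.

Lemma cmb_eq_rows (L : 'M[R[i]]_n) (i i' : 'I_n) : i != i' ->
  (forall j, L i j = L i' j) -> \det (cmb L) = 0.
Proof.
move=> ii' e; apply: (@determinant_alternate _ _ _ (lshift n i) (lshift n i')).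
  by rewrite (inj_eq (@lshift_inj _ _)).
by move=> k; rewrite /cmb; case: (split_ordP k) => j ->; rewrite ?block_mxEul ?block_mxEur !mxE ?e.
Qed.

Lemma cmb_eq_cols (L : 'M[R[i]]_n) (j j' : 'I_n) : j != j' ->
  (forall i, L i j = L i j') -> \det (cmb L) = 0.
Proof.
move=> jj' e; rewrite -det_tr; apply: (@determinant_alternate _ _ _ (rshift n j) (rshift n j')).
  by rewrite (inj_eq (@rshift_inj _ _)).
by move=> k; rewrite [LHS]mxE [RHS]mxE /cmb; case: (split_ordP k) => i ->; rewrite ?block_mxEur ?block_mxEdr !mxE ?e.
Qed.

Lemma lmx_le y z : Dn y -> Dn z -> interlace_le y z -> lmx y z = l0.
Proof.
move=> [sy by_] [sz bz] /andP[/forallP h1 /forallP h2]; apply/matrixP => i j; rewrite !mxE.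
have mono (w : n.-tuple R) (a b : 'I_n) : sorted <=%R w -> (a <= b)%N -> tnth w a <= tnth w b.
  by move=> sw ab; rewrite !(tnth_nth 0); apply: (sorted_leq_nth le_trans le_refl) => //; rewrite ?inE ?size_tuple.
congr (_%:R); case: ltnP => ji.
  have jn : (j.+1 < n)%N by exact: leq_ltn_trans ji (ltn_ord i).
  have /forallP/(_ (Ordinal jn)) := h2 j; rewrite eqxx /= => /lt_le_trans -> //.
  exact: mono.
by rewrite le_gtF// (le_trans (h1 i))// mono.
Qed.

Lemma lmx_gt y z : Dn y -> Dn z -> interlace_gt y z -> lmx y z = l1.
Proof.
move=> [sy by_] [sz bz] /andP[/forallP h1 /forallP h2]; apply/matrixP => i j; rewrite !mxE.
have mono (w : n.-tuple R) (a b : 'I_n) : sorted <=%R w -> (a <= b)%N -> tnth w a <= tnth w b.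
  by move=> sw ab; rewrite !(tnth_nth 0); apply: (sorted_leq_nth le_trans le_refl) => //; rewrite ?inE ?size_tuple.
congr (_%:R); case: leqP => ji.
  by rewrite (lt_le_trans (h1 j))// mono.
have jn : (i.+1 < n)%N by exact: leq_ltn_trans ji (ltn_ord j).
have /forallP/(_ (Ordinal jn)) := h2 i; rewrite eqxx /= => h.
by rewrite le_gtF// (le_trans h)// mono.
Qed.

(** Let [c k] count the z_j below y_k; it determines row k of [lmx]. Distinct rows make [c] strictly
    increasing, distinct columns make it take all values 1, ..., n - 1. Hence [c k = k] for all k or
    [c k = k + 1] for all k: the two interlacing patterns. *)
Lemma cmb_not_interlace y z : Dn y -> Dn z -> ~~ interlace y z -> \det (cmb (lmx y z)) = 0.
Proof.
move=> [sy by_] [sz bz] nint; apply/eqP; apply: contraNT nint => d0.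
have mono (w : n.-tuple R) (a b : 'I_n) : sorted <=%R w -> (a <= b)%N -> tnth w a <= tnth w b.
  by move=> sw ab; rewrite !(tnth_nth 0); apply: (sorted_leq_nth le_trans le_refl) => //; rewrite ?inE ?size_tuple.
pose c k := find (fun x => nth 0 y k <= x) z.
have cn k : (c k <= n)%N by rewrite -[X in (_ <= X)%N](size_tuple z) find_size.
have cE (k j : nat) : (j < n)%N -> (nth 0 z j < nth 0 y k) = (j < c k)%N.
  move=> jn; case: (ltnP j (c k)) => jc.
    by have /negbT := before_find 0 jc; rewrite -ltNge.
  apply/le_gtF; have hh : has (fun x => nth 0 y k <= x) z.
    by rewrite has_find size_tuple (leq_ltn_trans jc).
  apply: le_trans (nth_find 0 hh) _.
  by apply: (sorted_leq_nth le_trans le_refl) => //; rewrite ?inE ?size_tuple// (leq_ltn_trans jc).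
have cmon k k' : (k <= k')%N -> (k' < n)%N -> (c k <= c k')%N.
  move=> kk' kn; rewrite leqNgt; apply/negP => h.
  have hn : (c k' < n)%N by exact: leq_trans h (cn k).
  have := cE k (c k') hn; rewrite h => h1.
  have := cE k' (c k') hn; rewrite ltnn => /negbT; rewrite -leNgt => h2.
  have : nth 0 y k <= nth 0 y k'.
    by apply: (sorted_leq_nth le_trans le_refl) => //; rewrite ?inE ?size_tuple// (leq_ltn_trans kk').
  by rewrite leNgt (le_lt_trans h2 h1).
have lE (i j : 'I_n) : lmx y z i j = (j < c i)%N%:R by rewrite !mxE !(tnth_nth 0) cE.
have cstrict k k' : (k < k')%N -> (k' < n)%N -> (c k < c k')%N.
  move=> kk' kn; rewrite ltn_neqAle cmon ?(ltnW kk')// andbT; apply/eqP => e.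
  have kn0 : (k < n)%N by exact: ltn_trans kn.
  move/eqP: d0; apply; apply: (@cmb_eq_rows _ (Ordinal kn0) (Ordinal kn)).
    by rewrite -val_eqE /= ltn_eqF.
  by move=> j; rewrite !lE /= e.
have clow k : (k < n)%N -> (k <= c k)%N.
  elim: k => // k IH kn; apply: leq_ltn_trans (IH (ltnW kn)) _.
  exact: cstrict.
have cshift m k : (k + m < n)%N -> (c k + m <= c (k + m))%N.
  elim: m => [|m IH]; first by rewrite !addn0.
  rewrite !addnS => h; apply: leq_ltn_trans (IH (ltnW h)) _.
  exact: cstrict.
have cup k : (k < n)%N -> (c k <= k.+1)%N.
  move=> kn; have := cshift (n.-1 - k)%N k; rewrite subnKC; last by rewrite -ltnS prednK.
  rewrite prednK// leqnn => /(_ isT) h; have := leq_trans h (cn _).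
  by move=> h'; lia.
(* Columns k and k + 1 differ exactly in the rows i with [c i = k + 1]. *)
have tcol k : (k.+1 < n)%N -> exists2 i, (i < n)%N & c i = k.+1.
  move=> kn; apply: contrapT => hno; move/eqP: d0; apply.
  apply: (@cmb_eq_cols _ (Ordinal (ltnW kn)) (Ordinal kn)); first by rewrite -val_eqE /= ltn_eqF.
  move=> i; rewrite !lE /=; congr (_%:R); congr nat_of_bool.
  rewrite leq_eqVlt; case: eqP => // e.
  by exfalso; apply: hno; exists i.
rewrite /interlace; have [c0|c0] := eqVneq (c 0%N) 0%N.
  have ck k : (k < n)%N -> c k = k.
    elim: k => // k IH kn; have ck := IH (ltnW kn).
    have := clow _ kn; have := cup _ kn; rewrite leq_eqVlt => /orP[/eqP h _|h1 h2]; last first.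
      by apply/eqP; rewrite eqn_leq h2 andbT.
    have [i ilt ci] := tcol k kn.
    have [ik|ki] := leqP i k.
      by have := cmon _ _ ik (ltnW kn); rewrite ci ck ltnn.
    by have := cmon _ _ ki ilt; rewrite ci h ltnn.
  apply/orP; left; apply/andP; split.
    apply/forallP => j; rewrite !(tnth_nth 0) leNgt cE// ck// ltnn//.
  apply/forallP => j; apply/forallP => k; apply/implyP => /eqP e.
  by rewrite !(tnth_nth 0) cE// ck// e.
have ck k : (k < n)%N -> c k = k.+1.
  elim: k => [n0|k IH kn].
    by apply/eqP; rewrite eqn_leq cup// lt0n c0.
  apply/eqP; rewrite eqn_leq cup//=.
  have h := cstrict k k.+1 (ltnSn k) kn.
  by move: h; rewrite (IH (ltnW kn)).
apply/orP; right; apply/andP; split.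
  by apply/forallP => j; rewrite !(tnth_nth 0) cE// ck.
apply/forallP => j; apply/forallP => k; apply/implyP => /eqP e.
by rewrite !(tnth_nth 0) leNgt cE// ck// e ltnn.
Qed.

End two_times.

(* l1 is l0 with its first row moved to the bottom and replaced by ones; modulo the rows of (gam 1),
   the jump relation of tailC makes that row of ones equal to W times the old row. *)
Lemma cmb_l1 (R : realType) (n : nat) (q : R) : (1 <= n)%N -> 0 < q ->
  \det (cmb q (l1 R n)) = (q `^ (2 * pi))%:C * \det (cmb q (l0 R n)).
Proof.
case: n => // m n_ge1 q_gt0.
pose W := cexp (lam m.+1 q * (2 * pi)%:C).
pose p := ((2 * pi)^-1)%:C : R[i].
pose Q : 'M[R[i]]_m.+1 := \matrix_(i, j) (if i == ord_max then W * (j == ord0)%:R else (j == i.+1 :> nat)%:R).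
pose S : 'M[R[i]]_m.+1 := \matrix_(i, k) (if i == ord_max then p * W * J m.+1 q k%:Z (2 * pi) else 0).
have QE r (A : 'M[R[i]]_(m.+1, r)) i j : (Q *m A) i j =
   if i == ord_max then W * A ord0 j else A (inord i.+1) j.
  rewrite mxE; case: eqP => [->|/eqP im].
    rewrite (bigD1 ord0)//= !mxE !eqxx mulr1 big1 ?addr0// => k k0.
    by rewrite !mxE eqxx (negbTE k0) mulr0 mul0r.
  have im' : (i.+1 < m.+1)%N by rewrite ltnS ltn_neqAle -ltnS ltn_ord andbT.
  rewrite (bigD1 (inord i.+1))//= !mxE (negbTE im) inordK// eqxx mul1r big1 ?addr0// => k ki.
  rewrite !mxE (negbTE im) (_ : (k == i.+1 :> nat) = false) ?mul0r//.
  by apply/negbTE; apply: contra ki => /eqP e; apply/eqP/val_inj; rewrite /= inordK.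
have SE r (A : 'M[R[i]]_(m.+1, r)) i j : (S *m A) i j =
   if i == ord_max then \sum_(k < m.+1) p * W * J m.+1 q k%:Z (2 * pi) * A k j else 0.
  rewrite mxE; case: eqP => [->|/eqP im]; first by apply: eq_bigr => k _; rewrite !mxE eqxx.
  by rewrite big1// => k _; rewrite !mxE (negbTE im) mul0r.
have p2 : p * (2 * pi)%:C = 1.
  by rewrite /p -rmorphM/= mulVf// mulf_neq0// gt_eqF// pi_gt0.
have -> : cmb q (l1 R m.+1) = block_mx Q S 0 1%:M *m cmb q (l0 R m.+1).
  rewrite /cmb mulmx_block !mul0mx !mul1mx !add0r; congr (block_mx _ _ _ _); apply/matrixP => i j.
    rewrite [in RHS]mxE QE SE; case: eqP => [_|_]; last by rewrite !mxE addr0.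
    rewrite !mxE (bigD1 j)//= big1 ?addr0; last by move=> k kj; rewrite !mxE (negbTE kj) mulr0n mulr0.
    rewrite !mxE eqxx mulr1n -/p -mulrA [J _ _ _ _ * _]mulrC gJ mulrBr mulr1.
    by rewrite -[p * W * cexp _]mulrA (cexp_g2pi m.+1 q j); ring.
  rewrite [in RHS]mxE QE SE; case: eqP => [->|/eqP im]; last first.
    have im' : (i.+1 < m.+1)%N by rewrite ltnS ltn_neqAle -ltnS ltn_ord andbT.
    by rewrite !mxE addr0 inordK.
  rewrite !mxE ltn0 -ltnS ltn_ord/= sub0r.
  under eq_bigr => k _ do rewrite mxE mulr1.
  rewrite -mulr_sumr -/p.
  have := tailC_jump n_ge1 q_gt0; rewrite -/W big_mkord; move: (\sum_(k < m.+1) _) (tailC _ _) => A B h.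
  by rewrite -p2 -h; ring.
rewrite det_mulmx det_ublock det1 mulr1; congr (_ * _).
rewrite (expand_det_col _ ord0) (bigD1 ord_max)//= big1 ?addr0; last first.
  by move=> i im; rewrite !mxE (negbTE im) mul0r.
rewrite mxE !eqxx mulr1 /cofactor addn0.
have -> : row' ord_max (col' ord0 Q) = 1%:M.
  apply/matrixP => i j; rewrite !mxE (_ : lift ord_max i == ord_max = false); last first.
    by apply/negbTE; rewrite eq_sym neq_lift.
  congr (_%:R); rewrite -val_eqE /= /bump leq0n add1n leqNgt ltn_ord add0n eqSS eq_sym //.
rewrite det1 mulr1 /W.
(* The sign comes from the imaginary part of [lam] and cancels the sign of the cofactor, that of a
   cycle of length m + 1. *)
have -> : cexp (lam m.+1 q * (2 * pi)%:C) = (q `^ (2 * pi))%:C * (-1) ^+ m.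
  rewrite /cexp ReM ImM /lam/= mulr0 subr0 mulr0 add0r; congr (_ * _).
    by rewrite /powR gt_eqF// mulrC.
  have -> : m%:R / 2 * (2 * pi) = pi * m%:R :> R by field.
  rewrite expi_natmul.
  by congr (_ ^+ _); rewrite /expi cospi sinpi; apply: complex_ext; rewrite ?ReN ?ImN//= oppr0.
by rewrite -mulrA -expr2 sqrr_sign mulr1.
Qed.

(** * Adding one more time to a correlation determinant *)

Section transition.
Context (R : realType) (n : nat) (q : R).
Hypothesis n_ge1 : (1 <= n)%N.
Hypothesis q_gt0 : 0 < q.
Implicit Types (y z : n.-tuple R).
Local Notation kern := (kern n q).

Lemma cexp_lam (s : R) : cexp (lam n q * s%:C) = (q `^ s)%:C * expi (n.-1%:R / 2 * s).
Proof.
rewrite /cexp ReM ImM /lam/= !mulr0 subr0 add0r; congr (_%:C * _).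
by rewrite /powR gt_eqF// mulrC.
Qed.

(** If every z_j lies below y_j, the sum of displacements is negative, and the extra q^{2 pi} of
    [cmb_l1] is the [2 * pi] that [gap] then adds. *)
Lemma trans_det_weight y z : Dn y -> Dn z ->
  trans_det q y z = \det (cmb q (l0 R n)) *
    expi (n.-1%:R / 2 * \sum_(j < n) (tnth z j - tnth y j)) * (interlace_weight q y z)%:C.
Proof.
move=> Dy Dz; rewrite (trans_detE n_ge1 q_gt0) cexp_lam /interlace_weight.
have [int|nint] := boolP (interlace y z); last first.
  by rewrite (cmb_not_interlace n_ge1 q_gt0 Dy Dz nint) mulr0 mulr0.
rewrite /gap; have [le|nle] := boolP (interlace_le y z).
  have s0 : 0 <= \sum_(j < n) (tnth z j - tnth y j).
    by apply: sumr_ge0 => j _; rewrite subr_ge0; case/andP: le => /forallP/(_ j).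
  by rewrite s0 lmx_le//; ring.
have gt : interlace_gt y z by move: int; rewrite /interlace (negbTE nle).
have s0 : \sum_(j < n) (tnth z j - tnth y j) < 0.
  have h j : tnth z j - tnth y j < 0 by rewrite subr_lt0; case/andP: gt => /forallP/(_ j).
  rewrite (bigD1 (Ordinal n_ge1))//=; apply: ltr_wnDr => //.
  by rewrite -oppr_ge0 -sumrN; apply: sumr_ge0 => j _; rewrite oppr_ge0 ltW.
rewrite leNgt s0/= lmx_gt// (cmb_l1 n_ge1 q_gt0) powRD; last by rewrite (gt_eqF q_gt0) implybT.
by rewrite rmorphM/=; ring.
Qed.

Lemma trans_det_schur y z : emx y \in unitmx ->
  trans_det q y z = \det (emx y) * \det (fmx z + gam n q *m invmx (emx y) *m tmx q y z).
Proof.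
move=> uE; rewrite /trans_det.
have -> : block_mx (emx y) (- tmx q y z) (gam n q) (fmx z) =
  block_mx 1%:M 0 (gam n q *m invmx (emx y)) 1%:M *m
  block_mx (emx y) (- tmx q y z) 0 (fmx z + gam n q *m invmx (emx y) *m tmx q y z).
  rewrite mulmx_block !(mul1mx, mul0mx, mulmx0, addr0); congr (block_mx _ _ _ _).
    by rewrite -mulmxA mulVmx// mulmx1.
  by rewrite mulmxN addrC addrK.
by rewrite det_mulmx det_lblock !det1 mul1r mul1r det_ublock.
Qed.

(** A Schur complement that does not invert [M], here the determinant of the earlier times, which
    may be singular. *)
Lemma det_block_factor (F : comNzRingType) n1 n2 (A : 'M[F]_n1) (Cc : 'M[F]_(n2, n1)) (M : 'M[F]_n2) (G : 'M[F]_(n1, n2)) :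
  \det (block_mx A (G *m M) Cc M) = \det (A - G *m Cc) * \det M.
Proof.
have -> : block_mx A (G *m M) Cc M = block_mx 1%:M G 0 1%:M *m block_mx (A - G *m Cc) 0 Cc M.
  by rewrite mulmx_block !(mul1mx, mul0mx, mulmx0, add0r) subrK.
by rewrite det_mulmx det_ublock !det1 !mul1r det_lblock.
Qed.

Lemma corr_mx_cat p1 p2 (t1 : p1.-tuple int) (t2 : p2.-tuple int) (X1 : p1.-tuple R) (X2 : p2.-tuple R) :
  corr_mx n q (cat_tuple t1 t2) (cat_tuple X1 X2) =
  block_mx (corr_mx n q t1 X1)
    (\matrix_(i, j) kern (tnth t1 i) (tnth X1 i) (tnth t2 j) (tnth X2 j))
    (\matrix_(i, j) kern (tnth t2 i) (tnth X2 i) (tnth t1 j) (tnth X1 j))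
    (corr_mx n q t2 X2).
Proof.
apply/matrixP => i j; case: (split_ordP i) => i' ->; case: (split_ordP j) => j' ->;
  by rewrite ?block_mxEul ?block_mxEur ?block_mxEdl ?block_mxEdr !mxE ?tnth_lshift ?tnth_rshift.
Qed.

Lemma Dn_incirc z (i : 'I_n) : Dn z -> incirc (tnth z i).
Proof. by case=> _ /(_ i). Qed.

Lemma corr_time y (t : int) : Dn y -> corr n q (nseq_tuple n t) y = \det (emx y) * \det (fmx y).
Proof.
move=> Dy; rewrite /corr -det_mulmx; congr (\det _); apply/matrixP => i j.
rewrite !mxE !tnth_nseq /kern !Dn_incirc// lexx/= subrr big_mkord mulr_sumr.
apply: eq_bigr => k _; rewrite !mxE expr0z mul1r -mulrA -expiD; congr (_ * expi _); ring.
Qed.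

Lemma corr_time_Delta y (t : int) : Dn y ->
  corr n q (nseq_tuple n t) y = ((2 * pi) ^- n * Delta y ^+ 2)%:C.
Proof.
move=> Dy; rewrite corr_time// det_emx_Delta// det_fmx_Delta//.
rewrite rmorphM/= rmorphXn/= -exprVn rmorphXn/=.
have -> : vphase (-1) y = (vphase 1 y)^-1 by rewrite /vphase mulN1r mul1r expiN.
have h : vphase 1 y != 0 by exact: expi_neq0.
transitivity (((2 * pi)^-1)%:C ^+ n * (vunit n (- 'i%C) * vunit n 'i%C) * (Delta y)%:C ^+ 2 * ((vphase 1 y)^-1 * vphase 1 y)).
  by move: (vunit _ _) (vunit _ _) (_ ^+ n) (vphase _ _)^-1 => *; ring.
by rewrite mulVf// vunit_ii !mulr1.
Qed.

(** Towards points of time at most [t], the rows of time t + 1 are [emx z *m gam *m Vm] and those of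
    time [t] are [emx y *m Vm], with the same [Vm]. So the upper right block is [G] times the
    remaining matrix, and [G] involves only the rows of time [t]: the factor split off depends on
    [y] and [z] alone, which is the Markov property. *)
Lemma corr_step N (t : int) (tau : N.-tuple int) (z y : n.-tuple R) (X : N.-tuple R) :
  (forall i, tnth tau i <= t) -> Dn y -> Dn z -> Delta y != 0 ->
  corr n q (cat_tuple (nseq_tuple n (t + 1)) (cat_tuple (nseq_tuple n t) tau))
    (cat_tuple z (cat_tuple y X)) =
  \det (cmb q (l0 R n)) * (Delta z / Delta y * interlace_weight q y z)%:C *
  corr n q (cat_tuple (nseq_tuple n t) tau) (cat_tuple y X).
Proof.
move=> tau_t Dy Dz dy.
have uE : emx y \in unitmx by rewrite unitmxE unitfE det_emx_neq0.
set T := cat_tuple (nseq_tuple n t) tau; set Y := cat_tuple y X.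
have Tt i : tnth T i <= t.
  by rewrite /T; case: (split_ordP i) => i' ->; rewrite ?tnth_lshift ?tnth_rshift// tnth_nseq.
pose Vm : 'M[R[i]]_(n, n + N) := \matrix_(k, j) (if incirc (tnth Y j) then
   g n q k%:Z ^ (t - tnth T j) * expi (tnth Y j * k%:R) else 0).
have low (r : int) (w : n.-tuple R) i j : t <= r -> Dn w ->
   kern r (tnth w i) (tnth T j) (tnth Y j) = \sum_k emx w i k * (g n q k%:Z ^ (r - t) * Vm k j).
  move=> tr Dw; rewrite /kern Dn_incirc//=.
  have [ij|nj] := boolP (incirc (tnth Y j)); last first.
    by rewrite big1// => k _; rewrite !mxE (negbTE nj) !mulr0.
  rewrite (le_trans (Tt j) tr) big_mkord mulr_sumr; apply: eq_bigr => k _.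
  rewrite !mxE ij (exprz_split (g n q k%:Z) tr (Tt j)).
  have -> : expi ((tnth Y j - tnth w i) * k%:R) = expi (- tnth w i * k%:R) * expi (tnth Y j * k%:R).
    by rewrite -expiD; congr expi; ring.
  ring.
pose G := row_mx (emx z *m gam n q *m invmx (emx y)) (0 : 'M[R[i]]_(n, N)).
have usubM : usubmx (corr_mx n q T Y) = emx y *m Vm.
  apply/matrixP => i j; rewrite !mxE tnth_lshift [tnth Y (lshift _ _)]tnth_lshift tnth_nseq low//.
  by apply: eq_bigr => k _; rewrite subrr expr0z mul1r.
rewrite /corr corr_mx_cat.
have -> : \matrix_(i, j) kern (tnth (nseq_tuple n (t + 1)) i) (tnth z i) (tnth T j) (tnth Y j) = G *m corr_mx n q T Y.
  rewrite -[corr_mx n q T Y]vsubmxK /G mul_row_col mul0mx addr0 usubM -!mulmxA (mulmxA (invmx _)) mulVmx// mul1mx.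
  apply/matrixP => i j; rewrite mxE tnth_nseq low ?lerDl// mxE; apply: eq_bigr => k _; congr (_ * _).
  rewrite mul_diag_mx !mxE; congr (_ * _).
  by rewrite addrAC subrr add0r expr1z.
rewrite det_block_factor -/(corr n q T Y); congr (_ * _).
have -> : corr_mx n q (nseq_tuple n (t + 1)) z = emx z *m fmx z.
  apply/matrixP => i j; rewrite !mxE !tnth_nseq /kern !Dn_incirc// lexx/= subrr big_mkord mulr_sumr.
  apply: eq_bigr => k _; rewrite !mxE expr0z mul1r -mulrA -expiD; congr (_ * expi _); ring.
set Cc := \matrix_(i, j) _.
have -> : G *m Cc = - (emx z *m (gam n q *m invmx (emx y) *m tmx q y z)).
  rewrite -[Cc]vsubmxK /G mul_row_col mul0mx addr0 -!mulmxA -!mulmxN; congr (_ *m (_ *m (_ *m _))).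
  apply/matrixP => i j; rewrite !mxE !tnth_nseq tnth_lshift [tnth Y (lshift _ _)]tnth_lshift tnth_nseq /kern !Dn_incirc//=.
  rewrite leNgt ltrDl ltr01/= mulrN; congr (- (_ * tailK _ _ _ _ _)); lia.
rewrite opprK -mulmxDr det_mulmx.
have dE0 : \det (emx y) != 0 by rewrite -unitfE -unitmxE.
have -> : \det (fmx z + gam n q *m invmx (emx y) *m tmx q y z) = trans_det q y z / \det (emx y).
  by rewrite trans_det_schur// mulrC mulKf.
rewrite trans_det_weight// !det_emx_Delta// !rmorphM/= (_ : ((Delta y)^-1)%:C = ((Delta y)%:C)^-1); last by rewrite fmorphV.
have -> : expi (n.-1%:R / 2 * \sum_(j < n) (tnth z j - tnth y j)) = vphase (-1) y / vphase (-1) z.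
  rewrite /vphase -expiN -expiD; congr expi; rewrite sumrB; ring.
have : vphase (-1) y != 0 by exact: expi_neq0.
have : vphase (-1) z != 0 by exact: expi_neq0.
have : vunit n (- 'i%C) != 0 :> R[i].
  by apply/eqP => h; have := vunit_ii R n; rewrite h mul0r => /eqP; rewrite eq_sym oner_eq0.
have : (Delta y)%:C != 0 by rewrite fmorph_eq0.
have : ((2 * pi)^-1)%:C ^+ n != 0 :> R[i].
  by rewrite expf_neq0// fmorph_eq0 invr_eq0 mulf_neq0// ?gt_eqF ?pi_gt0.
move: (vphase _ y) (vphase _ z) (vunit _ _) (Delta y)%:C (Delta z)%:C (_ ^+ n) (\det _) (interlace_weight _ _ _)%:C => A B C D D' E F G' h1 h2 h3 h4 h5.
by field; rewrite ?h1 ?h2 ?h3 ?h4 ?h5.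
Qed.
End transition.

(** * Lebesgue measure on tuples *)

Section tuple_integration.
Context (R : realType).
Local Notation mu := (@lebesgue_measure R).
Local Notation L := (lebesgue_tuple R).
Local Open Scope ereal_scope.

Lemma measurable_reindex p m d (T : measurableType d) (X : T -> p.-tuple R) (f : 'I_m -> 'I_p) :
  measurable_fun setT X -> measurable_fun setT (fun x => reindex_tuple (X x) f).
Proof.
move=> mX; apply/measurable_fun_tnthP => i; rewrite (_ : _ \o _ = fun x => tnth (X x) (f i)).
  by move/measurable_fun_tnthP : mX => /(_ (f i)).
by apply/funext => x /=; rewrite tnth_mktuple.
Qed.

Lemma measurable_cat n k d (T : measurableType d) (X : T -> n.-tuple R) (Y : T -> k.-tuple R) :
  measurable_fun setT X -> measurable_fun setT Y ->
  measurable_fun setT (fun x => cat_tuple (X x) (Y x) : (n + k).-tuple R).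
Proof.
move=> /measurable_fun_tnthP mX /measurable_fun_tnthP mY; apply/measurable_fun_tnthP => i.
rewrite -(splitK i); case: (fintype.split i) => j /=.
  rewrite (_ : _ \o _ = fun x => tnth (X x) j); first exact: mX.
  by apply/funext => x /=; rewrite tnth_lshift.
rewrite (_ : _ \o _ = fun x => tnth (Y x) j); first exact: mY.
by apply/funext => x /=; rewrite tnth_rshift.
Qed.

Lemma lebesgue_tuple_prod n (f : n.+1.-tuple R -> \bar R) : measurable_fun setT f ->
  (forall X, 0 <= f X) -> \int[L n.+1]_X f X = \int[(mu \x L n)%E]_z f (cons_pair z).
Proof.
move=> mf f0.
have := @ge0_integral_pushforward _ _ _ _ R (@cons_pair _ (measurableTypeR R) n)
   (@measurable_cons_pair _ (measurableTypeR R) n) (mu \x L n)%E setT f measurableT mf (fun x _ => f0 x).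
by rewrite preimage_setT => <-.
Qed.

Lemma measurable_comp_cons n (f : n.+1.-tuple R -> \bar R) : measurable_fun setT f ->
  measurable_fun setT (fun z : measurableTypeR R * n.-tuple (measurableTypeR R) => f (cons_pair z)).
Proof.
move=> mf; apply: (measurableT_comp mf).
exact: (@measurable_cons_pair _ (measurableTypeR R) n).
Qed.

Lemma integral_tuple_cons n (f : n.+1.-tuple R -> \bar R) : measurable_fun setT f ->
  (forall X, 0 <= f X) ->
  \int[L n.+1]_X f X = \int[mu]_c \int[L n]_Y f [tuple of c :: Y].
Proof.
move=> mf f0; rewrite lebesgue_tuple_prod // fubini_tonelli1 //.
exact: measurable_comp_cons.
Qed.

Lemma integral_tuple_cons2 n (f : n.+1.-tuple R -> \bar R) : measurable_fun setT f ->
  (forall X, 0 <= f X) ->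
  \int[L n.+1]_X f X = \int[L n]_Y \int[mu]_c f [tuple of c :: Y].
Proof.
move=> mf f0; rewrite lebesgue_tuple_prod // fubini_tonelli2 //.
exact: measurable_comp_cons.
Qed.

Lemma lebesgue_tuple_rect n (B : 'I_n -> set R) : (forall i, measurable (B i)) ->
  L n [set X | forall i, B i (tnth X i)] = \prod_(i < n) mu (B i).
Proof.
elim: n B => [|n IH] B mB.
  rewrite big_ord0 /= diracE mem_set //= => -[]//.
rewrite big_ord_recl -IH //.
have mr : measurable [set X : n.-tuple (measurableTypeR R) | forall i, B (lift ord0 i) (tnth X i)].
  rewrite (_ : mkset _ = \bigcap_(i in [set: 'I_n]) ((@tnth _ _ ^~ i) @^-1` B (lift ord0 i))).
    apply: fin_bigcap_measurable => // i _.
    rewrite -[X in measurable X]setTI.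
    by apply: (@measurable_tnth _ (measurableTypeR R)); [exact: measurableT|exact: mB].
  by apply/seteqP; split => [X h i _|X h i]; [exact: h|exact: (h i I)].
have h := @product_measure1E _ _ _ _ _ mu (L n) _ _ (mB ord0) mr.
rewrite -h {h} /= /tuple_measureS /pushforward; congr product_measure1.
apply/seteqP; split => [[x t] /= h|[x t] /= [hx ht] i].
  by split; [exact: (h ord0)|move=> i; have := h (lift ord0 i); rewrite tnthS].
case: (unliftP ord0 i) => [j|] ->; first by rewrite tnthS; exact: ht.
exact: hx.
Qed.

Definition rect n : set (set (n.-tuple R)) :=
  [set A | exists B : 'I_n -> set R, (forall i, measurable (B i)) /\ A = [set X | forall i, B i (tnth X i)]].

Lemma measurable_rect n (A : set (n.-tuple R)) : rect A -> measurable A.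
Proof.
move=> [B [mB ->]].
rewrite (_ : mkset _ = \bigcap_(i in [set: 'I_n]) ((@tnth _ _ ^~ i) @^-1` B i)).
  apply: fin_bigcap_measurable => // i _.
  by rewrite -[X in measurable X]setTI; exact: measurable_tnth.
by apply/seteqP; split => [X h i _|X h i]; exact: h.
Qed.

Lemma sigma_rect n : @measurable _ (n.-tuple (measurableTypeR R)) = <<s @rect n >>.
Proof.
apply/seteqP; split.
  apply: smallest_sub; first exact: smallest_sigma_algebra.
  rewrite -bigcup_seq => A [i _ [B mB <-]]; apply: sub_sigma_algebra.
  exists (fun j => if j == i then B else setT); split=> [j|]; first by case: ifP.
  rewrite setTI; apply/seteqP; split => [X h j|X /= /(_ i)]; last by rewrite eqxx.
  by case: eqP => // ->.
apply: smallest_sub; first exact: sigma_algebra_measurable.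
by move=> A /measurable_rect.
Qed.

(** The two measures agree on rectangles, a generating family closed under intersection, and the
    cubes [-k, k]^n exhaust the space with finite measure. *)
Lemma lebesgue_tuple_perm n (s : {perm 'I_n}) (A : set (n.-tuple R)) : measurable A ->
  L n [set X | A (reindex_tuple X s)] = L n A.
Proof.
move=> mA.
have mphi : measurable_fun setT (fun X : n.-tuple (measurableTypeR R) => reindex_tuple X s).
  by apply: measurable_reindex; exact: measurable_id.
pose phi (X : n.-tuple (measurableTypeR R)) : n.-tuple (measurableTypeR R) := reindex_tuple X s.
have [m2 m2E] : exists m2 : {measure set (n.-tuple (measurableTypeR R)) -> \bar R},
    forall B, m2 B = L n (phi @^-1` B).
  by unshelve eexists (@pushforward _ _ _ _ _ (L n) phi); first exact: mphi.
transitivity (m2 A); first by rewrite m2E.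
apply/esym.
pose box k := [set X : n.-tuple R | forall i, [set` `[(- k%:R)%R, (k%:R : R)%R]] (tnth X i)].
refine (@measure_unique _ R (n.-tuple (measurableTypeR R)) (@rect n) box
  (@sigma_rect n) _ _ _ (L n) m2 _ _ A mA).
- move=> _ _ [B [mB ->]] [C [mC ->]]; exists (fun i => B i `&` C i); split.
    by move=> i; exact: measurableI.
  by apply/seteqP; split => [X [h1 h2] i|X h]; split => // i; case: (h i).
- by move=> k; exists (fun=> [set` `[(- k%:R)%R, (k%:R : R)%R]]); split => // i; exact: measurable_itv.
- apply/seteqP; split => // X _; exists (\sum_(i < n) (Num.trunc `|tnth X i|).+1)%N => // i /=.
  rewrite in_itv /= -ler_norml; have h := Num.Theory.truncnS_gt `|tnth X i|%R.
  apply: (le_trans (ltW h)); rewrite ler_nat (bigD1 i) //=; exact: leq_addr.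
- move=> _ [B [mB ->]]; apply: (etrans (lebesgue_tuple_rect mB)); rewrite m2E.
  rewrite (_ : _ @^-1` _ = [set X : n.-tuple R | forall i, B ((s^-1)%g i) (tnth X i)]).
    apply/esym/(etrans (lebesgue_tuple_rect (fun i => mB ((s^-1)%g i)))).
    by rewrite (reindex_inj (@perm_inj _ s)) /=; apply: eq_bigr => i _; rewrite permK.
  apply/seteqP; split => X /= h i.
    by have := h ((s^-1)%g i); rewrite tnth_mktuple permKV.
  by rewrite tnth_mktuple; have := h (s i); rewrite permK.
- move=> k; have mk (i : 'I_n) : measurable [set` `[(- k%:R)%R, (k%:R : R)%R]] by exact: measurable_itv.
  rewrite [X in X < _](lebesgue_tuple_rect mk).
  rewrite (eq_bigr (fun=> (fine (mu `[(- k%:R)%R, (k%:R : R)%R]))%:E)); last first.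
    by move=> i _; rewrite lebesgue_measure_itv /=; case: ifP.
  by rewrite prodEFin ltry.
Qed.

Lemma integral_tuple_perm n (s : {perm 'I_n}) (f : n.-tuple R -> \bar R) : measurable_fun setT f ->
  (forall X, 0 <= f X) -> \int[L n]_X f (reindex_tuple X s) = \int[L n]_X f X.
Proof.
move=> mf f0.
have mphi : measurable_fun setT (fun X : n.-tuple (measurableTypeR R) => reindex_tuple X s).
  by apply: measurable_reindex; exact: measurable_id.
have := @ge0_integral_pushforward _ _ _ _ R _ mphi (L n) setT f measurableT mf (fun x _ => f0 x).
rewrite preimage_setT /comp => <-.
by apply: eq_measure_integral => A mA _; exact: lebesgue_tuple_perm.
Qed.

Lemma integral_tuple0 (f : 0.-tuple R -> \bar R) : (forall X, 0 <= f X) ->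
  \int[L 0%N]_X f X = f [tuple].
Proof.
move=> f0; have e : f = cst (f [tuple]) by apply/funext => X; rewrite (tuple0 X).
have := @integral_dirac _ (0.-tuple (measurableTypeR R)) [tuple] R setT measurableT f.
rewrite {1}e => /(_ (measurable_cst _)).
by rewrite diracE mem_set // mul1e.
Qed.

Lemma measurable_integral_cat n k (f : (n + k).-tuple R -> \bar R) : measurable_fun setT f ->
  (forall X, 0 <= f X) ->
  measurable_fun setT (fun z : n.-tuple R => \int[L k]_X f (cat_tuple z X)).
Proof.
move=> mf f0.
apply: (@measurable_fun_fubini_tonelli_F _ _ _ (k.-tuple (measurableTypeR R)) R (L k)
  (fun z : n.-tuple (measurableTypeR R) * k.-tuple (measurableTypeR R) => f (cat_tuple z.1 z.2))) => //.
by apply: (measurableT_comp mf); exact: measurable_cat.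
Qed.

Lemma integral_tuple_cat n k (f : (n + k).-tuple R -> \bar R) : measurable_fun setT f ->
  (forall X, 0 <= f X) ->
  \int[L (n + k)%N]_X f X = \int[L n]_z \int[L k]_X f (cat_tuple z X).
Proof.
elim: n f => [|n IH] f mf f0.
  rewrite integral_tuple0; last by move=> X; exact: integral_ge0.
  by apply: eq_integral => X _; congr f; apply/val_inj.
have -> : \int[L (n.+1 + k)%N]_X f X = \int[mu]_c \int[L (n + k)%N]_Y f [tuple of c :: Y].
  exact: (@integral_tuple_cons (n + k)).
rewrite integral_tuple_cons; last 2 first.
- exact: measurable_integral_cat.
- by move=> z; exact: integral_ge0.
apply: eq_integral => c _; rewrite IH //.
  apply: eq_integral => z _; apply: eq_integral => X _; congr f; exact/val_inj.
apply: (measurableT_comp mf).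
exact: (@measurable_cons _ _ _ (measurableTypeR R) (fun=> c) (n + k) id).
Qed.

Lemma measurable_uniq n : measurable [set X : n.-tuple R | uniq X].
Proof.
rewrite (_ : mkset _ = \bigcap_(i in [set: 'I_n]) \bigcap_(j in [set j : 'I_n | j != i])
    [set X : n.-tuple R | tnth X i != tnth X j]); last first.
  apply/seteqP; split => [X uX i _ j /= ji|X h].
    by apply: contra ji => /eqP /(tuple_uniqP _ uX) ->.
  apply/tuple_uniqP => i j e; apply/eqP/contraT => ij.
  by have := h j I i ij; rewrite /= e eqxx.
apply: fin_bigcap_measurable => // i _; apply: fin_bigcap_measurable => // j _.
rewrite (_ : mkset _ = ~` ((fun X : n.-tuple R => tnth X i - tnth X j)%R @^-1` [set 0%R])).
  apply: measurableC; rewrite -[X in measurable X]setTI.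
  suff m : measurable_fun setT (fun X : n.-tuple (measurableTypeR R) => tnth X i - tnth X j)%R by exact: m.
  by apply: measurable_funB; exact: measurable_tnth.
by apply/seteqP; split => X /=; rewrite -subr_eq0 => /eqP.
Qed.

Lemma ae_uniq n : L n [set X : n.-tuple R | ~~ uniq X] = 0.
Proof.
have mU k : measurable [set X : k.-tuple R | ~~ uniq X].
  rewrite (_ : [set X : k.-tuple R | ~~ uniq X] = ~` [set X | uniq X]); first by apply: measurableC; exact: measurable_uniq.
  by apply/seteqP; split => X /= /negP.
have mI k : measurable_fun setT (fun X : k.-tuple R => (\1_[set X : k.-tuple R | ~~ uniq X] X)%:E : \bar R).
  by apply/measurable_EFinP; exact: (@measurable_indic _ (k.-tuple (measurableTypeR R)) R setT _ (mU k)).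
elim: n => [|n IH].
  rewrite (_ : mkset _ = set0) ?measure0 //; apply/seteqP; split => // X /=.
  by rewrite (tuple0 X).
have e k : L k [set X : k.-tuple R | ~~ uniq X] = \int[L k]_X (\1_[set X : k.-tuple R | ~~ uniq X] X)%:E.
  by rewrite (@integral_indic _ (k.-tuple (measurableTypeR R)) R (L k) setT measurableT _ (mU k)) setIT.
rewrite e integral_tuple_cons2 //.
(* For a fixed [Y] without repetition, the bad values of the new coordinate are the finitely many
   entries of [Y]. *)
have z : {ae L n, forall Y : n.-tuple R, setT Y ->
   (\int[mu]_c (\1_[set X : n.+1.-tuple R | ~~ uniq X] [tuple of c :: Y])%:E) = cst 0%E Y}.
  exists [set X : n.-tuple R | ~~ uniq X]; split; [exact: mU|exact: IH|] => Y /=; apply: contra_notP => /negP; rewrite negbK => uY _.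
  rewrite (_ : (fun c => _) = (fun c => (\1_[set` (Y : seq R)] c)%:E)).
    rewrite integral_indic ?setIT //; first exact: (countable_lebesgue_measure0 (finite_set_countable (finite_seq _))).
    by apply: countable_measurable; [exact: measurable_set1|apply: finite_set_countable; exact: finite_seq].
  apply/funext => c; rewrite !indicE; congr (_%:R%:E); congr nat_of_bool.
  apply/idP/idP => /set_mem /= h; apply/mem_set => /=.
    by move: h; rewrite uY andbT negbK.
  by rewrite negb_and negbK h.
rewrite (ge0_ae_eq_integral _ _ _ _ _ z) ?integral_cst ?mul0e //.
- apply: (@measurable_fun_fubini_tonelli_G _ _ (measurableTypeR R) (n.-tuple (measurableTypeR R)) R mu
    (fun z => (\1_[set X : n.+1.-tuple R | ~~ uniq X] (cons_pair z))%:E)).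
  - exact: (measurable_comp_cons (mI n.+1)).
  - by move=> x; rewrite lee_fin.
- by move=> Y _; apply: integral_ge0 => c _; rewrite lee_fin.
Qed.

End tuple_integration.

(** * Positivity of the correlation determinants *)

Section sorting.
Context (R : realType).

Section key.
Context (N : nat) (tau : N.-tuple int) (X : N.-tuple R).

(** Sorting by this order lists a window as in [block_times], with each configuration increasing; it
    is antisymmetric precisely when no two points share time and position. *)
Definition key_le : rel 'I_N := fun i j =>
  (tnth tau j < tnth tau i) || ((tnth tau i == tnth tau j) && (tnth X i <= tnth X j)).

Lemma key_le_total : total key_le.
Proof. by move=> i j; rewrite /key_le; case: ltgtP => //= _; exact: le_total. Qed.

Lemma key_le_trans : transitive key_le.
Proof.
move=> j i k; rewrite /key_le => /orP[h1|/andP[/eqP -> h1]] /orP[h2|/andP[/eqP e h2]].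
- by rewrite (lt_trans h2 h1).
- by rewrite -e h1.
- by rewrite h2.
- by rewrite e eqxx (le_trans h1 h2) orbT.
Qed.

Definition key_sorted (s : {perm 'I_N}) : bool :=
  [forall i : 'I_N, forall j : 'I_N, (i < j)%N ==> key_le (s i) (s j)].

Lemma key_sorted_pairwise (s : {perm 'I_N}) :
  key_sorted s = pairwise key_le [tuple s i | i < N].
Proof.
rewrite /key_sorted; move: key_le; case: N s => [|M] s r.
  by rewrite (tuple0 [tuple s i | i < 0]) /=; apply/forallP; case.
apply/idP/idP => [/forallP h|/(pairwiseP ord0) h].
  apply/(pairwiseP ord0) => i j; rewrite !inE !size_tuple => iM jM ij.
  have /forallP/(_ (Ordinal jM))/implyP/(_ ij) := h (Ordinal iM).
  by rewrite -!(tnth_mktuple s) !(tnth_nth ord0).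
apply/forallP => i; apply/forallP => j; apply/implyP => ij.
have := h i j; rewrite !inE !size_tuple !ltn_ord => /(_ isT isT ij).
by rewrite -!(tnth_nth ord0) !tnth_mktuple.
Qed.

Lemma key_sorted_exists : exists s, key_sorted s.
Proof.
have : perm_eq (sort key_le (enum 'I_N)) (ord_tuple N) by rewrite perm_sort.
move/tuple_permP => [s e]; exists s; rewrite key_sorted_pairwise.
rewrite (_ : tval _ = sort key_le (enum 'I_N)).
  by rewrite -(sorted_pairwise key_le_trans); exact: (sort_sorted key_le_total).
by rewrite e; congr tval; apply: eq_from_tnth => i; rewrite !tnth_mktuple tnth_ord_tuple.
Qed.

Lemma key_sorted_unique s s' :
  (forall i j, i != j -> tnth tau i = tnth tau j -> tnth X i != tnth X j) ->
  key_sorted s -> key_sorted s' -> s = s'.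
Proof.
move=> h; rewrite !key_sorted_pairwise -!(sorted_pairwise key_le_trans) => hs hs'.
have anti : antisymmetric key_le.
  move=> i j; rewrite /key_le; case: ltgtP => //= e /le_anti eX; apply/eqP; apply: contraT => ij.
  by have := h i j ij (esym e); rewrite eX eqxx.
have := sorted_eq key_le_trans anti hs hs'.
have -> : perm_eq [tuple s i | i < N] [tuple s' i | i < N].
  apply/tuple_permP; exists (s * s'^-1)%g; congr tval.
  by apply: eq_from_tnth => i; rewrite !tnth_mktuple permM permKV.
move=> /(_ isT) e; apply/permP => i.
by rewrite -[s i](tnth_mktuple s) -[s' i](tnth_mktuple s'); congr tnth; exact/val_inj.
Qed.

Lemma key_sorted_tau s : (forall i j : 'I_N, (i < j)%N -> tnth tau j <= tnth tau i) ->
  key_sorted s -> reindex_tuple tau s = tau.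
Proof.
move=> dec hs; apply/val_inj; apply: (@sorted_eq _ >=%O).
- exact: ge_trans.
- exact: ge_anti.
- rewrite sorted_pairwise; last exact: ge_trans.
  apply/(pairwiseP 0) => i j; rewrite !inE !size_tuple => iN jN ij.
  rewrite -!(tnth_nth 0 _ (Ordinal iN)) -!(tnth_nth 0 _ (Ordinal jN)) !tnth_mktuple.
  move/forallP : hs => /(_ (Ordinal iN)) /forallP/(_ (Ordinal jN)) /implyP/(_ ij).
  by rewrite /key_le /= => /orP[/ltW//|/andP[/eqP -> _]].
- rewrite sorted_pairwise; last exact: ge_trans.
  apply/(pairwiseP 0) => i j; rewrite !inE !size_tuple => iN jN ij.
  rewrite -!(tnth_nth 0 _ (Ordinal iN)) -!(tnth_nth 0 _ (Ordinal jN)).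
  exact: dec.
- by apply/tuple_permP; exists s.
Qed.

End key.

End sorting.

(** * Windows of complete configurations *)

Section blocks.
Context (R : realType) (n : nat).

(* n copies of each of the times s + m - 1, ..., s, latest first. *)
Fixpoint block_times (s : int) m : (m * n).-tuple int :=
  if m is m'.+1 then cat_tuple (nseq_tuple n (s + m'%:Z)) (block_times s m') else [tuple].

Definition head_block T k (X : (n + k).-tuple T) : n.-tuple T := reindex_tuple X (@lshift n k).
Definition tail_block T k (X : (n + k).-tuple T) : k.-tuple T := reindex_tuple X (@rshift n k).

Lemma cat_blocks T k (X : (n + k).-tuple T) : cat_tuple (head_block X) (tail_block X) = X.
Proof.
apply: eq_from_tnth => i; rewrite -(splitK i); case: (fintype.split i) => j /=.
  by rewrite tnth_lshift tnth_mktuple.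
by rewrite tnth_rshift tnth_mktuple.
Qed.

Lemma head_cat T k (z : n.-tuple T) (X : k.-tuple T) : head_block (cat_tuple z X) = z.
Proof. by apply: eq_from_tnth => i; rewrite tnth_mktuple tnth_lshift. Qed.

Lemma tail_cat T k (z : n.-tuple T) (X : k.-tuple T) : tail_block (cat_tuple z X) = X.
Proof. by apply: eq_from_tnth => i; rewrite tnth_mktuple tnth_rshift. Qed.

Lemma tnth_nseq_tuple T (x : T) (i : 'I_n) : tnth (nseq_tuple n x) i = x.
Proof. by rewrite (tnth_nth x) nth_nseq ltn_ord. Qed.

Lemma block_times_lt s m i : tnth (block_times s m) i < s + m%:Z.
Proof.
elim: m i => [|m IH]; first by case.
move=> i; rewrite -(@splitK n (m * n) i); case: (fintype.split _) => j /=.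
  by rewrite tnth_lshift tnth_nseq_tuple; lia.
by rewrite tnth_rshift; apply: (lt_trans (IH j)); lia.
Qed.

Lemma block_times_ge s m i : s <= tnth (block_times s m) i.
Proof.
elim: m i => [|m IH]; first by case.
move=> i; rewrite -(@splitK n (m * n) i); case: (fintype.split _) => j /=.
  by rewrite tnth_lshift tnth_nseq_tuple; lia.
by rewrite tnth_rshift; exact: IH.
Qed.

Lemma count_block_times s m t : s <= t < s + m%:Z -> count_mem t (block_times s m) = n.
Proof.
elim: m => [|m IH] h; first by exfalso; lia.
rewrite /= count_cat count_nseq /=.
have [tm|tm] := eqVneq (s + m%:Z) t; last by rewrite mul0n IH //; lia.
rewrite mul1n (_ : count_mem _ _ = 0%N) ?addn0 //; apply/count_memPn/negP => /tnthP[i e].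
by have := block_times_lt s i; rewrite -e -tm ltxx.
Qed.

Lemma block_times_decr s m (i j : 'I_(m * n)) : (i < j)%N ->
  tnth (block_times s m) j <= tnth (block_times s m) i.
Proof.
elim: m i j => [|m IH]; first by case.
move=> i j; rewrite -(@splitK n (m * n) i) -(@splitK n (m * n) j).
case: (fintype.split i) => i'; case: (fintype.split j) => j' /=.
- by rewrite !tnth_lshift !tnth_nseq_tuple.
- by rewrite tnth_lshift tnth_rshift tnth_nseq_tuple => _; apply/ltW; exact: block_times_lt.
- by move=> h; exfalso; have := ltn_ord j'; lia.
- by rewrite !tnth_rshift ltn_add2l; exact: IH.
Qed.

Fixpoint blocks_Dn m : (m * n).-tuple R -> Prop :=
  if m is m'.+1 then fun X => Dn (@head_block R (m' * n) X) /\ blocks_Dn (@tail_block R (m' * n) X)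
  else fun=> True.

Lemma sorted_tuple (z : n.-tuple R) :
  (forall i j : 'I_n, (i < j)%N -> tnth z i <= tnth z j) <-> sorted <=%R z.
Proof.
rewrite (sorted_pairwise le_trans); split=> [h|/(pairwiseP 0) h i j ij].
  apply/(pairwiseP 0) => i j; rewrite !inE !size_tuple => iN jN ij.
  by rewrite -!(tnth_nth 0 _ (Ordinal iN)) -!(tnth_nth 0 _ (Ordinal jN)); exact: h.
by have := h i j; rewrite !inE !size_tuple !ltn_ord -!tnth_nth; exact.
Qed.

(** Restates the recursive condition as sortedness of the identity, a form that can be transported
    along permutations of the window. *)
Lemma blocks_DnP s m (X : (m * n).-tuple R) : blocks_Dn X <->
  (forall i, incirc (tnth X i)) /\ key_sorted (block_times s m) X 1%g.
Proof.
suff : blocks_Dn X <-> (forall i, incirc (tnth X i)) /\ (forall i j : 'I_(m * n), (i < j)%N ->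
    tnth (block_times s m) i = tnth (block_times s m) j -> tnth X i <= tnth X j).
  move=> ->; split=> -[h1 h2]; split => //.
    apply/forallP => i; apply/forallP => j; apply/implyP => ij; rewrite !perm1 /key_le.
    have := block_times_decr s ij; rewrite le_eqVlt => /orP[/eqP e|->//].
    by rewrite e eqxx h2 ?orbT.
  move=> i j ij e; move/forallP : h2 => /(_ i) /forallP/(_ j) /implyP/(_ ij); rewrite !perm1 /key_le e ltxx eqxx /=.
  exact.
elim: m X => [|m IH] X; first by split => // _; split; case.
rewrite /= -{3 4 5}(@cat_blocks R (m * n) X) IH.
set z := head_block X; set Y := tail_block X.
split=> [[[sz bz] [bY hY]]|[b h]].
  split=> [i|i j].
    rewrite -(@splitK n (m * n) i); case: (fintype.split _) => k /=.
      by rewrite tnth_lshift; exact: bz.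
    by rewrite tnth_rshift; exact: bY.
  rewrite -(@splitK n (m * n) i) -(@splitK n (m * n) j).
  case: (fintype.split i) => i'; case: (fintype.split j) => j' /=.
  - by rewrite !tnth_lshift => ij _; move/sorted_tuple : sz; exact.
  - rewrite tnth_lshift tnth_rshift tnth_nseq_tuple => _ e.
    by have := block_times_lt s j'; rewrite -e ltxx.
  - by move=> e; exfalso; have := ltn_ord j'; lia.
  - by rewrite !tnth_rshift ltn_add2l; exact: hY.
split.
  split=> [|j]; last by have := b (lshift _ j); rewrite tnth_lshift.
  apply/sorted_tuple => i j ij; have := h (lshift _ i) (lshift _ j) ij.
  by rewrite !tnth_lshift !tnth_nseq_tuple; exact.
split=> [j|i j ij]; first by have := b (rshift _ j); rewrite tnth_rshift.
have := h (rshift _ i) (rshift _ j); rewrite ltn_add2l => /(_ ij).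
by rewrite !tnth_rshift.
Qed.

End blocks.

Lemma int_window (l : seq int) : exists s m, forall t, t \in l -> s <= t < s + m%:Z.
Proof.
suff [M h] : exists M : nat, forall t, t \in l -> `|t| <= M%:Z.
  by exists (- M%:Z), (M.*2.+1) => t /h; rewrite -addnn; lia.
elim: l => [|u l [M h]]; first by exists 0%N.
exists (M + `|u|)%N => t; rewrite inE => /orP[/eqP ->|/h]; lia.
Qed.

(** * The sign of the determinants *)

Section positivity.
Context (R : realType) (n : nat) (q : R).
Hypothesis n_ge1 : (1 <= n)%N.
Hypothesis q_gt0 : 0 < q.
Local Notation corr := (corr n q).
Local Notation D := (\det (cmb q (l0 R n))).
Local Notation bt := (block_times n).

Lemma integralC_ge0 (A : set R) (f : R -> R[i]) : (forall c, 0 <= f c) -> 0 <= integralC A f.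
Proof.
move=> h; rewrite /integralC lecE /=.
have hIm c : complex.Im (f c) = 0 by have := h c; rewrite lecE /= => /andP[/eqP -> _].
apply/andP; split.
  by rewrite /Rintegral integral0_eq // => x _; rewrite hIm.
by apply: Rintegral_ge0 => c _; have := h c; rewrite lecE /= => /andP[].
Qed.

Lemma corr_cons_integrable p (t : int) (tau : p.-tuple int) (X : p.-tuple R) :
  cintegrable (@circ R) (fun x => corr [tuple of t :: tau] [tuple of x :: X]).
Proof.
have [M HM] := corr_bounded n_ge1 q_gt0 [tuple of t :: tau].
apply: (@bounded_cintegrable R _ (@measurable_circ R) (mu_circ_fin R) _ M); last by move=> x _; exact: HM.
have [h1 h2] : cmfun (fun x : R => corr [tuple of t :: tau] [tuple of x :: X]).
  by apply: (corr_cmfun n_ge1 q_gt0); apply: (@measurable_cons _ _ _ (measurableTypeR R) id p (fun=> X)).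
by split; exact: measurable_funTS.
Qed.

Lemma corr_ge0_tail (z : R[i]) p (t : int) (tau : p.-tuple int) :
  (forall X, 0 <= z * corr [tuple of t :: tau] X) -> (count_mem t tau < n)%N ->
  forall X, 0 <= z * corr tau X.
Proof.
move=> h c X.
have : 0 <= integralC (@circ R) (fun x => z * corr [tuple of t :: tau] [tuple of x :: X]).
  by apply: integralC_ge0 => x.
rewrite integralCZ; last exact: corr_cons_integrable.
rewrite integral_corr_cons // mulrCA.
  by rewrite pmulr_rge0 // -natrB ?ltr0n ?subn_gt0 //; exact: ltnW.
exact: measurable_circ.
Qed.

Lemma Delta_eq0 (y : n.-tuple R) : Dn y -> Delta y = 0 ->
  exists i j : 'I_n, i != j /\ tnth y i = tnth y j.
Proof.
move=> Dy /eqP; rewrite /Delta => /prodf_eq0[l _] /prodf_eq0[p lp].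
have h := Dn_lt Dy lp; rewrite normc_expiB // mulf_eq0 pnatr_eq0 /= => /eqP sn0.
exists l, p; split; first by apply: contraTneq lp => ->; rewrite ltnn.
case/andP: h => h0 h2; apply/eqP; rewrite eq_sym -subr_eq0; move: h0; rewrite le_eqVlt => /orP[/eqP <-//|h0].
by exfalso; move: sn0; apply/eqP; rewrite gt_eqF // sin_gt0_pi //; lra.
Qed.

Lemma Delta_ge0 (y : n.-tuple R) : 0 <= Delta y.
Proof. by apply: prodr_ge0 => l _; apply: prodr_ge0 => p _; exact: normc_ge0. Qed.

Lemma interlace_weight_ge0 (y z : n.-tuple R) : 0 <= interlace_weight q y z.
Proof. by rewrite /interlace_weight; case: ifP => // _; exact: powR_ge0. Qed.

Lemma corr_cat0 p (tau : p.-tuple int) (X : p.-tuple R) (t0 : 0.-tuple int) (X0 : 0.-tuple R) :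
  corr (cat_tuple tau t0) (cat_tuple X X0) = corr tau X.
Proof.
rewrite /corr corr_mx_cat; set C := (X in block_mx _ _ X _).
by rewrite (flatmx0 C) det_ublock (det_mx00 (corr_mx _ _ t0 X0)) mulr1.
Qed.

Lemma corr_block1 s (X : (1 * n).-tuple R) : Dn (@head_block n R (0 * n) X) ->
  corr (bt s 1) X = ((2 * pi)^-n * Delta (@head_block n R (0 * n) X) ^+ 2)%:C.
Proof.
move=> Dz; rewrite -{1}(@cat_blocks n R (0 * n) X).
by rewrite (@corr_cat0 n (nseq_tuple n (s + 0%:Z))) corr_time_Delta.
Qed.

Lemma corr_Delta0 k (t : int) (tau : k.-tuple int) (y : n.-tuple R) (X : k.-tuple R) N
    (sigma : N.-tuple int) (z : N.-tuple R) :
  Dn y -> Delta y = 0 ->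
  corr (cat_tuple sigma (cat_tuple (nseq_tuple n t) tau)) (cat_tuple z (cat_tuple y X)) = 0.
Proof.
move=> Dy /(Delta_eq0 Dy)[i [j [ij e]]].
apply: (@corr_eq_points R n q _ _ _ (rshift N (lshift k i)) (rshift N (lshift k j))).
- by rewrite (inj_eq (@rshift_inj _ _)) (inj_eq (@lshift_inj _ _)).
- by rewrite !tnth_rshift !tnth_lshift !tnth_nseq_tuple.
- by rewrite !tnth_rshift !tnth_lshift.
Qed.

Lemma corr_blocks_step s m (z y : n.-tuple R) (X : (m * n).-tuple R) : Dn y -> Dn z ->
  corr (bt s m.+2) (cat_tuple z (cat_tuple y X)) =
  D * (Delta z / Delta y * interlace_weight q y z)%:C * corr (bt s m.+1) (cat_tuple y X).
Proof.
(* If [Delta y = 0], the left side vanishes because two points coincide, the right side by the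
   convention that the inverse of 0 is 0. *)
move=> Dy Dz; have [d0|d0] := eqVneq (Delta y) 0.
  rewrite d0 invr0 mulr0 mul0r mulr0 mul0r.
  exact: (@corr_Delta0 (m * n) (s + m%:Z) (bt s m) y X n (nseq_tuple n (s + m.+1%:Z)) z Dy d0).
rewrite -(@corr_step R n q n_ge1 q_gt0 (m * n)%N (s + m%:Z) (bt s m)) //; last first.
  by move=> i; apply/ltW; exact: block_times_lt.
by rewrite /= (_ : s + m.+1%:Z = s + m%:Z + 1) //; lia.
Qed.

(** The power of [D] is kept apart because its sign is not known yet. *)
Lemma corr_blocks_ge0 s m (X : (m * n).-tuple R) : blocks_Dn X ->
  exists2 c : R[i], 0 <= c & corr (bt s m) X = D ^+ m.-1 * c.
Proof.
elim: m X => [|[|m] IH] X.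
- move=> _; exists 1; first exact: ler01.
  rewrite expr0 mulr1 /corr; exact: det_mx00.
- move=> [Dz _]; exists ((2 * pi)^-n * Delta (@head_block n R (0 * n) X) ^+ 2)%:C.
    rewrite lecE /= eqxx /= mulr_ge0 ?sqr_ge0 // invr_ge0 exprn_ge0 // mulr_ge0 ?pi_ge0 //.
  by rewrite corr_block1 // mul1r.
- move=> [Dz DY]; have [c c0 e] := IH _ DY; case: (DY) => Dy _.
  set z := head_block X in Dz *; set Y := tail_block X in DY e Dy *.
  rewrite -(@cat_blocks n R (m.+1 * n) X) -/z -/Y.
  set y := head_block Y in Dy *; set W := @tail_block n R (m * n) Y.
  exists ((Delta z / Delta y * interlace_weight q y z)%:C * c).
    rewrite mulr_ge0 // lecE /= eqxx /= mulr_ge0 ?interlace_weight_ge0 // divr_ge0 //; exact: Delta_ge0.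
  have eY : cat_tuple y W = Y by exact: cat_blocks.
  by rewrite -eY corr_blocks_step // eY e /= exprS; move: (D) => d; ring.
Qed.

(** [corr] is invariant under simultaneous permutations of times and positions, so sorting a window
    loses nothing; points off the circle give 0. *)
Lemma corr_bt_ge0 (z : R[i]) s m : (forall X, blocks_Dn X -> 0 <= z * corr (bt s m) X) ->
  forall X, 0 <= z * corr (bt s m) X.
Proof.
move=> h X; have [hX|] := boolP [forall i, incirc (tnth X i)]; last first.
  by rewrite negb_forall => /existsP[i hi]; rewrite (corr_out _ _ _ hi) mulr0.
have [sg hs] := key_sorted_exists (bt s m) X.
have e := key_sorted_tau (@block_times_decr n s m) hs.
rewrite -(corr_perm _ _ _ _ sg) e; apply: h; apply/(blocks_DnP s); split.
  by move=> i; rewrite tnth_mktuple; move/forallP : hX; exact.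
apply/forallP => i; apply/forallP => j; apply/implyP => ij.
move/forallP : hs => /(_ i) /forallP/(_ j) /implyP/(_ ij).
have et k : tnth (bt s m) (sg k) = tnth (bt s m) k by rewrite -[in RHS]e tnth_mktuple.
by rewrite !perm1 /key_le !et !tnth_mktuple.
Qed.

(* Stated for the underlying list of times so that it can be transported along permutations and
   tails; z is used with the values -1, 1 and the inverse of the constant in corr_blocks_step. *)
Definition corr_pos (z : R[i]) (l : seq int) :=
  forall p (tau : p.-tuple int) X, tau = l :> seq int -> 0 <= z * corr tau X.

Lemma corr_pos_perm z l l' : perm_eq l l' -> corr_pos z l -> corr_pos z l'.
Proof.
move=> pl h p tau X e; move: pl; rewrite -e => /tuple_permP[s es].
by rewrite -(corr_perm _ _ _ _ s); apply: h; rewrite es.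
Qed.

Lemma corr_pos_drop z r l : (forall t, (count_mem t (r ++ l) <= n)%N) ->
  corr_pos z (r ++ l) -> corr_pos z l.
Proof.
elim: r => //= t r IH c h; apply: IH => [u|]; first by apply: leq_trans (c u); exact: leq_addl.
move=> p tau X e; apply: (@corr_ge0_tail _ _ t) => [Y|]; first by apply: h; rewrite /= e.
by rewrite e; have := c t; rewrite eqxx.
Qed.

Lemma corr_pos_sub z l l' : (forall t, (count_mem t l <= count_mem t l' <= n)%N) ->
  corr_pos z l' -> corr_pos z l.
Proof.
move=> c; have /count_subseqP[l1 /perm_to_subseq[r pr] pl] : forall t, (count_mem t l <= count_mem t l')%N.
  by move=> t; case/andP: (c t).
move=> h; have p : perm_eq l' (r ++ l).
  by apply: (perm_trans pr); rewrite perm_catC perm_cat2l perm_sym.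
apply: (@corr_pos_drop _ r); last exact: corr_pos_perm p h.
by move=> t; rewrite -(seq.permP p); case/andP: (c t).
Qed.

Lemma corr_nil (tau : 0.-tuple int) (X : 0.-tuple R) : corr tau X = 1.
Proof. exact: det_mx00. Qed.

(** Two-time determinants are [D * c] with [c >= 0]. If [z * (D * c) >= 0] for all such c, then
    integrating out every point leaves z times the empty determinant, so [z >= 0]. With z = -1 this
    excludes [D = 0]; with z the inverse of [D] it makes the inverse nonnegative. *)
Lemma D_gt0 : 0 < D.
Proof.
have pos z : (forall c : R[i], 0 <= c -> 0 <= z * (D * c)) -> 0 <= z.
  move=> h; have : corr_pos z [::].
    apply: (@corr_pos_sub z [::] (bt 0 2)).
      move=> t /=; rewrite count_cat !count_cat !count_nseq /=.
      by case: eqP => [<-|_]; case: eqP => [?|_] //; rewrite ?mul1n ?mul0n ?addn0 ?add0n //; exfalso; lia.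
    move=> p tau X e; have ep : p = (2 * n)%N by rewrite -(size_tuple tau) e size_tuple.
    subst p; rewrite (_ : tau = bt 0 2); last exact/val_inj.
    apply: corr_bt_ge0 => Y /(corr_blocks_ge0 0)[c c0 ->]; exact: h.
  by move=> /(_ 0%N [tuple] [tuple] erefl); rewrite corr_nil mulr1.
have D0 : D != 0.
  apply/eqP => e; suff : 0 <= (-1 : R[i]) by rewrite oppr_ge0 ler10.
  by apply: pos => c c0; rewrite e mul0r mulr0.
rewrite lt_neqAle eq_sym D0 /= -invr_ge0; apply: pos => c c0.
by rewrite mulrA mulVf // mul1r.
Qed.

Lemma corr_ge0 p (tau : p.-tuple int) X : 0 <= corr tau X.
Proof.
have [hc|] := boolP (all (fun t => (count_mem t tau <= n)%N) tau); last first.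
  by move=> /allPn[t _]; rewrite -ltnNge => h; rewrite (corr_many q X h).
(* Multiplicities at most n embed the times into a window with n points at each time, from which the
   surplus points are integrated out. *)
have [s [m w]] := int_window tau.
suff : corr_pos 1 tau by move=> /(_ _ tau X erefl); rewrite mul1r.
apply: (@corr_pos_sub _ _ (bt s m)) => [t|].
  have [tt|tt] := boolP (t \in (tau : seq int)).
    by rewrite (count_block_times n (w t tt)) leqnn andbT; move/allP : hc; exact.
  rewrite (count_memPn tt) leq0n /=.
  have [h|h] := boolP (s <= t < s + m%:Z); first by rewrite count_block_times.
  rewrite (_ : count_mem _ _ = 0%N) //; apply/count_memPn/negP => /tnthP[i e]; move: h.
  by rewrite e block_times_ge block_times_lt.
move=> p' tau' Y e; have ep : p' = (m * n)%N by rewrite -(size_tuple tau') e size_tuple.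
subst p'; rewrite (_ : tau' = bt s m); last exact/val_inj.
apply: corr_bt_ge0 => {}Y /(corr_blocks_ge0 s)[c c0 ->].
by rewrite mul1r mulr_ge0 // exprn_ge0 // ltW // D_gt0.
Qed.

End positivity.

(** * Integrating out points *)

Section rho.
Context (R : realType) (n : nat) (q : R).
Hypothesis n_ge1 : (1 <= n)%N.
Hypothesis q_gt0 : 0 < q.
Local Notation corr := (corr n q).
Local Notation mu := (@lebesgue_measure R).
Local Notation L := (lebesgue_tuple R).

Definition rho p (tau : p.-tuple int) (X : p.-tuple R) : R := complex.Re (corr tau X).

Lemma rhoRe p (tau : p.-tuple int) X : rho tau X = complex.Re (corr tau X).
Proof. by []. Qed.

(* Keeps unification from unfolding the determinant. *)
#[global] Opaque rho.

Lemma rhoE p (tau : p.-tuple int) X : corr tau X = (rho tau X)%:C.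
Proof. by rewrite rhoRe; apply: complex_ext => //=; have := corr_ge0 n_ge1 q_gt0 tau X; rewrite lecE /= => /andP[/eqP ->]. Qed.

Lemma rho_ge0 p (tau : p.-tuple int) X : 0 <= rho tau X.
Proof. by have := corr_ge0 n_ge1 q_gt0 tau X; rewrite lecE rhoRe => /andP[]. Qed.

Lemma rho_perm p (tau : p.-tuple int) X (s : {perm 'I_p}) :
  rho (reindex_tuple tau s) (reindex_tuple X s) = rho tau X.
Proof. by rewrite !rhoRe corr_perm. Qed.

Lemma rho_out p (tau : p.-tuple int) (X : p.-tuple R) i : ~~ incirc (tnth X i) -> rho tau X = 0.
Proof. by move=> h; rewrite rhoRe (corr_out _ _ _ h). Qed.

Lemma measurable_rho p (tau : p.-tuple int) d (T : measurableType d) (X : T -> p.-tuple R) :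
  measurable_fun setT X -> measurable_fun setT (fun x => rho tau (X x)).
Proof. by move=> mX; have [] := corr_cmfun n_ge1 q_gt0 tau mX; under eq_fun do rewrite -rhoRe. Qed.

Lemma measurable_Erho p (tau : p.-tuple int) d (T : measurableType d) (X : T -> p.-tuple R) :
  measurable_fun setT X -> measurable_fun setT (fun x => (rho tau (X x))%:E).
Proof. by move=> mX; apply/measurable_EFinP; exact: measurable_rho. Qed.

Lemma integral_rho_cons p (t : int) (tau : p.-tuple int) (Y : p.-tuple R) :
  (\int[mu]_c (rho [tuple of t :: tau] [tuple of c :: Y])%:E =
   ((n - count_mem t tau)%N%:R * rho tau Y)%:E)%E.
Proof.
have -> : (\int[mu]_c (rho [tuple of t :: tau] [tuple of c :: Y])%:E =
    \int[mu]_(c in @circ R) (rho [tuple of t :: tau] [tuple of c :: Y])%:E)%E.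
  rewrite [RHS]integral_mkcond; apply: eq_integral => c _; rewrite patchE.
  case: ifPn => // /negP hc; rewrite (@rho_out _ _ _ ord0) // tnth0; apply/negP => h; apply: hc.
  by apply/mem_set; rewrite /circ /= in_itv.
have [i1 _] := corr_cons_integrable n_ge1 q_gt0 t tau Y.
have e : (fun c => complex.Re (corr [tuple of t :: tau] [tuple of c :: Y])) =
   (fun c => rho [tuple of t :: tau] [tuple of c :: Y]) by apply/funext => c; rewrite rhoRe.
rewrite e in i1.
rewrite -(fineK (integrable_fin_num _ i1)); last exact: measurable_circ.
have := integral_corr_cons n_ge1 q_gt0 t tau Y.
rewrite rhoE /integralC e -[(n%:R - _)]/(_ : R[i]).
have [le|lt] := leqP (count_mem t tau) n.
  rewrite -natrB // -(rmorph_nat (@real_complex R)) -rmorphM /= => -[e' _].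
  by rewrite -e'.
(* Beyond n points the natural-number subtraction truncates to 0, and the integrand vanishes too. *)
move=> _; rewrite (eqP (ltnW lt)) mul0r integral0_eq // => c _.
rewrite /= rhoRe (@corr_many _ _ _ _ _ _ t) //.
by rewrite /= eqxx add1n ltnW.
Qed.

Lemma measurable_tail k p d (T : measurableType d) (X : T -> (k + p).-tuple R) :
  measurable_fun setT X -> measurable_fun setT (fun x => tail_block (X x)).
Proof. exact: measurable_reindex. Qed.

(* The constant does not depend on h; it is only identified in integral_rho_labels, by taking h = 1. *)
Lemma integral_rho_cat k p (A : k.-tuple int) (tau : p.-tuple int) :
  exists2 C : R, 0 <= C & forall h : p.-tuple R -> \bar R, measurable_fun setT h ->
    (forall Y, 0 <= h Y)%E ->
  (\int[L (k + p)%N]_X (h (tail_block X) * (rho (cat_tuple A tau) X)%:E) =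
   C%:E * \int[L p]_Y (h Y * (rho tau Y)%:E))%E.
Proof.
elim: k A => [|k IH] A.
  exists 1 => [|h mh h0]; first exact: ler01.
  rewrite mul1e (tuple0 A); apply: eq_integral => X _.
  rewrite (_ : tail_block X = X); last first.
    by apply: eq_from_tnth => i; rewrite tnth_mktuple; congr tnth; exact/val_inj.
  have e : (cat_tuple [tuple] tau : p.-tuple int) = tau by exact/val_inj.
  by have -> : rho (cat_tuple [tuple] tau) X = rho tau X by exact: (f_equal (fun t : p.-tuple int => rho t X) e).
case/tupleP: A => t A; have [C C0 HC] := IH A.
exists ((n - count_mem t (cat_tuple A tau))%N%:R * C) => [|h mh h0].
  by rewrite mulr_ge0.
rewrite (@integral_tuple_cons2 R (k + p)); last 2 first.
- apply: emeasurable_funM; first by apply: (measurableT_comp mh); apply: measurable_tail; exact: measurable_id.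
  by apply: measurable_Erho; exact: measurable_id.
- by move=> X; rewrite mule_ge0 // lee_fin rho_ge0.
rewrite EFinM -muleA -HC // -ge0_integralZl //; last 2 first.
- apply: emeasurable_funM; first by apply: (measurableT_comp mh); apply: measurable_tail; exact: measurable_id.
  by apply: measurable_Erho; exact: measurable_id.
- by move=> X _; rewrite mule_ge0 // lee_fin rho_ge0.
apply: eq_integral => Y _.
rewrite muleCA -EFinM -(integral_rho_cons t (cat_tuple A tau) Y) -ge0_integralZl; last 4 first.
- exact: measurableT.
- apply: measurable_Erho.
  exact: (@measurable_cons _ _ _ (measurableTypeR R) id (k + p) (fun=> Y)).
- by move=> c _; rewrite lee_fin rho_ge0.
- exact: h0.
have e1 : (cat_tuple [tuple of t :: A] tau : (k + p).+1.-tuple int) = [tuple of t :: cat_tuple A tau].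
  exact/val_inj.
apply: eq_integral => c _.
have -> : @tail_block k.+1 R p [tuple of c :: Y] = tail_block Y.
  apply: eq_from_tnth => i; rewrite !tnth_mktuple -[RHS](tnthS c Y); congr tnth; exact/val_inj.
congr (_ * _%:E)%E.
exact: (f_equal (fun u : (k + p).+1.-tuple int => rho u [tuple of c :: Y]) e1).
Qed.

(** Puts the chosen labels last and the remaining ones first, so that [integral_rho_cat] applies
    after a permutation of the coordinates. *)
Lemma perm_extend k p (j : p.-tuple 'I_(k + p)) : uniq j ->
  exists s : {perm 'I_(k + p)}, forall u, s (rshift k u) = tnth j u.
Proof.
move=> uj; pose r := [seq i <- enum 'I_(k + p) | i \notin j].
have pr : perm_eq (r ++ j) (ord_tuple (k + p)).
  apply: uniq_perm; rewrite ?enum_uniq //.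
    rewrite cat_uniq uj filter_uniq ?enum_uniq //= andbT.
    by apply/hasPn => i ij; rewrite mem_filter ij.
  by move=> i; rewrite mem_cat mem_filter mem_enum andbT /= orNb.
have sr : size r = k.
  by have := perm_size pr; rewrite size_cat !size_tuple => /addIn.
have /tuple_permP[s e] := pr; exists s => u.
have := congr1 (fun l => nth (tnth j u) l (k + u)) e.
rewrite nth_cat sr (ltnNge (k + u)) leq_addr [X in X = _ -> _]/= addKn -tnth_nth => ->.
have hu : (k + u < k + p)%N by rewrite ltn_add2l.
have -> : rshift k u = Ordinal hu by exact/val_inj.
by rewrite -[RHS](tnth_nth _ _ (Ordinal hu)) tnth_mktuple tnth_ord_tuple.
Qed.

Lemma integral_rho_label N (tau : N.-tuple int) p (j : p.-tuple 'I_N) : uniq j ->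
  exists2 C : R, 0 <= C & forall h : p.-tuple R -> \bar R, measurable_fun setT h ->
    (forall Y, 0 <= h Y)%E ->
  (\int[L N]_X (h (reindex_tuple X (tnth j)) * (rho tau X)%:E) =
   C%:E * \int[L p]_Y (h Y * (rho (reindex_tuple tau (tnth j)) Y)%:E))%E.
Proof.
move=> uj; have pN : (p <= N)%N.
  by rewrite -(size_tuple j) -(card_uniqP uj) -[leqRHS]card_ord max_card.
have [k eN] : exists k, N = (k + p)%N by exists (N - p)%N; rewrite subnK.
subst N; have [s hs] := perm_extend uj.
have [C C0 HC] := integral_rho_cat (head_block (reindex_tuple tau s)) (tail_block (reindex_tuple tau s)).
have et T (X : (k + p).-tuple T) : tail_block (reindex_tuple X s) = reindex_tuple X (tnth j).
  by apply: eq_from_tnth => u; rewrite !tnth_mktuple hs.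
rewrite cat_blocks et in HC.
exists C; [exact: C0|move=> h mh h0; apply: etrans (HC h mh h0)].
pose F (X : (k + p).-tuple R) := (h (tail_block X) * (rho (reindex_tuple tau s) X)%:E)%E.
have mF : measurable_fun setT F.
  apply: emeasurable_funM; first by apply: (measurableT_comp mh); apply: measurable_tail; exact: measurable_id.
  by apply: measurable_Erho; exact: measurable_id.
have F0 X : (0 <= F X)%E by rewrite mule_ge0 // lee_fin rho_ge0.
apply: etrans (integral_tuple_perm s mF F0).
by apply: eq_integral => X _; rewrite /F et rho_perm.
Qed.

Section labels.
Context (N : nat) (tau : N.-tuple int).

(** The distinct coordinates of a window that can carry a p-tuple of points with times [r]. *)
Definition is_label p (r : p.-tuple int) (j : p.-tuple 'I_N) : bool :=
  uniq j && (reindex_tuple tau (tnth j) == r).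

Definition nlabels p (r : p.-tuple int) : nat := \sum_(j : p.-tuple 'I_N | is_label r j) 1.

Lemma map_reindex p (j : p.-tuple 'I_N) : reindex_tuple tau (tnth j) = [seq tnth tau i | i <- j] :> seq int.
Proof. by rewrite -[in RHS](map_tnth_enum j) -map_comp. Qed.

Lemma count_label p (r : p.-tuple int) j t : is_label r j ->
  (\sum_(i < N | (tnth tau i == t) && (i \notin j)) 1 = count_mem t tau - count_mem t r)%N.
Proof.
move=> /andP[uj /eqP er]; rewrite sum1_card count_tuple.
have -> : count_mem t r = #|[pred i | (tnth tau i == t) && (i \in j)]|.
  rewrite -er map_reindex count_map -size_filter -(card_uniqP (filter_uniq _ uj)).
  by apply: eq_card => i; rewrite mem_filter !inE.
have := cardID (mem j) [pred i | tnth tau i == t].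
set a := #|_|; set b := #|_|; set c := #|_| => e.
have -> : (\sum_(i < N) (tnth tau i == t) = c)%N.
  by rewrite /c -sum1_card [RHS]big_mkcond; apply: eq_bigr => i _; rewrite inE; case: eqP.
by rewrite -e addKn; apply: eq_card => i; rewrite !inE andbC.
Qed.

(** The same recursion as for integrals of [rho] in [integral_rho_cons] when [t] has multiplicity n;
    this is how [integral_rho] identifies the two. *)
Lemma nlabels_cons p t (r : p.-tuple int) :
  nlabels [tuple of t :: r] = ((count_mem t tau - count_mem t r) * nlabels r)%N.
Proof.
rewrite /nlabels (reindex (fun x : p.-tuple 'I_N * 'I_N => [tuple of x.2 :: x.1])) /=; last first.
  exists (fun j : p.+1.-tuple 'I_N => ([tuple of behead j], thead j)).
    by move=> [j i] _; rewrite /= theadE; congr pair; exact/val_inj.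
  by move=> j _; rewrite /= [RHS]tuple_eta.
rewrite (eq_bigl (fun x : p.-tuple 'I_N * 'I_N => is_label r x.1 && ((tnth tau x.2 == t) && (x.2 \notin x.1)))).
  rewrite -(pair_big_dep (fun j => is_label r j) (fun j i => (tnth tau i == t) && (i \notin j)) (fun _ _ => 1%N)) /=.
  by rewrite big_distrr /=; apply: eq_bigr => j lj; rewrite (count_label t lj) muln1.
move=> [j i] /=; rewrite /is_label /=; case: (i \in j) => /=; first by rewrite !andbF.
rewrite andbT -andbA; congr (_ && _); rewrite andbC.
rewrite -!(inj_eq val_inj).
have -> : val (reindex_tuple tau (tnth [tuple of i :: j])) = tnth tau i :: val (reindex_tuple tau (tnth j)).
  apply: (etrans (map_reindex [tuple of i :: j])); congr cons; exact/esym/map_reindex.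
exact: eqseq_cons.
Qed.

End labels.

Lemma measurable_rho_id p (tau : p.-tuple int) : measurable_fun setT (fun X : p.-tuple R => (rho tau X)%:E).
Proof. by apply: measurable_Erho; exact: measurable_id. Qed.

Lemma integral_rho N (tau : N.-tuple int) p (r : p.-tuple int) :
  (forall t, t \in (r : seq int) -> count_mem t tau = n) ->
  (\int[L p]_X (rho r X)%:E = (nlabels tau r)%:R%:E)%E.
Proof.
elim: p r => [|p IH] r.
  move=> _; rewrite integral_tuple0 => [|X]; last by rewrite lee_fin rho_ge0.
  rewrite rhoRe corr_nil /nlabels (eq_bigl xpredT) ?sum1_card ?card_tuple ?expn0 //.
  move=> j; apply/andP; split; first by rewrite (tuple0 j).
  by apply/eqP; exact: etrans (tuple0 _) (esym (tuple0 r)).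
case/tupleP: r => t r h; rewrite nlabels_cons natrM EFinM -IH; last by move=> u ur; apply: h; rewrite inE ur orbT.
rewrite (h t) ?inE ?eqxx //.
rewrite integral_tuple_cons2; [|exact: measurable_rho_id|by move=> X; rewrite lee_fin rho_ge0].
rewrite -ge0_integralZl //.
- by apply: eq_integral => Y _; rewrite -EFinM integral_rho_cons.
- exact: measurable_rho_id.
- by move=> X _; rewrite lee_fin rho_ge0.
Qed.

Lemma nlabels_eq0 N (tau : N.-tuple int) p (r : p.-tuple int) :
  (forall t, t \in (r : seq int) -> count_mem t tau = n) -> nlabels tau r = 0%N ->
  exists t, (n < count_mem t r)%N.
Proof.
elim: p r => [|p IH] r.
  move=> _; rewrite /nlabels (eq_bigl xpredT) ?sum1_card ?card_tuple ?expn0 //.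
  move=> j; apply/andP; split; first by rewrite (tuple0 j).
  by apply/eqP; exact: etrans (tuple0 _) (esym (tuple0 r)).
case/tupleP: r => t r h; rewrite nlabels_cons (h t) ?inE ?eqxx // => /eqP; rewrite muln_eq0.
move=> /orP[|/eqP/IH[u|u hu]].
- by rewrite subn_eq0 => nt; exists t; rewrite /= eqxx add1n ltnS.
- by move=> ur; apply: h; rewrite inE ur orbT.
- by exists u; apply: (leq_trans hu); exact: leq_addl.
Qed.

(** The constants of the single labels are independent of [h]. For h = 1 both sides are counts of
    labels by [integral_rho], and dividing by [nlabels tau r] yields the sum of the constants. *)
Lemma integral_rho_labels N (tau : N.-tuple int) p (r : p.-tuple int) (h : p.-tuple R -> \bar R) :
  (forall t, t \in (tau : seq int) -> count_mem t tau = n) ->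
  (forall t, t \in (r : seq int) -> count_mem t tau = n) ->
  measurable_fun setT h -> (forall Y, 0 <= h Y)%E ->
  (\int[L N]_X ((\sum_(j : p.-tuple 'I_N | is_label tau r j) h (reindex_tuple X (tnth j))) * (rho tau X)%:E) =
   (nlabels tau tau)%:R%:E * \int[L p]_Y (h Y * (rho r Y)%:E))%E.
Proof.
move=> htau hr mh h0.
have mj (g : p.-tuple R -> \bar R) : measurable_fun setT g -> forall j : p.-tuple 'I_N,
    measurable_fun setT (fun X : N.-tuple R => g (reindex_tuple X (tnth j)) * (rho tau X)%:E)%E.
  move=> mg j; apply: emeasurable_funM; last exact: measurable_rho_id.
  by apply: (measurableT_comp mg); apply: measurable_reindex; exact: measurable_id.
pose C (j : p.-tuple 'I_N) := if pselect (uniq j) is left uj then s2val (cid2 (integral_rho_label tau uj)) else 0.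
have S (g : p.-tuple R -> \bar R) : measurable_fun setT g -> (forall Y, 0 <= g Y)%E ->
  (\int[L N]_X ((\sum_(j : p.-tuple 'I_N | is_label tau r j) g (reindex_tuple X (tnth j))) * (rho tau X)%:E) =
   (\sum_(j : p.-tuple 'I_N | is_label tau r j) C j)%:E * \int[L p]_Y (g Y * (rho r Y)%:E))%E.
  move=> mg g0.
  under eq_integral do rewrite ge0_sume_distrl // -big_filter.
  rewrite ge0_integral_sum // ?big_filter.
  - rewrite -sumEFin ge0_sume_distrl.
    apply: eq_bigr => j /andP[uj /eqP er]; rewrite /C; case: pselect => // {}uj.
    by case: cid2 => c c0 /= hc; rewrite (hc g mg g0) er.
  - move=> j /andP[uj _]; rewrite lee_fin /C; case: pselect => // {}uj.
    by case: cid2.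
  - by move=> j; exact: mj.
  - by move=> j X _; rewrite mule_ge0 // lee_fin rho_ge0.
rewrite S //; have := S (cst 1%E) (@measurable_cst _ _ _ _ _ _) (fun=> @lee01 R).
have -> : (\int[L p]_Y (cst 1%E Y * (rho r Y)%:E) = (nlabels tau r)%:R%:E)%E.
  by rewrite -(integral_rho hr); apply: eq_integral => X _; rewrite mul1e.
have -> : (\int[L N]_X ((\sum_(j : p.-tuple 'I_N | is_label tau r j) cst 1%E (reindex_tuple X (tnth j))) * (rho tau X)%:E)
   = (nlabels tau r)%:R%:E * (nlabels tau tau)%:R%:E)%E.
  rewrite -(integral_rho htau) -ge0_integralZl //.
  - apply: eq_integral => X _; congr (_ * _)%E.
    by rewrite sumEFin; congr _%:E; rewrite /nlabels natr_sum.
  - exact: measurable_rho_id.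
  - by move=> X _; rewrite lee_fin rho_ge0.
set c := \sum_(j | _) C j; rewrite -!EFinM => -[e].
have [z|nz] := eqVneq (nlabels tau r) 0%N; last first.
  congr (_%:E * _)%E; apply: (@mulIf _ ((nlabels tau r)%:R : R)); first by rewrite pnatr_eq0.
  by rewrite -e mulrC.
(* Division is impossible when there is no label, but then some time occurs more than n times in [r]
   and [rho r] is identically 0. *)
have [t ht] := nlabels_eq0 hr z.
rewrite (_ : (fun Y => _) = cst 0%E) ?integral0 ?mule0 //.
by apply/funext => Y; rewrite rhoRe (@corr_many _ _ _ _ _ _ t ht) mule0.
Qed.

End rho.

(** * The joint law of consecutive configurations *)

Section change_of_law.
Context (R : realType) d (T : measurableType d).
Local Open Scope ereal_scope.
Import HBNNSimple.

(** The simple functions live on the target [T], so two weighted laws with the same masses on events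
    give the same approximating sums term by term. *)
Lemma integral_law_approx d1 (X : measurableType d1) (m : {measure set X -> \bar R})
    (Z : X -> T) (w : X -> R) (F : T -> \bar R) (mF : measurable_fun setT F) :
  measurable_fun setT Z -> measurable_fun setT w -> (forall x, (0 <= w x)%R) -> (forall t, 0 <= F t) ->
  \int[m]_x (F (Z x) * (w x)%:E) =
  limn (fun n => \sum_(r \in range (nnsfun_approx measurableT mF n))
    r%:E * \int[m]_x ((\1_(nnsfun_approx measurableT mF n @^-1` [set r]) (Z x))%:E * (w x)%:E)).
Proof.
move=> mZ mw w0 F0; set f_ := nnsfun_approx measurableT mF.
have mZr n r : measurable (Z @^-1` (f_ n @^-1` [set r])).
  by rewrite -[X in measurable X]setTI; apply: mZ.
have mI n r : measurable_fun setT (fun x => (\1_(f_ n @^-1` [set r]) (Z x))%:E * (w x)%:E).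
  apply: emeasurable_funM; last exact/measurable_EFinP.
  apply/measurable_EFinP.
  rewrite (_ : (fun x => _) = \1_(Z @^-1` (f_ n @^-1` [set r]))); first exact: measurable_indic.
  by apply/funext => x; rewrite !indicE.
have I0 n r x : 0 <= (\1_(f_ n @^-1` [set r]) (Z x))%:E * (w x)%:E.
  by rewrite mule_ge0 // lee_fin.
transitivity (\int[m]_x limn (fun n => (f_ n (Z x))%:E * (w x)%:E)).
  apply: eq_integral => x _; apply/esym/cvg_lim => //.
  by apply: cvgeZr => //; apply: cvg_nnsfun_approx => // y _; exact: F0.
rewrite monotone_convergence //; last 3 first.
- move=> n; apply: emeasurable_funM; last exact/measurable_EFinP.
  by apply/measurable_EFinP; apply: measurableT_comp.
- by move=> n x _; rewrite mule_ge0 // lee_fin.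
- move=> x _ a b ab; rewrite lee_wpmul2r ?lee_fin //; exact/lefP/nd_nnsfun_approx.
congr (limn _); apply/funext => n.
have E x : (f_ n (Z x))%:E * (w x)%:E =
    \sum_(r \in range (f_ n)) (r%:E * ((\1_(f_ n @^-1` [set r]) (Z x))%:E * (w x)%:E)).
  rewrite {1}fimfunE -fsumEFin // ge0_mule_fsuml.
    by apply: eq_fsbigr => r _; rewrite EFinM muleA.
  by move=> r; rewrite nnfun_muleindic_ge0.
under eq_integral do rewrite E.
have nn r x : r \in range (f_ n) -> 0 <= r%:E * ((\1_(f_ n @^-1` [set r]) (Z x))%:E * (w x)%:E).
  by move=> /set_mem[t _ <-]; rewrite mule_ge0 // lee_fin.
have nn' r x : 0 <= r%:E * ((\1_(f_ n @^-1` [set r]) (Z x))%:E * (w x)%:E).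
  by rewrite [X in 0 <= X]muleA; apply: mule_ge0; [exact: nnfun_muleindic_ge0|rewrite lee_fin].
rewrite ge0_integral_fsum //; last first.
  by move=> r; apply: emeasurable_funM => //; exact: measurable_cst.
apply: eq_fsbigr => r /set_mem [t _ <-].
by rewrite -ge0_integralZl // lee_fin.
Qed.

Lemma eq_law d1 (X1 : measurableType d1) (m1 : {measure set X1 -> \bar R}) (Z1 : X1 -> T) (w1 : X1 -> R)
    d2 (X2 : measurableType d2) (m2 : {measure set X2 -> \bar R}) (Z2 : X2 -> T) (w2 : X2 -> R)
    (F : T -> \bar R) :
  measurable_fun setT Z1 -> measurable_fun setT w1 -> (forall x, (0 <= w1 x)%R) ->
  measurable_fun setT Z2 -> measurable_fun setT w2 -> (forall x, (0 <= w2 x)%R) ->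
  (forall A, measurable A -> \int[m1]_x ((\1_A (Z1 x))%:E * (w1 x)%:E) = \int[m2]_x ((\1_A (Z2 x))%:E * (w2 x)%:E)) ->
  measurable_fun setT F -> (forall t, 0 <= F t) ->
  \int[m1]_x (F (Z1 x) * (w1 x)%:E) = \int[m2]_x (F (Z2 x) * (w2 x)%:E).
Proof.
move=> mZ1 mw1 w10 mZ2 mw2 w20 h mF F0.
rewrite (integral_law_approx m1 mF mZ1 mw1 w10 F0) (integral_law_approx m2 mF mZ2 mw2 w20 F0).
congr (limn _); apply/funext => n; apply: eq_fsbigr => r _; congr (_ * _).
by apply: h.
Qed.

Lemma density_measure (m : {measure set T -> \bar R}) (f : T -> \bar R) :
  measurable_fun setT f -> (forall x, 0 <= f x) ->
  exists m' : {measure set T -> \bar R}, forall A, m' A = \int[m]_(x in A) f x.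
Proof.
move=> mf f0.
have h0 : \int[m]_(x in set0) f x = 0 by rewrite integral_set0.
have hge0 A : 0 <= \int[m]_(x in A) f x by exact: integral_ge0.
pose mix := isMeasure.Build d T R (fun A => \int[m]_(x in A) f x) h0 hge0
  (semi_sigma_additive_nng_induced mf f0).
pose m' : {measure set T -> \bar R} := HB.pack (integral m ^~ f) mix.
by exists m'.
Qed.

Lemma law_measure d1 (X : measurableType d1)
    (mX : {measure set X -> \bar R}) (Z : X -> T) : measurable_fun setT Z ->
  exists m' : {measure set T -> \bar R}, forall A, m' A = mX (Z @^-1` A).
Proof. by move=> mZ; unshelve eexists (@pushforward _ _ _ _ _ mX Z); first exact: mZ. Qed.

End change_of_law.

(** * Measurability of the transition density *)

Section chain_measurability.
Context (R : realType) (n : nat) (q : R).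
Hypothesis q_gt0 : 0 < q.

Lemma measurable_Dn : measurable (@Dn R n).
Proof.
rewrite (_ : @Dn R n = (\bigcap_(i in [set: 'I_n]) \bigcap_(j in [set j : 'I_n | (i < j)%N])
    [set z : n.-tuple R | tnth z i <= tnth z j]) `&`
    (\bigcap_(i in [set: 'I_n]) [set z : n.-tuple R | incirc (tnth z i)])); last first.
  apply/seteqP; split=> z.
    by move=> [/sorted_tuple sz bz]; split=> [i _ j /= ij|i _]; [exact: sz|exact: bz].
  move=> [sz bz]; split=> [|i]; last exact: (bz i I).
  by apply/sorted_tuple => i j ij; exact: (sz i I j ij).
have mt i : measurable_fun setT (fun z : n.-tuple R => tnth z i).
  exact: (@measurable_tnth _ (measurableTypeR R)).
apply: measurableI; apply: fin_bigcap_measurable => // i _.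
  apply: fin_bigcap_measurable => // j _.
  have := measurable_fun_ler (mt i) (mt j) => /(_ measurableT [set true] I).
  by rewrite setTI; congr measurable; apply/seteqP; split.
have := measurable_incirc (mt i) => /(_ measurableT [set true] I).
by rewrite setTI; congr measurable; apply/seteqP; split.
Qed.

Lemma measurable_blocks_Dn m : measurable (@blocks_Dn R n m).
Proof.
elim: m => [|m IH]; first exact: measurableT.
rewrite (_ : @blocks_Dn R n m.+1 = ((@head_block n R (m * n)) @^-1` (@Dn R n)) `&`
   ((@tail_block n R (m * n)) @^-1` (@blocks_Dn R n m))) //.
apply: measurableI; rewrite -[X in measurable X]setTI.
  apply: measurable_reindex; [exact: measurable_id|exact: measurableT|exact: measurable_Dn].
by apply: measurable_reindex; [exact: measurable_id|exact: measurableT|exact: IH].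
Qed.

Section with_dom.
Context d (T : measurableType d) (Y Z : T -> n.-tuple R).
Hypothesis mY : measurable_fun setT Y.
Hypothesis mZ : measurable_fun setT Z.
Let mYi i : measurable_fun setT (fun t => tnth (Y t) i).
Proof. by move/measurable_fun_tnthP : mY => /(_ i). Qed.
Let mZi i : measurable_fun setT (fun t => tnth (Z t) i).
Proof. by move/measurable_fun_tnthP : mZ => /(_ i). Qed.

Lemma measurable_normc (f : T -> R[i]) : cmfun f -> measurable_fun setT (fun t => normc (f t)).
Proof.
move=> [m1 m2].
rewrite (_ : (fun t => _) = (fun t => Num.sqrt (complex.Re (f t) ^+ 2 + complex.Im (f t) ^+ 2))).
  have msq : measurable_fun setT (@Num.sqrt R).
    by apply: continuous_measurable_fun; exact: sqrt_continuous.
  apply: (measurableT_comp msq).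
  by apply: measurable_funD; exact: measurable_funX.
by apply/funext => t; case: (f t).
Qed.

Lemma measurable_prod_big (I : finType) (P : pred I) (F : I -> T -> R) :
  (forall i, measurable_fun setT (F i)) -> measurable_fun setT (fun t => \prod_(i | P i) F i t).
Proof.
move=> mF; elim: (index_enum I) => [|i s IH].
  by under eq_fun do rewrite big_nil; exact: measurable_cst.
under eq_fun do rewrite big_cons; case: (P i) => //.
by apply: measurable_funM.
Qed.

Lemma measurable_Delta : measurable_fun setT (fun t => Delta (Y t)).
Proof.
apply: measurable_prod_big => l; apply: measurable_prod_big => p; apply: measurable_normc.
by apply: cmfunD; [|apply: cmfunN]; exact: cmfun_expi.
Qed.

Lemma measurable_forall (I : finType) (F : I -> T -> bool) :
  (forall i, measurable_fun setT (F i)) -> measurable_fun setT (fun t => [forall i, F i t]).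
Proof.
move=> mF; rewrite (_ : (fun t => _) = (fun t => \big[andb/true]_i F i t)); last first.
  by apply/funext => t; rewrite big_andE.
elim: (index_enum I) => [|i s IH].
  by under eq_fun do rewrite big_nil; exact: measurable_cst.
under eq_fun do rewrite big_cons.
by apply: measurable_and.
Qed.

Lemma measurable_implyb (b : bool) (F : T -> bool) :
  measurable_fun setT F -> measurable_fun setT (fun t => b ==> F t).
Proof. by case: b => //= _; exact: measurable_cst. Qed.

Lemma measurable_interlace : measurable_fun setT (fun t => interlace (Y t) (Z t)).
Proof.
apply: measurable_or; apply: measurable_and; apply: measurable_forall => j.
- exact: measurable_fun_ler.
- by apply: measurable_forall => k; apply: measurable_implyb; exact: measurable_fun_ltr.
- exact: measurable_fun_ltr.
- by apply: measurable_forall => k; apply: measurable_implyb; exact: measurable_fun_ler.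
Qed.

Lemma measurable_interlace_weight : measurable_fun setT (fun t => interlace_weight q (Y t) (Z t)).
Proof.
apply: measurable_fun_ifT; [exact: measurable_interlace| |exact: measurable_cst].
apply: (measurableT_comp (measurable_powRr q)); rewrite /gap.
have ms : measurable_fun setT (fun t => \sum_(j < n) (tnth (Z t) j - tnth (Y t) j)).
  by apply: measurable_sum => j; exact: measurable_funB.
apply: measurable_fun_ifT => //; first exact: measurable_fun_ler.
by apply: measurable_funD.
Qed.

End with_dom.

Lemma normalization_ge0 : 0 <= normalization n q.
Proof.
rewrite mulr_ge0 ?invr_ge0 //; apply: Rintegral_ge0 => r _.
by rewrite mulr_ge0 ?powR_ge0 // exprn_ge0 // normc_ge0.
Qed.

(** The indicator of [Dn] turns the kernel into an integral over the whole space, ready for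
    Fubini. *)
Definition transition (y z : n.-tuple R) : R :=
  (normalization n q)^-1 * (Delta z / Delta y) * interlace_weight q y z * \1_(@Dn R n) z.

Lemma transition_ge0 y z : 0 <= transition y z.
Proof.
by rewrite !mulr_ge0 ?invr_ge0 ?normalization_ge0 ?Delta_ge0 ?interlace_weight_ge0.
Qed.

Lemma measurable_transition d (T : measurableType d) (Y Z : T -> n.-tuple R) :
  measurable_fun setT Y -> measurable_fun setT Z -> measurable_fun setT (fun t => transition (Y t) (Z t)).
Proof.
move=> mY mZ; apply: measurable_funM; last first.
  have mI : measurable_fun setT (\1_(@Dn R n) : n.-tuple R -> R).
    apply: measurable_indic; exact: measurable_Dn.
  exact: (measurableT_comp mI mZ).
apply: measurable_funM; last exact: measurable_interlace_weight.
apply: measurable_funM => //; apply: measurable_funM; first exact: measurable_Delta.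
under eq_fun do rewrite -(powR_inv1 (Delta_ge0 _)).
by apply: (measurableT_comp (measurable_powR (-1))); exact: measurable_Delta.
Qed.

Lemma chain_kernelE y (B : set (n.-tuple R)) : measurable B ->
  chain_kernel q y B = (\int[lebesgue_tuple R n]_z ((\1_B z)%:E * (transition y z)%:E))%E.
Proof.
move=> mB; rewrite /chain_kernel integral_mkcond; apply: eq_integral => z _.
rewrite patchE -EFinM /transition indicE indicE in_setI.
by case: (z \in B); case: (z \in @Dn R n); rewrite /= ?mul1r ?mulr1 ?mul0r ?mulr0.
Qed.

End chain_measurability.

(** * The density of a window of the chain *)

Section law.
Context (R : realType) (n : nat) (q : R).
Hypothesis n_ge1 : (1 <= n)%N.
Hypothesis q_gt0 : 0 < q.
Context d (Omega : measurableType d) (P : probability Omega R) (x : int -> Omega -> n.-tuple R).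
Hypothesis chain : stationary_markov_chain q P x.
Local Notation L := (lebesgue_tuple R).
Local Notation rho := (rho n q).
Local Notation bt := (block_times n).
Local Notation step_const := (complex.Re (\det (cmb q (l0 R n)))).

Fixpoint history (s : int) m (omega : Omega) : (m * n).-tuple R :=
  if m is m'.+1 then cat_tuple (x (s + m'%:Z) omega) (history s m' omega) else [tuple].

Lemma measurable_history d' (T : measurableType d') (f : T -> Omega) s m :
  (forall r, s <= r -> r < s + m%:Z -> measurable_fun setT (fun t => x r (f t))) ->
  measurable_fun setT (fun t => history s m (f t)).
Proof.
elim: m => [|m IH] h; first exact: measurable_cst.
apply: (@measurable_cat R n (m * n)); first by apply: h; lia.
by apply: IH => r h1 h2; apply: h => //; lia.
Qed.

Lemma measurable_history_id s m : measurable_fun setT (history s m).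
Proof. by apply: (@measurable_history _ _ id) => r _ _; case: chain => h _ _ _; exact: h. Qed.

Lemma history_past s m r A : s + m%:Z <= r + 1 -> measurable A -> past x r (history s m @^-1` A).
Proof.
move=> mr mA.
pose G := [set B | exists s' C, [/\ s' <= r, measurable C & B = x s' @^-1` C]].
have : measurable_fun setT (fun t : g_sigma_algebraType G => history s m t).
  apply: (@measurable_history _ (g_sigma_algebraType G) (fun t : g_sigma_algebraType G => t : Omega)) => r' _ h2 _ C mC.
  rewrite setTI.
  by apply: sub_sigma_algebra; exists r', C; split => //; lia.
by move=> /(_ measurableT A mA); rewrite setTI.
Qed.

(** One factor per transition: [corr_blocks_step] produces [step_const] where the kernel has the
    inverse of [normalization]. *)
Definition density_const m : R := (normalization n q * step_const)^-1 ^+ m.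

Lemma step_const_gt0 : 0 < step_const.
Proof. by have := D_gt0 n_ge1 q_gt0; rewrite ltcE => /andP[]. Qed.

Lemma density_const_ge0 m : 0 <= density_const m.
Proof.
rewrite exprn_ge0 // invr_ge0 mulr_ge0 ?normalization_ge0 //; exact/ltW/step_const_gt0.
Qed.

Definition joint_density s m (X : (m * n).-tuple R) : R :=
  density_const m.-1 * rho (bt s m) X * \1_(@blocks_Dn R n m) X.

Lemma joint_density_ge0 s m X : 0 <= @joint_density s m X.
Proof. by rewrite !mulr_ge0 ?density_const_ge0 ?rho_ge0. Qed.

Lemma measurable_joint_density s m d' (T : measurableType d') (X : T -> (m * n).-tuple R) :
  measurable_fun setT X -> measurable_fun setT (fun t => joint_density s (X t)).
Proof.
move=> mX; apply: measurable_funM.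
  by apply: measurable_funM; [exact: measurable_cst|exact: measurable_rho].
have mI : measurable_fun setT (\1_(@blocks_Dn R n m) : (m * n).-tuple R -> R).
  apply: measurable_indic; exact: measurable_blocks_Dn.
exact: (measurableT_comp mI mX).
Qed.

Lemma joint_density_step s m (z : n.-tuple R) (X : (m.+1 * n).-tuple R) :
  @joint_density s m.+2 (cat_tuple z X) = transition q (@head_block n R (m * n) X) z * joint_density s X.
Proof.
rewrite /joint_density /transition !indicE.
have -> : (cat_tuple z X \in (@blocks_Dn R n m.+2 : set _)) = (z \in @Dn R n) && (X \in (@blocks_Dn R n m.+1 : set _)).
  apply/idP/andP => [/set_mem /= [h1 h2]|[/set_mem h1 /set_mem h2]].
    by rewrite (@head_cat n R (m.+1 * n)) in h1; rewrite (@tail_cat n R (m.+1 * n)) in h2; split; apply/mem_set.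
  apply/mem_set => /=; split; first by rewrite (@head_cat n R (m.+1 * n)).
  by rewrite (@tail_cat n R (m.+1 * n)).
have [/set_mem Dz|_] := boolP (z \in @Dn R n); last by rewrite /= !mulr0 mul0r.
have [/set_mem DX|_] := boolP (X \in (@blocks_Dn R n m.+1 : set _)); last by rewrite /= !mulr0.
have Dy : Dn (@head_block n R (m * n) X) by case: DX.
have := corr_blocks_step n_ge1 q_gt0 s (@tail_block n R (m * n) X) Dy Dz.
rewrite (@cat_blocks n R (m * n) X) !(rhoE n_ge1 q_gt0).
have -> : \det (cmb q (l0 R n)) = step_const%:C.
  have := D_gt0 n_ge1 q_gt0; move: (\det _) => D; rewrite ltcE /= => /andP[/eqP e _].
  by apply: complex_ext => //=; rewrite e.
rewrite -!rmorphM /= => -[->].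
have D0 : step_const != 0 by rewrite gt_eqF // step_const_gt0.
rewrite /density_const /= exprS; move: (_ ^+ m) => M; rewrite invfM.
move: (normalization n q)^-1 (Delta z / _) (interlace_weight _ _ _) (rho _ X) => c u v w.
by move: step_const D0 => D D0; field.
Qed.

(** Induction on the number of times. The joint law of the newest configuration and the earlier
    history is compared with the candidate density on measurable rectangles, where the Markov
    property applies because the history is an event of the past. *)
Lemma law_history s m (F : (m.+1 * n).-tuple R -> \bar R) : measurable_fun setT F -> (forall X, 0 <= F X)%E ->
  (\int[P]_omega F (history s m.+1 omega) = \int[L (m.+1 * n)%N]_X (F X * (joint_density s X)%:E))%E.
Proof.
move=> mF F0.
transitivity (\int[P]_omega (F (history s m.+1 omega) * (cst 1%R omega : R)%:E))%E.
  by apply: eq_integral => omega _; rewrite mule1.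
(* Extends the identity from events to nonnegative functions; the induction needs this because the
   Markov property integrates the kernel, a function of the history. *)
have red k : (forall A, measurable A -> P (history s k @^-1` A) =
    \int[L (k * n)%N]_X ((\1_A X)%:E * (joint_density s X)%:E))%E ->
    forall G : (k * n).-tuple R -> \bar R, measurable_fun setT G -> (forall X, 0 <= G X)%E ->
    (\int[P]_omega (G (history s k omega) * (cst 1%R omega : R)%:E) =
     \int[L (k * n)%N]_X (G X * (joint_density s X)%:E))%E.
  move=> h G mG G0.
  apply: (@eq_law R _ ((k * n).-tuple (measurableTypeR R)) _ Omega P (history s k) (cst 1%R) _ _ (L (k * n)%N) id) => //.
  - exact: measurable_history_id.
  - by apply: measurable_joint_density; exact: measurable_id.
  - by move=> X; exact: joint_density_ge0.
  - move=> A mA; rewrite -h //.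
    have mZ : measurable (history s k @^-1` A).
      by rewrite -[X in measurable X]setTI; exact: measurable_history_id.
    rewrite -[X in P X]setIT -(integral_indic P measurableT mZ).
    by apply: eq_integral => omega _; rewrite mule1 !indicE.
refine (red m.+1 _ F mF F0); clear F mF F0.
have mf k B : measurable B -> measurable_fun setT (fun X : (k * n).-tuple R => (\1_B X)%:E * (joint_density s X)%:E)%E.
  move=> mB; apply: emeasurable_funM; apply/measurable_EFinP.
    exact: (@measurable_indic _ ((k * n).-tuple (measurableTypeR R)) R setT B mB).
  by apply: measurable_joint_density; exact: measurable_id.
have f0 k B (X : (k * n).-tuple R) : (0 <= (\1_B X)%:E * (joint_density s X)%:E)%E.
  by rewrite mule_ge0 // lee_fin ?joint_density_ge0.
elim: m => [|m IH] A mA.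
  pose B := [set z : n.-tuple R | A (cat_tuple z ([tuple] : (0 * n).-tuple R))].
  have mB : measurable B.
    rewrite -[X in measurable X]setTI.
    have mcat : measurable_fun setT (fun z : n.-tuple R => cat_tuple z ([tuple] : (0 * n).-tuple R)).
      by apply: measurable_cat; [exact: measurable_id|exact: measurable_cst].
    exact: mcat.
  have -> : history s 1 @^-1` A = x (s + 0%:Z) @^-1` B by [].
  have [_ _ -> // _] := chain.
  rewrite (@integral_tuple_cat R n (0 * n)); [|exact: (mf 1%N A mA)|exact: (f0 1%N A)].
  rewrite /mu integral_mkcond; apply: eq_integral => z _.
  rewrite integral_tuple0; last by move=> X; exact: (f0 1%N A).
  rewrite patchE -EFinM /joint_density !indicE in_setI.
  have -> : (cat_tuple z ([tuple] : (0 * n).-tuple R) \in (@blocks_Dn R n 1 : set _)) = (z \in @Dn R n).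
    apply/idP/idP => [/set_mem /= [h _]|/set_mem h]; apply/mem_set.
      by rewrite (@head_cat n R (0 * n)) in h.
    by split => //; rewrite (@head_cat n R (0 * n)).
  rewrite -[z \in B]/(cat_tuple z [tuple] \in A); case: (_ \in A); last by rewrite mul0r.
  have [/set_mem Dz|_] /= := boolP (z \in @Dn R n); last by rewrite !mulr0.
  rewrite rhoRe (@corr_block1 R n q s (cat_tuple z ([tuple] : (0 * n).-tuple R))); last first.
    by rewrite (@head_cat n R (0 * n)).
  by rewrite (@head_cat n R (0 * n)) /= /density_const expr0 !mul1r mulr1.
have {}IH := red _ IH.
pose N := (m.+1 * n)%N.
pose pr omega : n.-tuple (measurableTypeR R) * N.-tuple (measurableTypeR R) := (x (s + m.+1%:Z) omega, history s m.+1 omega).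
have mpr : @measurable_fun _ _ Omega (n.-tuple (measurableTypeR R) * N.-tuple (measurableTypeR R))%type setT pr.
  have mx : measurable_fun setT (x (s + m.+1%:Z)) by case: chain.
  apply: measurable_fun_pair; first exact: mx.
  exact: measurable_history_id.
have [m1 m1E] := law_measure P mpr.
pose jd (z : n.-tuple (measurableTypeR R) * N.-tuple (measurableTypeR R)) :=
  (joint_density s (cat_tuple z.1 z.2 : (m.+2 * n).-tuple R))%:E.
have mjd : measurable_fun setT jd.
  apply/measurable_EFinP; apply: measurable_joint_density.
  exact: (@measurable_cat R n N).
have jd0 z : (0 <= jd z)%E by rewrite lee_fin joint_density_ge0.
have [m2 m2E] := density_measure (L n \x L N)%E mjd jd0.
have mcat : measurable_fun setT (fun z : n.-tuple (measurableTypeR R) * N.-tuple (measurableTypeR R) =>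
    cat_tuple z.1 z.2 : (n + N).-tuple R) by exact: (@measurable_cat R n N).
have main C : measurable C -> m1 C = m2 C.
  move=> mC; refine (@measure_unique _ R (n.-tuple (measurableTypeR R) * N.-tuple (measurableTypeR R))%type
    [set B `*` A | B in measurable & A in measurable] (fun=> setT)
    (measurable_prod_measurableType _ _) _ _ _ m1 m2 _ _ C mC).
  - move=> _ _ [B mB [A' mA' <-]] [B' mB' [A2 mA2 <-]].
    by exists (B `&` B'); [exact: measurableI|exists (A' `&` A2); [exact: measurableI|rewrite setXI]].
  - by move=> _; exists setT => //; exists setT => //; rewrite setXTT.
  - by rewrite bigcup_const.
  - move=> _ [B mB [A' mA' <-]]; rewrite m1E m2E.
    have -> : pr @^-1` (B `*` A') = (history s m.+1 @^-1` A') `&` (x (s + m%:Z + 1) @^-1` B).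
      rewrite setIC /pr (_ : s + m.+1%:Z = s + m%:Z + 1) //; lia.
    have hA : past x (s + m%:Z) (history s m.+1 @^-1` A') by apply: history_past => //; lia.
    have [_ _ _ hP] := chain; apply: (etrans (hP _ _ _ hA mB)).
    pose G (X : N.-tuple R) := ((\1_A' X)%:E * chain_kernel q (@head_block n R (m * n) X) B)%E.
    have mck : measurable_fun setT (fun X : N.-tuple R => chain_kernel q (@head_block n R (m * n) X) B).
      under eq_fun do rewrite chain_kernelE //.
      apply: (@measurable_fun_fubini_tonelli_F _ _ (N.-tuple (measurableTypeR R)) (n.-tuple (measurableTypeR R)) R (L n)
        (fun z => (\1_B z.2)%:E * (transition q (@head_block n R (m * n) z.1) z.2)%:E)%E).
      - apply: emeasurable_funM; apply/measurable_EFinP.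
          by apply: measurableT_comp => //; exact: measurable_indic.
        by apply: measurable_transition => //; apply: measurable_reindex.
      - by move=> z; rewrite mule_ge0 // lee_fin ?transition_ge0.
    have ck0 X : (0 <= chain_kernel q (@head_block n R (m * n) X) B)%E.
      by rewrite chain_kernelE //; apply: integral_ge0 => z _; rewrite mule_ge0 // lee_fin ?transition_ge0.
    have mG : measurable_fun setT G.
      apply: emeasurable_funM; last exact: mck.
      by apply/measurable_EFinP; exact: (@measurable_indic _ (N.-tuple (measurableTypeR R)) R setT A' mA').
    have G0 X : (0 <= G X)%E by rewrite mule_ge0 // lee_fin.
    transitivity (\int[P]_omega (G (history s m.+1 omega) * (cst 1%R omega : R)%:E))%E.
      rewrite integral_mkcond; apply: eq_integral => omega _.
      rewrite mule1 patchE /G /= (@head_cat n R (m * n)) indicE.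
      rewrite -[omega \in _]/(history s m.+1 omega \in A').
      by case: (_ \in A'); rewrite ?mul1e ?mul0e.
    rewrite (IH G mG G0) integral_mkcond fubini_tonelli2; last 2 first.
    - apply/(measurable_restrictT _ _).1; first exact: measurableX.
      exact: measurable_funTS.
    - by move=> z; apply: erestrict_ge0 => ? _; exact: jd0.
    apply: eq_integral => X _; rewrite /fubini_G /G chain_kernelE // muleAC.
    rewrite -ge0_integralZl; last 4 first.
    - exact: measurableT.
    - apply: emeasurable_funM; apply/measurable_EFinP.
        exact: (@measurable_indic _ (n.-tuple (measurableTypeR R)) R setT B mB).
      by apply: measurable_transition => //; exact: measurable_cst.
    - by move=> z _; rewrite mule_ge0 // lee_fin ?transition_ge0.
    - by rewrite mule_ge0 // lee_fin joint_density_ge0.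
    apply: eq_integral => z _; rewrite patchE in_setX /= /jd joint_density_step EFinM !indicE.
    by case: (z \in B); case: (X \in A'); rewrite /= ?mul1e ?mul0e ?mule0 // muleC.
  - by move=> _; rewrite m1E preimage_setT [X in (X < _)%E](_ : _ = 1%E) ?ltry //; exact: probability_setT.
pose C := [set z : n.-tuple (measurableTypeR R) * N.-tuple (measurableTypeR R) | A (cat_tuple z.1 z.2)].
have mC : measurable C by rewrite -[X in measurable X]setTI; exact: mcat.
have -> : history s m.+2 @^-1` A = pr @^-1` C by [].
rewrite -m1E main // m2E integral_mkcond fubini_tonelli1.
- rewrite (@integral_tuple_cat R n N); [|exact: (mf m.+2 A mA)|exact: (f0 m.+2 A)].
  apply: eq_integral => z _; apply: eq_integral => X _; rewrite patchE indicE.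
  rewrite -[(z, X) \in C]/(cat_tuple z X \in A).
  by case: (_ \in A); rewrite ?mul1e ?mul0e.
- apply/(measurable_restrictT _ _).1; first exact: mC.
  by apply: measurable_funTS; exact: mjd.
- by move=> z; apply: erestrict_ge0 => ? _; exact: jd0.
Qed.

End law.

(** * Symmetrisation *)

Section symmetrisation.
Context (R : realType) (n : nat) (q : R).
Hypothesis n_ge1 : (1 <= n)%N.
Hypothesis q_gt0 : 0 < q.
Local Notation L := (lebesgue_tuple R).
Local Notation rho := (rho n q).
Local Notation bt := (block_times n).

Section window.
Variables (s : int) (m : nat).
Local Notation N := (m * n)%N.
Local Notation T := (bt s m).
Local Notation ind X := (\1_(@blocks_Dn R n m) X : R).

(** The permutations that act within each configuration. *)
Definition stab (sg : {perm 'I_N}) : bool := reindex_tuple T sg == T.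

Lemma blocks_Dn_perm (X : N.-tuple R) sg : stab sg ->
  blocks_Dn (reindex_tuple X sg) <-> (forall i, incirc (tnth X i)) /\ key_sorted T X sg.
Proof.
move=> /eqP e.
have et k : tnth T (sg k) = tnth T k by rewrite -[in RHS]e tnth_mktuple.
rewrite (blocks_DnP s) /key_sorted; split=> -[h1 h2]; split.
- by move=> i; have := h1 ((sg^-1)%g i); rewrite tnth_mktuple permKV.
- apply/forallP => i; apply/forallP => j; apply/implyP => ij.
  move/forallP : h2 => /(_ i) /forallP/(_ j) /implyP/(_ ij).
  by rewrite !perm1 /key_le !et !tnth_mktuple.
- by move=> i; rewrite tnth_mktuple.
- apply/forallP => i; apply/forallP => j; apply/implyP => ij.
  move/forallP : h2 => /(_ i) /forallP/(_ j) /implyP/(_ ij).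
  by rewrite !perm1 /key_le !et !tnth_mktuple.
Qed.

(** If the points of each time are distinct, exactly one time-preserving permutation sorts the
    window. If two of them coincide, or one lies off the circle, [rho] is 0. *)
Lemma rho_sum_perm (X : N.-tuple R) :
  rho T X = \sum_(sg | stab sg) rho T X * ind (reindex_tuple X sg).
Proof.
rewrite -big_distrr /=.
have [hX|] := boolP [forall i, incirc (tnth X i)]; last first.
  by rewrite negb_forall => /existsP[i hi]; rewrite (rho_out _ _ _ hi) mul0r.
have [/existsP[i /existsP[j /and3P[ij /eqP eT /eqP eX]]]|nt] :=
    boolP [exists i, exists j, [&& i != j, tnth T i == tnth T j & tnth X i == tnth X j]].
  by rewrite rhoRe (corr_eq_points _ _ ij eT eX) mul0r.
have [s0 hs0] := key_sorted_exists T X.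
have st0 : stab s0 by apply/eqP/(key_sorted_tau (@block_times_decr n s m) hs0).
rewrite (bigD1 s0) //= big1 ?addr0 => [|sg /andP[st ne]].
  rewrite indicE mem_set ?mulr1 //; apply/(blocks_Dn_perm _ st0); split => //.
  exact/forallP.
rewrite indicE memNset // => /(blocks_Dn_perm _ st)[_ hs]; move/eqP : ne; apply.
apply: (key_sorted_unique _ hs hs0) => i j ij eT; apply: contraNneq nt => eX.
by apply/existsP; exists i; apply/existsP; exists j; rewrite ij eT eX !eqxx.
Qed.

Definition nstab : R := \sum_(sg | stab sg) 1.

Lemma nstab_gt0 : 0 < nstab.
Proof.
rewrite /nstab (bigD1 1%g) /=; first by rewrite ltr_wpDr // sumr_ge0.
by apply/eqP; apply: eq_from_tnth => i; rewrite tnth_mktuple perm1.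
Qed.

Lemma integral_symmetrise (H : N.-tuple R -> \bar R) : measurable_fun setT H -> (forall X, 0 <= H X)%E ->
  (forall sg X, stab sg -> H (reindex_tuple X sg) = H X) ->
  (\int[L N]_X (H X * (rho T X)%:E) = nstab%:E * \int[L N]_X (H X * (rho T X * ind X)%:E))%E.
Proof.
move=> mH H0 Hs; pose F X := (H X * (rho T X * ind X)%:E)%E.
have mF : measurable_fun setT F.
  apply: emeasurable_funM => //; apply/measurable_EFinP; apply: measurable_funM.
    by apply: measurable_rho => //; exact: measurable_id.
  by apply: measurable_indic; exact: measurable_blocks_Dn.
have F0 X : (0 <= F X)%E by rewrite mule_ge0 // lee_fin mulr_ge0 ?rho_ge0.
rewrite /nstab -sumEFin ge0_sume_distrl; last by move=> i _; rewrite lee_fin.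
transitivity (\int[L N]_X \sum_(sg <- [seq sg <- index_enum _ | stab sg]) F (reindex_tuple X sg))%E.
  apply: eq_integral => X _; rewrite big_filter {1}rho_sum_perm -sumEFin ge0_sume_distrr.
    apply: eq_bigr => sg st; rewrite /F (Hs _ _ st).
    have e : rho T (reindex_tuple X sg) = rho T X by rewrite -{1}(eqP st) rho_perm.
    by rewrite e.
  by move=> sg _; rewrite lee_fin mulr_ge0 ?rho_ge0.
rewrite ge0_integral_sum; last 3 first.
- exact: measurableT.
- by move=> sg; apply: (measurableT_comp mF); apply: measurable_reindex; exact: measurable_id.
- by move=> sg X _; exact: F0.
by rewrite big_filter; apply: eq_bigr => sg _; rewrite mul1e (integral_tuple_perm sg mF F0).
Qed.

End window.

Section expectation.
Context d (Omega : measurableType d) (P : probability Omega R) (x : int -> Omega -> n.-tuple R).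
Hypothesis chain : stationary_markov_chain q P x.

Lemma expectation_labels s m p (r : p.-tuple int) (h : p.-tuple R -> \bar R) :
  (forall t, t \in (r : seq int) -> s <= t < s + m.+1%:Z) ->
  measurable_fun setT h -> (forall Y, 0 <= h Y)%E ->
  (\int[P]_omega (\sum_(j : p.-tuple 'I_(m.+1 * n) | is_label (bt s m.+1) r j)
      h (reindex_tuple (history x s m.+1 omega) (tnth j))) =
   \int[L p]_Y (h Y * (rho r Y)%:E))%E.
Proof.
move=> hr mh h0; set T := bt s m.+1.
have hT t : t \in (T : seq int) -> count_mem t T = n.
  by move=> /tnthP[i ->]; rewrite count_block_times // block_times_ge block_times_lt.
have hr' t : t \in (r : seq int) -> count_mem t T = n.
  by move=> tr; rewrite count_block_times // hr.
pose H (X : (m.+1 * n).-tuple R) :=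
  (\sum_(j : p.-tuple 'I_(m.+1 * n) | is_label T r j) h (reindex_tuple X (tnth j)))%E.
have mH : measurable_fun setT H.
  rewrite /H; under eq_fun do rewrite -big_filter.
  apply: emeasurable_sum => j; apply: (measurableT_comp mh); apply: measurable_reindex; exact: measurable_id.
have H0 X : (0 <= H X)%E by apply: sume_ge0 => j _; exact: h0.
have Hs sg X : @stab s m.+1 sg -> H (reindex_tuple X sg) = H X.
  move=> /eqP e; rewrite /H [RHS](reindex_inj (h := fun j : p.-tuple _ => map_tuple sg j)) /=; last first.
    by move=> j j' /(congr1 val) /= /(inj_map perm_inj) e'; exact/val_inj.
  apply: eq_big => j; last first.
    move=> _; congr h; apply: eq_from_tnth => i; by rewrite !tnth_mktuple tnth_map.
  rewrite /is_label /= (map_inj_uniq perm_inj); congr (_ && (_ == _)).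
  rewrite /T -{1}e; apply: eq_from_tnth => i; by rewrite !tnth_mktuple tnth_map.
have lawH (G : (m.+1 * n).-tuple R -> \bar R) : measurable_fun setT G -> (forall X, 0 <= G X)%E ->
   (\int[P]_omega G (history x s m.+1 omega) =
    (density_const n q m)%:E * \int[L (m.+1 * n)%N]_X (G X * (rho T X * \1_(@blocks_Dn R n m.+1) X)%:E))%E.
  move=> mG G0; rewrite (law_history n_ge1 q_gt0 chain) // -ge0_integralZl; last 4 first.
  - exact: measurableT.
  - apply: emeasurable_funM => //; apply/measurable_EFinP; apply: measurable_funM.
      by apply: measurable_rho => //; exact: measurable_id.
    by apply: measurable_indic; exact: measurable_blocks_Dn.
  - by move=> X _; rewrite mule_ge0 // lee_fin mulr_ge0 ?rho_ge0.
  - by rewrite lee_fin density_const_ge0.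
  by apply: eq_integral => X _; rewrite /joint_density /= -mulrA EFinM muleCA.
have symH := integral_symmetrise mH H0 Hs.
have sym1 := @integral_symmetrise s m.+1 (cst 1%E) (@measurable_cst _ _ _ _ _ _) (fun=> @lee01 R) (fun _ _ _ => erefl).
have law1 := lawH (cst 1%E) (@measurable_cst _ _ _ _ _ _) (fun=> @lee01 R).
have labH := integral_rho_labels n_ge1 q_gt0 hT hr' mh h0.
have labT := integral_rho n_ge1 q_gt0 hT.
have g0 := nstab_gt0 s m.+1.
have cancel (a b : \bar R) : ((nstab s m.+1)%:E * a = (nstab s m.+1)%:E * b -> a = b)%E.
  move=> e; rewrite -[a]mul1e -[b]mul1e -(mulVf (lt0r_neq0 g0)) EFinM -!muleA; congr (_ * _)%E.
  exact: e.
have nl : ((nstab s m.+1)%:E * \int[L (m.+1 * n)%N]_X (cst 1 X * (rho T X * \1_(@blocks_Dn R n m.+1) X)%:E) =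
   (nlabels T T)%:R%:E)%E.
  rewrite -labT; apply: (etrans (esym sym1)); apply: eq_integral => X _; exact: mul1e.
(* Both numbers count the time-preserving permutations, but the ratio is left unevaluated: the total
   mass [law1] gives [density_const * b = 1]. *)
pose b := (nlabels T T)%:R / nstab s m.+1.
have nb : (nlabels T T)%:R = nstab s m.+1 * b :> R by rewrite /b mulrCA mulfV ?mulr1 // lt0r_neq0.
rewrite nb EFinM in nl labH; move/cancel : nl => B1.
move: law1; rewrite B1 integral_cst // mul1e => law1.
have mb : (density_const n q m * b)%:E = 1%E.
  rewrite EFinM -law1; exact: probability_setT.
have A : (\int[L (m.+1 * n)%N]_X (H X * (rho T X * \1_(@blocks_Dn R n m.+1) X)%:E) =
    b%:E * \int[L p]_Y (h Y * (rho r Y)%:E))%E.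
  by apply: cancel; rewrite muleA -labH -symH.
apply: (etrans (lawH H mH H0)).
by rewrite A muleA -EFinM mb mul1e.
Qed.

End expectation.
End symmetrisation.

(** * Sums over the points of the process *)

Section integral_tools.
Context (R : realType).
Local Open Scope ereal_scope.
Import HBNNSimple.

(* No measurability of f and g is assumed: the sum over the points of the process is not known to be
   measurable, only to agree with a measurable function off a null set. *)
Lemma integral_le_off_null d (T : measurableType d) (m : {measure set T -> \bar R}) (f g : T -> \bar R) (A : set T) :
  measurable A -> m A = 0 -> (forall x, 0 <= f x) -> (forall x, 0 <= g x) ->
  (forall x, ~ A x -> f x = g x) -> \int[m]_x f x <= \int[m]_x g x.
Proof.
move=> mA A0 f0 g0 fg; rewrite [X in X <= _]ge0_integralTE // [X in _ <= X]ge0_integralTE //.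
apply: ub_ereal_sup => _ [h hf <-].
pose h' : {nnsfun T >-> R} := mul_nnsfun h (indic_nnsfun R (measurableC mA)).
have h'E x : h' x = (h x * \1_(~` A) x)%R by [].
have -> : sintegral m h = sintegral m h'.
  rewrite -!integralT_nnsfun; apply: ge0_ae_eq_integral => //.
  - by apply/measurable_EFinP.
  - by apply/measurable_EFinP; apply: (@measurable_funPT _ _ _ _ h').
  - by move=> x _; rewrite lee_fin.
  - by move=> x _; rewrite lee_fin; exact: (@fun_ge0 _ _ h').
  exists A; split => // x; apply: contra_notP => nAx _.
  by rewrite h'E indicE mem_set // mulr1.
apply: ereal_sup_ubound; exists h' => // x; rewrite h'E indicE.
have [Ax|nAx] := pselect (A x).
  by rewrite memNset ?mulr0 // => /(_ Ax).
by rewrite mem_set // mulr1 -fg.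
Qed.

Lemma eq_integral_off_null d (T : measurableType d) (m : {measure set T -> \bar R}) (f g : T -> \bar R) (A : set T) :
  measurable A -> m A = 0 -> (forall x, 0 <= f x) -> (forall x, 0 <= g x) ->
  (forall x, ~ A x -> f x = g x) -> \int[m]_x f x = \int[m]_x g x.
Proof.
move=> mA A0 f0 g0 fg; apply/le_anti/andP; split; apply: integral_le_off_null mA A0 _ _ _ => //.
by move=> x nA; rewrite fg.
Qed.

(** Turns an unordered sum into a series along an enumeration, to which monotone convergence
    applies; codes of no element contribute 0. *)
Lemma esum_count (T : countType) (a : T -> \bar R) : (forall r, 0 <= a r) ->
  \esum_(r in [set: T]) a r = \sum_(0 <= k <oo) (if pickle_inv k is Some r then a r else 0).
Proof.
move=> a0; pose b k := if pickle_inv k is Some r then a r else 0.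
have b0 k : 0 <= b k by rewrite /b; case: pickle_inv.
rewrite -/b nneseries_esum; last by move=> k _; exact: b0.
rewrite (_ : [set x | _] = [set: nat]); last by apply/seteqP.
rewrite (_ : \esum_(i in [set: nat]) b i = \esum_(i in range (@pickle T)) b i); last first.
  rewrite [RHS]esum_mkcond; apply: eq_esum => k _; case: ifPn => // /negP hk.
  rewrite /b; case e: pickle_inv => [r|] //; exfalso; apply: hk; apply/mem_set; exists r => //.
  by have := @pickle_invK T k; rewrite e /=.
rewrite (@reindex_esum R T nat setT (range (@pickle T)) pickle b).
  by apply: eq_esum => r _; rewrite /b pickleK_inv.
split => [r _|r r' _ _|k [r _ <-]]; [by exists r|exact: (pcan_inj (@pickleK T))|by exists r].
Qed.

Lemma integral_esum d (X : measurableType d) (m : {measure set X -> \bar R}) (T : countType)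
    (F : T -> X -> \bar R) :
  (forall r, measurable_fun setT (F r)) -> (forall r x, 0 <= F r x) ->
  \int[m]_x (\esum_(r in [set: T]) F r x) = \esum_(r in [set: T]) \int[m]_x F r x.
Proof.
move=> mF F0; under eq_integral do rewrite esum_count //.
rewrite integral_nneseries //.
- rewrite esum_count; last by move=> r; exact: integral_ge0.
  congr (limn _); apply/funext => N; apply: eq_bigr => k _.
  by case: pickle_inv => // ; rewrite integral0.
- by move=> k; case: pickle_inv => //; exact: measurable_cst.
- by move=> k x _; case: pickle_inv.
Qed.

Lemma esum_finType (T : finType) (P : pred T) (a : T -> \bar R) : (forall j, 0 <= a j) ->
  \esum_(j in [set j | P j]) a j = \sum_(j | P j) a j.
Proof.
move=> a0; rewrite esum_fset //; last exact: finite_finset.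
by rewrite -(@bigfs _ _ _ T (index_enum T) P a) ?index_enum_uniq // => j _; rewrite mem_index_enum.
Qed.

End integral_tools.

(** * Points of the process as labelled coordinates of a window *)

Section paths.
Context (R : realType) (n : nat) d (Omega : measurableType d) (x : int -> Omega -> n.-tuple R).
Variable omega : Omega.
Local Notation bt := (block_times n).
Local Notation Z s m := (history x s m omega).

Lemma tnth_zip (S T : Type) p (r : p.-tuple S) (X : p.-tuple T) u :
  tnth (zip_tuple r X) u = (tnth r u, tnth X u).
Proof.
rewrite (tnth_nth (tnth r u, tnth X u)) nth_zip ?size_tuple //.
by congr pair; rewrite -tnth_nth.
Qed.

Lemma history_points s m i : exists k, tnth (Z s m) i = tnth (x (tnth (bt s m) i) omega) k.
Proof.
elim: m i => [|m IH]; first by case.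
move=> i; rewrite -(@splitK n (m * n) i); case: (fintype.split i) => j /=.
  by rewrite !tnth_lshift tnth_nseq_tuple; exists j.
by rewrite !tnth_rshift; exact: IH.
Qed.

Lemma history_surj s m t k : s <= t < s + m%:Z ->
  exists i, tnth (bt s m) i = t /\ tnth (Z s m) i = tnth (x t omega) k.
Proof.
elim: m => [|m IH] h; first by exfalso; lia.
have [tm|tm] := eqVneq (s + m%:Z) t.
  by exists (lshift (m * n) k); rewrite !tnth_lshift tnth_nseq_tuple tm.
have [|i [e1 e2]] := IH; first by lia.
by exists (rshift n i); rewrite !tnth_rshift.
Qed.

Hypothesis xinj : forall r, injective (tnth (x r omega)).

Lemma history_inj s m i i' : tnth (bt s m) i = tnth (bt s m) i' ->
  tnth (Z s m) i = tnth (Z s m) i' -> i = i'.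
Proof.
elim: m i i' => [|m IH]; first by case.
move=> i i'; rewrite -(@splitK n (m * n) i) -(@splitK n (m * n) i').
case: (fintype.split i) => j; case: (fintype.split i') => j' /=.
- by rewrite !tnth_lshift => _ /xinj ->.
- rewrite tnth_lshift tnth_rshift tnth_nseq_tuple => e.
  by have := block_times_lt s j'; rewrite -e ltxx.
- rewrite tnth_lshift tnth_rshift tnth_nseq_tuple => e.
  by have := block_times_lt s j; rewrite e ltxx.
- by rewrite !tnth_rshift => e1 e2; rewrite (IH j j').
Qed.

(** For fixed times [r], tuples of distinct points of the process correspond bijectively to labels;
    injectivity uses that each configuration has distinct points. The window may vary with [r],
    since no finite window serves all [r]. *)
Lemma esum_points p (h : p.-tuple int -> p.-tuple R -> \bar R) (s : p.-tuple int -> int) (m : p.-tuple int -> nat) :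
  (forall r a, 0 <= h r a)%E ->
  (forall (r : p.-tuple int) t, t \in (r : seq int) -> s r <= t < s r + (m r)%:Z) ->
  (\esum_(z in [set z : p.-tuple (int * R) | uniq z /\ forall u, point_process x omega (tnth z u)])
     h (map_tuple fst z) (map_tuple snd z) =
   \esum_(r in [set: p.-tuple int]) \sum_(j : p.-tuple 'I_(m r * n) | is_label (bt (s r) (m r)) r j)
     h r (reindex_tuple (Z (s r) (m r)) (tnth j)))%E.
Proof.
move=> h0 w.
pose S (r : p.-tuple int) := [set X : p.-tuple R | uniq (zip_tuple r X) /\
  forall u, point_process x omega (tnth r u, tnth X u)].
transitivity (\esum_(r in [set: p.-tuple int]) \esum_(X in S r) h r X)%E; last first.
  apply: eq_esum => r _; rewrite -esum_finType //.
  apply: reindex_esum; split.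
  - move=> j /andP[uj /eqP er]; split.
      apply/tuple_uniqP => u u'; rewrite !tnth_zip !tnth_mktuple => -[e1 e2].
      have er' v : tnth (bt (s r) (m r)) (tnth j v) = tnth r v.
        by have := congr1 (fun t => tnth t v) er; rewrite tnth_mktuple.
      rewrite -!er' in e1.
      by move: uj => /tuple_uniqP; apply; exact: history_inj e1 e2.
    move=> u; have [k e] := history_points (s r) (tnth j u).
    exists k; rewrite /= tnth_mktuple e; congr (tnth (x _ omega) k).
    by have := congr1 (fun t => tnth t u) er; rewrite tnth_mktuple.
  - move=> j j' /set_mem /andP[uj /eqP er] /set_mem /andP[uj' /eqP er'] e.
    apply: eq_from_tnth => u; apply: (@history_inj (s r) (m r)).
      by have := congr1 (fun t => tnth t u) (etrans er (esym er')); rewrite !tnth_mktuple.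
    by have := congr1 (fun X => tnth X u) e; rewrite !tnth_mktuple.
  - move=> X [uX hX].
    have /choice[f hf] : forall u, exists i, tnth (bt (s r) (m r)) i = tnth r u /\ tnth (Z (s r) (m r)) i = tnth X u.
      move=> u; have [k /= ->] := hX u; apply: history_surj; apply: w; exact: mem_tnth.
    exists [tuple f u | u < p] => /=; last first.
      by apply: eq_from_tnth => u; rewrite !tnth_mktuple; case: (hf u).
    apply/andP; split.
      apply/tuple_uniqP => u u'; rewrite !tnth_mktuple => e.
      move: uX => /tuple_uniqP; apply; rewrite !tnth_zip.
      by have [<- <-] := hf u; have [<- <-] := hf u'; rewrite e.
    by apply/eqP; apply: eq_from_tnth => u; rewrite !tnth_mktuple; case: (hf u).
rewrite esum_esum //.
rewrite (@reindex_esum R (p.-tuple (int * R)) (p.-tuple int * p.-tuple R)%type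
  [set z : p.-tuple (int * R) | uniq z /\ forall u, point_process x omega (tnth z u)] (setT `*`` S)
  (fun z => (map_tuple fst z, map_tuple snd z)) (fun k => h k.1 k.2)) //.
have zu (z : p.-tuple (int * R)) : zip_tuple (map_tuple fst z) (map_tuple snd z) = z.
  by apply/val_inj; rewrite /= zip_unzip.
split.
- move=> z [uz hz]; split => //; split => /=; first by rewrite zip_unzip.
  by move=> u; rewrite !tnth_map -surjective_pairing.
- move=> z z' _ _ [e1 e2]; rewrite -[z]zu -[z']zu; apply/val_inj => /=.
  by rewrite e1 e2.
- move=> [r X] [_ /= [uX hX]]; exists (zip_tuple r X) => /=.
    by split => // u; rewrite tnth_zip; exact: hX.
  have zs : size (r : seq int) = size (X : seq R) by rewrite !size_tuple.
  congr pair; apply/val_inj => /=; [apply: unzip1_zip|apply: unzip2_zip]; by rewrite zs.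
Qed.

End paths.

(** * The determinantal property *)

Section determinantal_chain.
Context (R : realType) (n : nat) (q : R).
Hypothesis n_ge1 : (1 <= n)%N.
Hypothesis q_gt0 : 0 < q.
Local Notation L := (lebesgue_tuple R).
Local Notation rho := (rho n q).

Section ties.
Context d (Omega : measurableType d) (P : probability Omega R) (x : int -> Omega -> n.-tuple R).
Hypothesis chain : stationary_markov_chain q P x.

(** Off this null set the n coordinates of every configuration are distinct, so counting points and
    counting labels agree. *)
Definition ties : set Omega := \bigcup_r [set omega | Delta (x r omega) = 0].

Lemma ties_null : measurable ties /\ P ties = 0%E.
Proof.
have [mx Dx law _] := chain.
pose B := [set y : n.-tuple R | Delta y = 0].
have mB : measurable B.
  rewrite -[X in measurable X]setTI.
  have mD : measurable_fun setT (fun y : n.-tuple R => Delta y) by apply: measurable_Delta; exact: measurable_id.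
  exact: (mD measurableT [set 0] (measurable_set1 _)).
have mr r : measurable (x r @^-1` B) by rewrite -[X in measurable X]setTI; exact: mx.
have Pr r : P (x r @^-1` B) = 0%E.
  rewrite law // /mu integral0_eq // => y [By _]; rewrite (By : Delta y = 0) expr0n /= mulr0 //.
have e : ties = \bigcup_k (x k%:Z @^-1` B `|` x (Negz k) @^-1` B).
  apply/seteqP; split => [w [[k|k] _ h]|w [k _ [h|h]]].
  - by exists k => //; left.
  - by exists k => //; right.
  - by exists k%:Z.
  - by exists (Negz k).
have mt : measurable ties by rewrite e; apply: bigcupT_measurable => k; exact: measurableU.
split => //; apply/negligibleP => //; rewrite e; apply: negligible_bigcup => k.
by apply: negligibleU; apply/negligibleP => //; exact: Pr.
Qed.

Lemma no_ties_inj omega r : ~ ties omega -> injective (tnth (x r omega)).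
Proof.
move=> nt i j e; apply/eqP/contraT => ij; exfalso; apply: nt; exists r => //=.
have [_ Dx _ _] := chain.
wlog ij' : i j e ij / (i < j)%N.
  move=> W; have := ij; rewrite -val_eqE /= neq_ltn => /orP[h|h]; first exact: (W i j).
  by apply: (W j i) => //; rewrite eq_sym.
apply/eqP/prodf_eq0; exists i => //; apply/prodf_eq0; exists j => //.
by rewrite e subrr /normc /= expr0n /= addr0 sqrtr0.
Qed.

Lemma correlation_chain p : correlation_function P (point_process x) (fun r : p.-tuple int => rho r).
Proof.
split.
- by move=> r; apply: measurable_rho => //; exact: measurable_id.
- by move=> r a; exact: rho_ge0.
move=> h mh h0.
have /choice[w hw] : forall r : p.-tuple int, exists sm : int * nat,
    forall t, t \in (r : seq int) -> sm.1 <= t < sm.1 + sm.2.+1%:Z.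
  move=> r; have [s [m H]] := int_window r; exists (s, m) => t /H /=; lia.
pose F (r : p.-tuple int) omega := (\sum_(j : p.-tuple 'I_((w r).2.+1 * n) | is_label (block_times n (w r).1 (w r).2.+1) r j)
  h r (reindex_tuple (history x (w r).1 (w r).2.+1 omega) (tnth j)))%E.
have F0 r omega : (0 <= F r omega)%E by apply: sume_ge0.
have mF r : measurable_fun setT (F r).
  rewrite /F; under eq_fun do rewrite -big_filter.
  apply: emeasurable_sum => j; apply: (measurableT_comp (mh r)); apply: measurable_reindex.
  exact: (measurable_history_id n_ge1 q_gt0 chain).
have [mt Pt] := ties_null.
transitivity (\int[P]_omega \esum_(r in [set: p.-tuple int]) F r omega)%E.
  apply: (eq_integral_off_null mt Pt).
  - by move=> omega; apply: esum_ge0.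
  - by move=> omega; apply: esum_ge0.
  - move=> omega nt.
    exact: (@esum_points R n _ Omega x omega (fun r => @no_ties_inj omega r nt) p h (fun r => (w r).1) (fun r => (w r).2.+1) h0 hw).
rewrite (@integral_esum R _ Omega P (p.-tuple int) F mF F0).
apply: eq_esum => r _; rewrite (expectation_labels n_ge1 q_gt0 chain (hw r) (mh r) (h0 r)).
(* Outside the box [rho] vanishes, so restricting the integral changes nothing. *)
rewrite [RHS]integral_mkcond; apply: eq_integral => a _; rewrite patchE.
case: ifPn => // /negP na.
have [u hu] : exists u, ~~ incirc (tnth a u).
  apply/existsP; rewrite -negb_forall; apply/negP => /forallP H; apply: na; apply/mem_set => u; exact: H.
by rewrite (rho_out _ _ _ hu) mule0.
Qed.

(** [kern] agrees with the kernel on the diagonal and wherever the positions differ, so only tuples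
    with a repeated coordinate are exceptional. *)
Lemma det_space_time_ae p (r : p.-tuple int) :
  {ae L p, forall a : p.-tuple R, @box R p a ->
     \det (\matrix_(u < p, v < p) space_time_kernel n q (tnth r u) (tnth a u) (tnth r v) (tnth a v)) =
     (rho r a)%:C}.
Proof.
exists [set a : p.-tuple R | ~~ uniq a]; split.
- rewrite (_ : [set a : p.-tuple R | ~~ uniq a] = ~` [set a : p.-tuple R | uniq a]).
    by apply: measurableC; exact: measurable_uniq.
  by apply/seteqP; split => X /= /negP.
- exact: ae_uniq.
- move=> a /=; apply: contra_notP => /negP; rewrite negbK => ua ba.
  rewrite -(rhoE n_ge1 q_gt0) /corr; congr (\det _); apply/matrixP => u v; rewrite !mxE.
  apply/esym/kern_spec => //; [exact: ba|exact: ba|].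
  have [->|uv] := eqVneq u v; first by rewrite eqxx.
  apply/orP; right; apply: contra uv => /eqP e; apply/eqP.
  by move/tuple_uniqP : ua; apply.
Qed.

End ties.
End determinantal_chain.

(** * The symbol and its Fourier coefficients *)

Section symbol.
Context (R : realType) (n : nat) (q : R).
Hypothesis n_ge1 : (1 <= n)%N.
Hypothesis q_gt0 : 0 < q.
Local Notation mu := (@lebesgue_measure R).

Lemma mod2pi_id (u : R) : 0 <= u < 2 * pi -> mod2pi u = u.
Proof.
move=> /andP[u0 u2]; have p0 : 0 < 2 * pi :> R by rewrite mulr_gt0 ?pi_gt0.
rewrite /mod2pi (_ : Num.floor _ = 0) ?mul0r ?subr0 //; apply: floor_def.
by rewrite divr_ge0 ?(ltW p0) //= add0r ltr_pdivrMr // mul1r.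
Qed.

Lemma expi_pi m : expi (pi * m%:R) = ((-1) ^+ m)%:C :> R[i].
Proof.
elim: m => [|m IH]; first by rewrite mulr0 expi0 expr0.
rewrite -addn1 natrD mulrDr mulr1 expiD IH exprD expr1 rmorphM /=; congr (_ * _).
by rewrite /expi cospi sinpi.
Qed.

Definition symbol_denom : R := 1 - (-1) ^+ n.-1 * q `^ (2 * pi).

(** The endpoint 2 pi, where [mod2pi] drops back to 0, is negligible; the functions need only agree
    before it. *)
Lemma integralC_itv_bndc (f h : R -> R[i]) : cmeasurable (@circ R) h ->
  (forall u, @circ R u -> f u = h u) -> integralC `[0, 2 * pi] f = integralC `[0, 2 * pi] h.
Proof.
have m1 (F : R -> R) : measurable_fun (@circ R) F -> \int[mu]_(x in @circ R) F x = \int[mu]_(x in `[0, 2 * pi]) F x.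
  by move=> mF; rewrite /circ; congr fine; apply: integral_itv_bndo_bndc; exact/measurable_EFinP.
move=> [h1 h2] fh.
have f1 : measurable_fun (@circ R) (fun u => complex.Re (f u)).
  by apply: eq_measurable_fun h1 => u /set_mem cu; rewrite fh.
have f2 : measurable_fun (@circ R) (fun u => complex.Im (f u)).
  by apply: eq_measurable_fun h2 => u /set_mem cu; rewrite fh.
have e : integralC (@circ R) f = integralC (@circ R) h by exact: eq_integralC.
by move: e; rewrite /integralC !m1.
Qed.

Hypothesis q_neq1 : q != 1.

Lemma symbol_denom_neq0 : symbol_denom != 0.
Proof.
have p0 : 0 < 2 * pi :> R by rewrite mulr_gt0 ?pi_gt0.
rewrite /symbol_denom -signr_odd; case: odd; rewrite ?expr0 ?expr1 ?mul1r ?mulN1r.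
  by rewrite opprK gt_eqF // ltr_wpDr // powR_ge0.
rewrite subr_eq0 eq_sym /powR (gt_eqF q_gt0); apply/eqP => h.
have /expR_inj/eqP : expR (2 * pi * ln q) = expR 0 by rewrite h expR0.
by rewrite mulf_eq0 (gt_eqF p0) /= ln_eq0 // (negbTE q_neq1).
Qed.

(** With w the denominator of the symbol, the integrand is e^{-g_k u} / w on the period. As e^{-2 pi
    g_k} = e^{2 pi lam} = 1 - w, integration yields w / g_k, which the denominator cancels. *)
Lemma symbol_integral (k : int) :
  integralC `[0, 2 * pi] (fun u : R => symbol n q u * expi (- (u * k%:~R))) = (g n q k)^-1.
Proof.
have p0 : 0 <= 2 * pi :> R by rewrite mulr_ge0 ?pi_ge0.
pose w : R[i] := symbol_denom%:C.
have w0 : w != 0 by rewrite /w (fmorph_eq0 (@real_complex R)) symbol_denom_neq0.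
have g0 : g n q k != 0.
  apply/eqP => /(congr1 (@complex.Re R)); rewrite gE ReD ReN ReM /= mul0r mulr0 subrr add0r.
  by move/eqP; rewrite oppr_eq0 ln_eq0 // (negbTE q_neq1).
have cm z c : cmeasurable (@circ R) (fun u => c * cexp (z * u%:C)).
  apply: cderiv_cmeasurable => [|t]; [exact: measurable_circ|].
  by eexists; apply: cderivZ; exact: cderiv_cexp.
rewrite (@integralC_itv_bndc _ (fun u => w^-1 * cexp (- g n q k * u%:C))) //; last first.
  move=> u; rewrite /circ /= in_itv /= => hu.
  rewrite /symbol mod2pi_id // -/symbol_denom -/w mulrAC mulrC; congr (_ * _).
  rewrite [u * _]mulrC -(cexp_lam _ q_gt0) (_ : - (u * k%:~R) = u * (- k)%:~R); last by rewrite rmorphN /= mulrN.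
  rewrite expi_cexp -cexpD gE; congr cexp; rewrite !rmorphN /=; ring.
rewrite (integralC_FTC (F := fun u => - (w * g n q k)^-1 * cexp (- g n q k * u%:C)) p0).
- rewrite mulr0 cexp0.
  have -> : cexp (- g n q k * (2 * pi)%:C) = 1 - w.
    rewrite (_ : _ * _ = lam n q * (2 * pi)%:C + 'i * ((- k)%:~R)%:C * (2 * pi)%:C); last first.
      by rewrite gE !rmorphN /=; ring.
    rewrite cexpD -expi_cexp expi2pi mulr1 cexp_lam //.
    rewrite (_ : n.-1%:R / 2 * (2 * pi) = pi * n.-1%:R); last by field.
    by rewrite expi_pi -rmorphM /w /symbol_denom rmorphB /= rmorph1 opprB addrC subrK mulrC.
  by move: (g n q k) g0 w0 => z z0 w0; field; rewrite z0 w0.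
- move=> t; rewrite (_ : w^-1 * _ = - (w * g n q k)^-1 * (- g n q k * cexp (- g n q k * t%:C))).
    by apply: cderivZ; exact: cderiv_cexp.
  move: (cexp (- g n q k * t%:C)) => c; move: (g n q k) g0 => z z0.
  by field; rewrite z0 w0.
- by move=> t; eexists; apply: cderivZ; exact: cderiv_cexp.
Qed.

End symbol.

Theorem corollary5p3 (R : realType) (n : nat) (q : R)
    (n_ge1 : (1 <= n)%N) (q_gt0 : 0 < q) :
  (forall (d : measure_display) (Omega : measurableType d)
     (P : probability Omega R) (x : int -> Omega -> n.-tuple R),
     stationary_markov_chain q P x ->
     determinantal P (point_process x) (space_time_kernel n q)) /\
  (q != 1 -> forall k : int,
     g n q k =
     (integralC `[0, 2 * pi]
        (fun u : R => symbol n q u * expi (- (u * k%:~R))))^-1).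
Proof.
split=> [d Omega P x chain p p0|q1 k]; last by rewrite symbol_integral // invrK.
exists (fun r => rho n q r); split; first exact: correlation_chain.
by move=> r; exact: det_space_time_ae.
Qed.
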